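(* Let $0<q<1$, $\delta=\frac{2\pi i}{\log q}$, let $0<z\le1$, and let $s\in\mathbb{C}$ with $\Re s<0$ and $s\ne -r+\delta l$ for all positive integers $r$ and nonzero integers $l$. Define $$\zeta^*(s,z:q)=\zeta(s,z:q)+\frac{(q-q^2)^s q^{-zs}}{\log q}\,\frac{\pi}{\sin\pi s}.$$ Then $$\zeta^*(s,z:q)=-\frac{1}{2\pi i}(q-q^2)^s q^{-zs}\,\Gamma(1-s)\sum_{l\ne0}\frac1l\,\frac{\Gamma(s+\delta l)}{\Gamma(\delta l)}e^{-2\pi i l z},$$ where $l$ runs over the nonzero integers.
   Context: $[x]_q=\frac{1-q^x}{1-q}$, and $\zeta(s,z:q)$ denotes the meromorphic continuation to the whole $s$-plane of $\sum_{k=0}^{\infty}q^{s(k+1)}/[k+z]_q^{\,s}$ (convergent for $\Re s>0$), with complex powers via the principal branch; $\Gamma$ is Euler's gamma function. *)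

(* Defs.v *)
From Stdlib Require Import Reals Arith ZArith.
From Coquelicot Require Import Coquelicot.
Open Scope R_scope.

Definition qnum (q x : R) : R := (1 - Rpower q x) / (1 - q).

Definition cexp (w : C) : C :=
  (exp (Re w) * cos (Im w), exp (Re w) * sin (Im w)).

Definition csin (w : C) : C :=
  ((cexp (Ci * w) - cexp (- (Ci * w))) / (2 * Ci))%C.

Definition cpowR (a : R) (s : C) : C := cexp (s * RtoC (ln a))%C.

Fixpoint poch (s : C) (n : nat) : C :=
  match n with
  | O => s
  | S m => (poch s m * (s + RtoC (INR (S m))))%C
  end.

(* Euler's Gamma function on C via Gauss' limit formula
   Gamma s = lim_{n -> oo} n^s n! / (s (s+1) ... (s+n))   (s not in -N) *)
Definition gauss_seq (s : C) (n : nat) : C :=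
  (cpowR (INR n) s * RtoC (INR (fact n)) / poch s n)%C.

Definition CGamma (s : C) : C :=
  @lim C_CompleteNormedModule (filtermap (gauss_seq s) eventually).

Definition qzeta_term (q z : R) (s : C) (k : nat) : C :=
  (cpowR q (s * RtoC (INR k + 1)) / cpowR (qnum q (INR k + z)) s)%C.

(* F is the meromorphic continuation to C of s |-> sum_k qzeta_term q z s k
   (convergent for Re s > 0):  F is holomorphic on an open set U whose
   complement P is discrete (hence closed and discrete), every point of P is
   a pole of F (|F w| -> +oo), and F agrees with the series on Re s > 0.
   Since C \ P is connected, such an F is unique on U. *)
Definition is_qzeta_continuation (q z : R) (F : C -> C) : Prop :=
  exists U : C -> Prop,
    (forall w, U w -> exists eps : posreal,
        forall v, Cmod (v - w) < eps -> U v) /\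
    (forall p, ~ U p -> exists eps : posreal,
        forall v, 0 < Cmod (v - p) < eps -> U v) /\
    (forall w, U w -> @ex_derive C_AbsRing C_NormedModule F w) /\
    (forall p, ~ U p ->
        filterlim (fun w => Cmod (F w))
          (within (fun w => w <> p) (locally p)) (Rbar_locally p_infty)) /\
    (forall s, 0 < Re s -> U s /\ is_series (qzeta_term q z s) (F s)).

Definition qzeta_corr (q z : R) (s : C) : C :=
  (cpowR (q - q ^ 2) s * cpowR q (- (RtoC z * s)) / RtoC (ln q)
     * (RtoC PI / csin (RtoC PI * s)))%C.

Definition qdelta (q : R) : C := (2 * RtoC PI * Ci / RtoC (ln q))%C.

Definition qzeta_summand (q z : R) (s : C) (l : Z) : C :=
  (/ RtoC (IZR l) * (CGamma (s + qdelta q * RtoC (IZR l))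
       / CGamma (qdelta q * RtoC (IZR l)))
   * cexp (- (2 * RtoC PI * Ci * RtoC (IZR l) * RtoC z)))%C.

(* the sum over l <> 0, grouped as terms l = n+1 and l = -(n+1), n >= 0
   (the series is absolutely convergent for Re s < 0) *)
Definition qzeta_pairs (q z : R) (s : C) (n : nat) : C :=
  (qzeta_summand q z s (Z.of_nat (S n)) + qzeta_summand q z s (- Z.of_nat (S n)))%C.

(* Main.v *)
Require Import Defs.
From Stdlib Require Import Reals Lra Lia ZArith Classical.
From Coquelicot Require Import Coquelicot.

(* Expand (1 - q^(k+z))^(-s) by the binomial series and sum over k: with
   b_r(s) = s (s+1) ... (s+r-1) / r! this continues zeta(s,z:q) as
     (q - q^2)^s sum_r b_r(s) q^(zr) / (1 - q^(s+r)),
   and by the identity theorem every continuation F agrees with it off the poles.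
   For Re s < 0 the series sum_r b_r(s) converges absolutely (Raabe). The Fourier
   series of exponentials in z writes q^(z(s+r)) / (1 - q^(s+r)) as a symmetric sum
   of e^(2 pi i n z) / (s + r - delta n) over n. Its n = 0 terms add up to
   sum_r b_r(s) / (s+r) = Gamma(s) Gamma(1-s) = pi / sin(pi s), which the correction
   term cancels; the other ones, exchanging the sums over n and r, add up to the
   right-hand side by the beta series
     sum_r b_r(s) / (s+r+x) = Gamma(s+x) Gamma(1-s) / Gamma(1+x). *)

(** Three obstacles shape the argument. First, the continuation is an arbitrary [F], so the identity
    theorem has to tolerate isolated singularities everywhere; it is built from Goursat's theorem on
    rectangles and exponential coordinates alone, without Cauchy's formula or power series
    expansions. Secondly, the Fourier sums converge only conditionally. Their exchange with the sum
    over r rests on a bound of the partial sums that is uniform in r; it holds because c = (w + r) /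
    delta moves up a vertical line and stays at a distance of order n + r from the integers n and
    -n. At z = 1 the symmetric sum gives the mean of two one-sided values, hence an error that does
    not depend on c; it gets multiplied by sum_r b_r(s) = 0. Thirdly, at s = -1, -2, ... both zeta
    and the correction have poles. The double sum without its n = 0 terms is regular there, so the
    identity is proved at nearby w and carried to s by continuity. *)

Lemma RtoC_neq (x y : R) : x <> y -> RtoC x <> RtoC y.
Proof. intros H E. apply H. exact (RtoC_inj _ _ E). Qed.

Ltac C_nz := apply RtoC_neq; lra.

Lemma Cmod_minus_sym (x y : C) : Cmod (x - y) = Cmod (y - x).
Proof. rewrite <- (Cmod_opp (x - y)%C). f_equal. ring. Qed.

Lemma Cmod_minus_triangle (x y : C) : Cmod (x - y) <= Cmod x + Cmod y.
Proof.
  replace (x - y)%C with (x + - y)%C by ring.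
  rewrite <- (Cmod_opp y). apply Cmod_triangle.
Qed.

Lemma Cmod_triangle_rev (x y : C) : Cmod x - Cmod y <= Cmod (x - y).
Proof.
  generalize (Cmod_triangle (x - y) y).
  replace (x - y + y)%C with x by ring. lra.
Qed.

Lemma im_le_Cmod (c : C) : Rabs (Im c) <= Cmod c.
Proof.
  apply Rle_trans with (2 := Rmax_Cmod c). apply Rmax_r.
Qed.

Lemma Cmod_le_components (c : C) : Cmod c <= Rabs (Re c) + Rabs (Im c).
Proof.
  replace c with (RtoC (Re c) + Ci * RtoC (Im c))%C at 1.
  - apply Rle_trans with (1 := Cmod_triangle _ _).
    rewrite Cmod_mult, Cmod_Ci, !Cmod_R. lra.
  - destruct c as [a b]; unfold RtoC, Ci, Cplus, Cmult, Re, Im; simpl.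
    f_equal; ring.
Qed.

Lemma Re_plus (x y : C) : Re (x + y) = Re x + Re y.
Proof. reflexivity. Qed.
Lemma Im_plus (x y : C) : Im (x + y) = Im x + Im y.
Proof. reflexivity. Qed.
Lemma Re_minus (x y : C) : Re (x - y) = Re x - Re y.
Proof. reflexivity. Qed.
Lemma Im_minus (x y : C) : Im (x - y) = Im x - Im y.
Proof. reflexivity. Qed.
Lemma Re_opp (x : C) : Re (- x) = - Re x.
Proof. reflexivity. Qed.
Lemma Re_mult (x y : C) : Re (x * y) = Re x * Re y - Im x * Im y.
Proof. reflexivity. Qed.
Lemma Im_mult (x y : C) : Im (x * y) = Re x * Im y + Im x * Re y.
Proof. reflexivity. Qed.
Lemma C_ext (x y : C) : Re x = Re y -> Im x = Im y -> x = y.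
Proof. destruct x, y; unfold Re, Im; simpl; intros; f_equal; auto. Qed.

(** * Limits in the complex plane *)

Section Limits.
Context {T : Type} {F : (T -> Prop) -> Prop} {FF : Filter F}.

(** Neighbourhoods in C come from the product structure, whose balls are squares; the equivalence of
    norms turns them into discs for [Cmod]. *)
Lemma clim_spec (f : T -> C) (l : C) :
  filterlim f F (locally l) <->
  forall eps, 0 < eps -> F (fun t => Cmod (f t - l) < eps).
Proof.
  split.
  - intros H eps He.
    refine (H (fun v => Cmod (v - l) < eps) _).
    apply (locally_le_locally_norm (K := C_AbsRing) (V := C_NormedModule)).
    exists (mkposreal eps He). intros v Hv. exact Hv.
  - intros H P HP.
    apply (locally_norm_le_locally (K := C_AbsRing) (V := C_NormedModule)) in HP.
    destruct HP as [eps He].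
    unfold filtermap. generalize (H eps (cond_pos eps)).
    apply filter_imp. intros t Ht. apply He. exact Ht.
Qed.

Lemma clim_const (c : C) : filterlim (fun _ : T => c) F (locally c).
Proof. apply filterlim_const. Qed.

Lemma clim_plus (f g : T -> C) (a b : C) :
  filterlim f F (locally a) -> filterlim g F (locally b) ->
  filterlim (fun t => f t + g t)%C F (locally (a + b)%C).
Proof.
  rewrite !clim_spec. intros Hf Hg eps He.
  generalize (filter_and (F := F) _ _ (Hf (eps / 2) ltac:(lra)) (Hg (eps / 2) ltac:(lra))).
  apply filter_imp. intros t [H1 H2].
  replace (f t + g t - (a + b))%C with ((f t - a) + (g t - b))%C by ring.
  apply Rle_lt_trans with (1 := Cmod_triangle _ _). lra.
Qed.

Lemma clim_mult (f g : T -> C) (a b : C) :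
  filterlim f F (locally a) -> filterlim g F (locally b) ->
  filterlim (fun t => f t * g t)%C F (locally (a * b)%C).
Proof.
  rewrite !clim_spec. intros Hf Hg eps He.
  pose proof (Cmod_ge_0 a) as Ha. pose proof (Cmod_ge_0 b) as Hb.
  set (d := Rmin 1 (eps / (Cmod a + Cmod b + 1))).
  assert (Hd : 0 < d).
  { unfold d. apply Rmin_glb_lt. lra. apply Rdiv_lt_0_compat; lra. }
  assert (Hd1 : d <= 1) by apply Rmin_l.
  assert (Hd2 : d * (Cmod a + Cmod b + 1) <= eps).
  { apply Rle_trans with (eps / (Cmod a + Cmod b + 1) * (Cmod a + Cmod b + 1)).
    apply Rmult_le_compat_r. lra. apply Rmin_r.
    right. field. lra. }
  generalize (filter_and (F := F) _ _ (Hf d Hd) (Hg d Hd)).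
  apply filter_imp. intros t [H1 H2].
  replace (f t * g t - a * b)%C
    with ((f t - a) * (g t - b) + (a * (g t - b) + (f t - a) * b))%C by ring.
  apply Rle_lt_trans with (1 := Cmod_triangle _ _).
  pose proof (Cmod_triangle (a * (g t - b)) ((f t - a) * b)) as H3.
  rewrite !Cmod_mult in H3. rewrite Cmod_mult.
  pose proof (Cmod_ge_0 (f t - a)). pose proof (Cmod_ge_0 (g t - b)).
  set (x := Cmod (f t - a)) in *. set (y := Cmod (g t - b)) in *.
  assert (x * y < d * 1) by nra.
  assert (Cmod a * y <= Cmod a * d) by nra.
  assert (x * Cmod b <= d * Cmod b) by nra.
  nra.
Qed.

Lemma clim_opp (f : T -> C) (a : C) :
  filterlim f F (locally a) -> filterlim (fun t => - f t)%C F (locally (- a)%C).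
Proof.
  rewrite !clim_spec. intros Hf eps He. generalize (Hf eps He).
  apply filter_imp. intros t. 
  replace (- f t - - a)%C with (- (f t - a))%C by ring. now rewrite Cmod_opp.
Qed.

Lemma clim_minus (f g : T -> C) (a b : C) :
  filterlim f F (locally a) -> filterlim g F (locally b) ->
  filterlim (fun t => f t - g t)%C F (locally (a - b)%C).
Proof. intros Hf Hg. apply clim_plus. exact Hf. now apply clim_opp. Qed.

Lemma clim_inv (f : T -> C) (a : C) : a <> 0 ->
  filterlim f F (locally a) -> filterlim (fun t => / f t)%C F (locally (/ a)%C).
Proof.
  rewrite !clim_spec. intros Ha Hf eps He.
  assert (Hm : 0 < Cmod a) by now apply Cmod_gt_0.
  set (d := Rmin (Cmod a / 2) (eps * (Cmod a * Cmod a / 2))).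
  assert (Hd : 0 < d).
  { unfold d. apply Rmin_glb_lt. lra. apply Rmult_lt_0_compat; nra. }
  generalize (Hf d Hd). apply filter_imp. intros t Ht.
  assert (H1 : Cmod a / 2 <= Cmod (f t)).
  { pose proof (Cmod_triangle_rev a (f t)). rewrite Cmod_minus_sym in H.
    assert (d <= Cmod a / 2) by apply Rmin_l. lra. }
  assert (Hft : f t <> 0) by (apply Cmod_gt_0; lra).
  replace (/ f t - / a)%C with (- ((f t - a) * / (f t * a)))%C
    by (field; auto).
  rewrite Cmod_opp, Cmod_mult, Cmod_inv, Cmod_mult by now apply Cmult_neq_0.
  assert (Hd2 : d <= eps * (Cmod a * Cmod a / 2)) by apply Rmin_r.
  assert (0 < Cmod (f t) * Cmod a) by nra.
  apply Rmult_lt_reg_r with (Cmod (f t) * Cmod a). assumption.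
  replace (Cmod (f t - a) * / (Cmod (f t) * Cmod a) * (Cmod (f t) * Cmod a))
    with (Cmod (f t - a)) by (field; lra).
  apply Rlt_le_trans with d. exact Ht.
  apply Rle_trans with (1 := Hd2). apply Rmult_le_compat_l. lra. nra.
Qed.

Lemma clim_div (f g : T -> C) (a b : C) : b <> 0 ->
  filterlim f F (locally a) -> filterlim g F (locally b) ->
  filterlim (fun t => f t / g t)%C F (locally (a / b)%C).
Proof. intros Hb Hf Hg. apply clim_mult. exact Hf. now apply clim_inv. Qed.

Lemma clim_eq (f : T -> C) (a b : C) :
  filterlim f F (locally a) -> a = b -> filterlim f F (locally b).
Proof. now intros H <-. Qed.

Lemma clim_ext (f g : T -> C) (l : C) :
  (forall t, f t = g t) -> filterlim f F (locally l) -> filterlim g F (locally l).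
Proof. intros H. now apply filterlim_ext. Qed.

Lemma clim_ext_loc (f g : T -> C) (l : C) :
  F (fun t => f t = g t) -> filterlim f F (locally l) -> filterlim g F (locally l).
Proof. intros H. now apply filterlim_ext_loc. Qed.

End Limits.

Section ProperLimits.
Context {T : Type} {F : (T -> Prop) -> Prop} {FF : ProperFilter F}.

Lemma clim_unique (f : T -> C) (a b : C) :
  filterlim f F (locally a) -> filterlim f F (locally b) -> a = b.
Proof.
  apply (filterlim_locally_unique (K := C_AbsRing) (V := C_NormedModule) (F := F)).
Qed.

Lemma clim_le (f : T -> C) (l : C) (M : R) :
  filterlim f F (locally l) -> F (fun t => Cmod (f t) <= M) -> Cmod l <= M.
Proof.
  intros Hf HM. apply Rnot_lt_le. intros Hlt.
  assert (H := proj1 (clim_spec f l) Hf (Cmod l - M) ltac:(lra)).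
  destruct (filter_ex (F := F) _ (filter_and _ _ HM H)) as [t [H1 H2]].
  pose proof (Cmod_triangle_rev l (f t)). rewrite Cmod_minus_sym in H0. lra.
Qed.

End ProperLimits.

Lemma clim_seq_spec (u : nat -> C) (l : C) :
  filterlim u eventually (locally l) <->
  forall eps, 0 < eps -> exists N, forall n, (N <= n)%nat -> Cmod (u n - l) < eps.
Proof. exact (clim_spec (F := eventually) u l). Qed.

Lemma clim_incr_1 (u : nat -> C) (l : C) :
  filterlim (fun n => u (S n)) eventually (locally l) <->
  filterlim u eventually (locally l).
Proof.
  rewrite !clim_seq_spec. split; intros H eps He; destruct (H eps He) as [N HN].
  - exists (S N). intros [|n] Hn. lia. apply HN. lia.
  - exists N. intros n Hn. apply HN. lia.
Qed.

Lemma locally_C_spec (w : C) (P : C -> Prop) :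
  locally w P <-> exists eps, 0 < eps /\ forall v, Cmod (v - w) < eps -> P v.
Proof.
  split.
  - intros HP.
    apply (locally_norm_le_locally (K := C_AbsRing) (V := C_NormedModule)) in HP.
    destruct HP as [eps He]. exists eps. split. apply cond_pos.
    intros v Hv. apply He. exact Hv.
  - intros [eps [He H]].
    apply (locally_le_locally_norm (K := C_AbsRing) (V := C_NormedModule)).
    exists (mkposreal eps He). intros v Hv. apply H. exact Hv.
Qed.

(** * Series of complex numbers *)

(** The upper index is excluded, so inductions start from the empty sum; [csum_sum_n] accounts for
    the shift by one against [sum_n]. *)
Fixpoint csum (a : nat -> C) (n : nat) : C :=
  match n with O => 0 | S m => (csum a m + a m)%C end.

Fixpoint rsum (a : nat -> R) (n : nat) : R :=
  match n with O => 0 | S m => rsum a m + a m end.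

(** Meant for majorants: absolute convergence is always expressed as domination by such an M, so
    that one M can serve a whole family of series. *)
Definition summable (M : nat -> R) : Prop :=
  (forall n, 0 <= M n) /\ exists B, forall n, rsum M n <= B.

(** A total function, also applied to the conditionally convergent Fourier sums, whose value is
    supplied through [CS_unique]. *)
Definition CS (a : nat -> C) : C :=
  (Series (fun n => Re (a n)), Series (fun n => Im (a n))).

Lemma csum_S (a : nat -> C) (n : nat) : csum a (S n) = (csum a n + a n)%C.
Proof. reflexivity. Qed.

Lemma csum_ext (a b : nat -> C) (n : nat) :
  (forall k, (k < n)%nat -> a k = b k) -> csum a n = csum b n.
Proof.
  induction n as [|n IH]; intros H; simpl. reflexivity.
  rewrite IH by (intros; apply H; lia). now rewrite H by lia.
Qed.

Lemma csum_plus (a b : nat -> C) (n : nat) :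
  csum (fun k => a k + b k)%C n = (csum a n + csum b n)%C.
Proof. induction n as [|n IH]; simpl. ring. rewrite IH. ring. Qed.

Lemma csum_scal (c : C) (a : nat -> C) (n : nat) :
  csum (fun k => c * a k)%C n = (c * csum a n)%C.
Proof. induction n as [|n IH]; simpl. ring. rewrite IH. ring. Qed.

Lemma csum_head (a : nat -> C) (n : nat) :
  csum a (S n) = (a O + csum (fun k => a (S k)) n)%C.
Proof.
  induction n as [|n IH]. simpl; ring.
  change (csum a (S (S n))) with (csum a (S n) + a (S n))%C.
  rewrite IH. simpl. ring.
Qed.

Lemma csum_bound (a : nat -> C) (M : nat -> R) (n : nat) :
  (forall k, (k < n)%nat -> Cmod (a k) <= M k) -> Cmod (csum a n) <= rsum M n.
Proof.
  induction n as [|n IH]; intros H; simpl. rewrite Cmod_0. lra.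
  apply Rle_trans with (1 := Cmod_triangle _ _).
  apply Rplus_le_compat. apply IH. intros; apply H; lia. apply H; lia.
Qed.

Lemma csum_bound_diff (a : nat -> C) (M : nat -> R) (n m : nat) : (n <= m)%nat ->
  (forall k, Cmod (a k) <= M k) -> Cmod (csum a m - csum a n) <= rsum M m - rsum M n.
Proof.
  intros Hnm H. induction Hnm as [|m Hm IH].
  - replace (csum a n - csum a n)%C with (RtoC 0) by ring. rewrite Cmod_0. lra.
  - simpl. replace (csum a m + a m - csum a n)%C
      with ((csum a m - csum a n) + a m)%C by ring.
    apply Rle_trans with (1 := Cmod_triangle _ _). specialize (H m). lra.
Qed.

Lemma rsum_le (a b : nat -> R) (n : nat) :
  (forall k, (k < n)%nat -> a k <= b k) -> rsum a n <= rsum b n.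
Proof.
  induction n as [|n IH]; intros H; simpl. lra.
  apply Rplus_le_compat. apply IH; intros; apply H; lia. apply H; lia.
Qed.

Lemma rsum_mono (M : nat -> R) (n m : nat) : (n <= m)%nat ->
  (forall k, 0 <= M k) -> rsum M n <= rsum M m.
Proof.
  intros Hnm H. induction Hnm as [|m Hm IH]. lra. simpl. specialize (H m). lra.
Qed.

Lemma rsum_scal (c : R) (a : nat -> R) (n : nat) :
  rsum (fun k => c * a k) n = c * rsum a n.
Proof. induction n as [|n IH]; simpl. ring. rewrite IH. ring. Qed.

Lemma summable_scal (c : R) (M : nat -> R) :
  0 <= c -> summable M -> summable (fun n => c * M n).
Proof.
  intros Hc [H0 [B HB]]. split.
  - intros n. specialize (H0 n). nra.
  - exists (c * B). intros n. rewrite rsum_scal. specialize (HB n). nra.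
Qed.

Lemma summable_le (a M : nat -> R) :
  (forall n, 0 <= a n <= M n) -> summable M -> summable a.
Proof.
  intros H [H0 [B HB]]. split. intros n; apply H.
  exists B. intros n. apply Rle_trans with (2 := HB n). apply rsum_le.
  intros; apply H.
Qed.

(** The terms from J on add up to at most [T J]. The ratio test, the inverse squares and Raabe's
    test are all obtained by choosing T. *)
Lemma summable_telescope (M T : nat -> R) (J : nat) :
  (forall n, 0 <= M n) -> (forall n, 0 <= T n) ->
  (forall n, (J <= n)%nat -> M n <= T n - T (S n)) -> summable M.
Proof.
  intros HM HT H. split. assumption.
  exists (rsum M J + T J).
  assert (H1 : forall n, (J <= n)%nat -> rsum M n <= rsum M J + T J - T n).
  { intros n Hn. induction Hn as [|n Hn IH]. lra.
    simpl. specialize (H n Hn). lra. }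
  intros n. destruct (Nat.le_gt_cases J n) as [Hn|Hn].
  - specialize (H1 n Hn). specialize (HT n). lra.
  - pose proof (rsum_mono M n J ltac:(lia) HM). specialize (HT J). lra.
Qed.

Lemma summable_ratio (M : nat -> R) (J : nat) (k : R) :
  k < 1 -> (forall n, 0 <= M n) ->
  (forall n, (J <= n)%nat -> M (S n) <= k * M n) -> summable M.
Proof.
  intros Hk HM H. apply summable_telescope with (fun n => M n / (1 - k)) J.
  - assumption.
  - intros n. apply Rdiv_le_0_compat. apply HM. lra.
  - intros n Hn. specialize (H n Hn).
    apply Rmult_le_reg_r with (1 - k). lra.
    replace ((M n / (1 - k) - M (S n) / (1 - k)) * (1 - k)) with (M n - M (S n))
      by (field; lra). lra.
Qed.

Lemma rsum_lim (M : nat -> R) : summable M ->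
  exists l, (forall n, rsum M n <= l) /\
    forall eps, 0 < eps -> exists N, forall n, (N <= n)%nat -> l - rsum M n < eps.
Proof.
  intros [H0 [B HB]].
  destruct (completeness (fun x => exists n, x = rsum M n)) as [l [Hl1 Hl2]].
  - exists B. intros x [n ->]. apply HB.
  - exists (rsum M 0). now exists O.
  - exists l. split.
    + intros n. apply Hl1. now exists n.
    + intros eps He. apply NNPP. intros Hn.
      assert (l <= l - eps); [|lra].
      apply Hl2. intros x [n ->]. apply Rnot_lt_le. intros Hlt.
      apply Hn. exists n. intros m Hm.
      pose proof (rsum_mono M n m Hm H0). lra.
Qed.

Lemma csum_sum_n (a : nat -> C) (n : nat) :
  csum a (S n) = @sum_n C_NormedModule a n.
Proof.
  induction n as [|n IH].
  - rewrite sum_O. simpl. ring.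
  - rewrite sum_Sn, <- IH. reflexivity.
Qed.

Lemma is_series_csum (a : nat -> C) (l : C) :
  @is_series C_AbsRing C_NormedModule a l <-> filterlim (csum a) eventually (locally l).
Proof.
  rewrite <- clim_incr_1. unfold is_series. split; intros H.
  - apply clim_ext with (2 := H). intros n. symmetry. apply csum_sum_n.
  - apply clim_ext with (2 := H). intros n. apply csum_sum_n.
Qed.

Lemma Re_csum (a : nat -> C) (n : nat) :
  Re (csum a (S n)) = sum_n (fun k => Re (a k)) n.
Proof.
  induction n as [|n IH].
  - rewrite sum_O. simpl csum. rewrite Re_plus, re_RtoC. apply Rplus_0_l.
  - rewrite sum_Sn, <- IH. reflexivity.
Qed.

Lemma Im_csum (a : nat -> C) (n : nat) :
  Im (csum a (S n)) = sum_n (fun k => Im (a k)) n.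
Proof.
  induction n as [|n IH].
  - rewrite sum_O. simpl csum. rewrite Im_plus, im_RtoC. apply Rplus_0_l.
  - rewrite sum_Sn, <- IH. reflexivity.
Qed.

Lemma CS_unique (a : nat -> C) (l : C) :
  filterlim (csum a) eventually (locally l) -> CS a = l.
Proof.
  intros H. apply clim_incr_1 in H. rewrite clim_seq_spec in H.
  apply C_ext; unfold CS; simpl.
  - apply is_series_unique. apply (is_lim_seq_spec _ (Re l)). intros eps.
    destruct (H eps (cond_pos eps)) as [N HN]. exists N. intros n Hn.
    rewrite <- Re_csum. apply Rle_lt_trans with (2 := HN n Hn).
    apply (re_le_Cmod (csum a (S n) - l)).
  - apply is_series_unique. apply (is_lim_seq_spec _ (Im l)). intros eps.
    destruct (H eps (cond_pos eps)) as [N HN]. exists N. intros n Hn.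
    rewrite <- Im_csum. apply Rle_lt_trans with (2 := HN n Hn).
    apply (im_le_Cmod (csum a (S n) - l)).
Qed.

Lemma clim_components (u : nat -> C) (x y : R) :
  is_lim_seq (fun n => Re (u n)) x -> is_lim_seq (fun n => Im (u n)) y ->
  filterlim u eventually (locally (x, y)).
Proof.
  intros Hx Hy. apply clim_seq_spec. intros eps He.
  apply is_lim_seq_spec in Hx. apply is_lim_seq_spec in Hy.
  destruct (Hx (mkposreal (eps / 2) ltac:(lra))) as [N1 H1].
  destruct (Hy (mkposreal (eps / 2) ltac:(lra))) as [N2 H2].
  exists (max N1 N2). intros n Hn. simpl in *.
  specialize (H1 n ltac:(lia)). specialize (H2 n ltac:(lia)).
  apply Rle_lt_trans with (1 := Cmod_le_components _).
  change (Rabs (Re (u n) - x) + Rabs (Im (u n) - y) < eps). lra.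
Qed.

Lemma cauchy_converges (u : nat -> C) :
  (forall eps, 0 < eps -> exists N, forall n m, (N <= n)%nat -> (N <= m)%nat ->
     Cmod (u n - u m) < eps) ->
  exists l : C, filterlim u eventually (locally l).
Proof.
  intros H.
  assert (HR : ex_finite_lim_seq (fun n => Re (u n))).
  { apply ex_lim_seq_cauchy_corr. intros eps. destruct (H eps (cond_pos eps)) as [N HN].
    exists N. intros n m Hn Hm. apply Rle_lt_trans with (2 := HN n m Hn Hm).
    apply (re_le_Cmod (u n - u m)). }
  assert (HI : ex_finite_lim_seq (fun n => Im (u n))).
  { apply ex_lim_seq_cauchy_corr. intros eps. destruct (H eps (cond_pos eps)) as [N HN].
    exists N. intros n m Hn Hm. apply Rle_lt_trans with (2 := HN n m Hn Hm).
    apply (im_le_Cmod (u n - u m)). }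
  destruct HR as [x Hx], HI as [y Hy]. exists (x, y). now apply clim_components.
Qed.

(** The index N is chosen before the series a: the tail is controlled by M alone. This uniformity is
    what [CS_dominated] needs. *)
Lemma CS_tail (M : nat -> R) : summable M -> forall eps, 0 < eps ->
  exists N, forall a, (forall n, Cmod (a n) <= M n) ->
    forall n, (N <= n)%nat -> Cmod (CS a - csum a n) <= eps.
Proof.
  intros HM eps He. destruct (rsum_lim M HM) as [l [Hl1 Hl2]].
  destruct (Hl2 eps He) as [N HN]. exists N. intros a Ha n Hn.
  assert (Hex : exists s : C, filterlim (csum a) eventually (locally s)).
  { apply cauchy_converges. intros e Hee. destruct (Hl2 e Hee) as [K HK].
    exists K.
    assert (HH : forall i j, (K <= i)%nat -> (i <= j)%nat -> Cmod (csum a j - csum a i) < e).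
    { intros i j Hi Hj. apply Rle_lt_trans with (1 := csum_bound_diff a M i j Hj Ha).
      specialize (HK i Hi). specialize (Hl1 j). lra. }
    intros i j Hi Hj. destruct (Nat.le_ge_cases i j).
    rewrite Cmod_minus_sym. now apply HH. now apply HH. }
  destruct Hex as [s Hs]. rewrite (CS_unique a s Hs).
  apply (clim_le (F := eventually) (fun m => csum a m - csum a n)%C).
  - apply clim_minus. exact Hs. apply clim_const.
  - exists n. intros m Hm. apply Rle_trans with (1 := csum_bound_diff a M n m Hm Ha).
    specialize (HN n Hn). specialize (Hl1 m). lra.
Qed.

Lemma CS_lim (a : nat -> C) (M : nat -> R) : summable M ->
  (forall n, Cmod (a n) <= M n) -> filterlim (csum a) eventually (locally (CS a)).
Proof.
  intros HM Ha. apply clim_seq_spec. intros eps He.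
  destruct (CS_tail M HM (eps / 2) ltac:(lra)) as [N HN].
  exists N. intros n Hn. rewrite Cmod_minus_sym.
  specialize (HN a Ha n Hn). lra.
Qed.

Lemma CS_bound (a : nat -> C) (M : nat -> R) (B : R) : summable M ->
  (forall n, Cmod (a n) <= M n) -> (forall n, rsum M n <= B) -> Cmod (CS a) <= B.
Proof.
  intros HM Ha HB.
  apply (clim_le (F := eventually) (csum a)). now apply CS_lim with M.
  exists O. intros n _. apply Rle_trans with (2 := HB n).
  apply csum_bound. auto.
Qed.

Lemma CS_ext (a b : nat -> C) : (forall n, a n = b n) -> CS a = CS b.
Proof.
  intros H. unfold CS. f_equal; apply Series_ext; intros n; now rewrite H.
Qed.

Lemma CS_plus (a b : nat -> C) (M N : nat -> R) : summable M -> summable N ->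
  (forall n, Cmod (a n) <= M n) -> (forall n, Cmod (b n) <= N n) ->
  CS (fun n => a n + b n)%C = (CS a + CS b)%C.
Proof.
  intros HM HN Ha Hb. apply CS_unique.
  apply clim_ext with (fun n => csum a n + csum b n)%C.
  - intros n. symmetry. apply csum_plus.
  - apply clim_plus. now apply CS_lim with M. now apply CS_lim with N.
Qed.

Lemma CS_scal (c : C) (a : nat -> C) (M : nat -> R) : summable M ->
  (forall n, Cmod (a n) <= M n) -> CS (fun n => c * a n)%C = (c * CS a)%C.
Proof.
  intros HM Ha. apply CS_unique.
  apply clim_ext with (fun n => c * csum a n)%C.
  - intros n. symmetry. apply csum_scal.
  - apply clim_mult. apply clim_const. now apply CS_lim with M.
Qed.

Lemma clim_csum {T : Type} {F : (T -> Prop) -> Prop} {FF : Filter F}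
  (f : T -> nat -> C) (a : nat -> C) (n : nat) :
  (forall k, (k < n)%nat -> filterlim (fun t => f t k) F (locally (a k))) ->
  filterlim (fun t => csum (f t) n) F (locally (csum a n)).
Proof.
  induction n as [|n IH]; intros H; simpl.
  - apply clim_const.
  - apply clim_plus. apply IH; intros; apply H; lia. apply H; lia.
Qed.

(** Tannery's theorem along an arbitrary proper filter: one cut-off N from [CS_tail] serves every t
    and the limit, and only a finite sum is left to converge. *)
Lemma CS_dominated {T : Type} {F : (T -> Prop) -> Prop} {FF : ProperFilter F}
  (f : T -> nat -> C) (a : nat -> C) (M : nat -> R) : summable M ->
  F (fun t => forall n, Cmod (f t n) <= M n) ->
  (forall n, filterlim (fun t => f t n) F (locally (a n))) ->
  filterlim (fun t => CS (f t)) F (locally (CS a)).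
Proof.
  intros HM Hf Hl.
  assert (Ha : forall n, Cmod (a n) <= M n).
  { intros n. apply (clim_le _ _ _ (Hl n)). revert Hf. apply filter_imp. auto. }
  apply clim_spec. intros eps He.
  destruct (CS_tail M HM (eps / 4) ltac:(lra)) as [N HN].
  assert (H1 := clim_csum f a N (fun k _ => Hl k)).
  rewrite clim_spec in H1. specialize (H1 (eps / 4) ltac:(lra)).
  generalize (filter_and (F := F) _ _ Hf H1). apply filter_imp. intros t [H2 H3].
  replace (CS (f t) - CS a)%C with
    ((CS (f t) - csum (f t) N) + ((csum (f t) N - csum a N) + - (CS a - csum a N)))%C by ring.
  apply Rle_lt_trans with (1 := Cmod_triangle _ _).
  pose proof (Cmod_triangle (csum (f t) N - csum a N) (- (CS a - csum a N))) as H4.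
  rewrite Cmod_opp in H4.
  pose proof (HN (f t) H2 N (le_n _)). pose proof (HN a Ha N (le_n _)). lra.
Qed.

(** * Complex derivatives *)

Definition Cderiv (f : C -> C) (w d : C) : Prop :=
  @is_derive C_AbsRing C_NormedModule f w d.

Lemma cderiv_spec (f : C -> C) (w d : C) :
  Cderiv f w d <->
  forall eps, 0 < eps -> exists del, 0 < del /\ forall v, Cmod (v - w) < del ->
    Cmod (f v - f w - d * (v - w)) <= eps * Cmod (v - w).
Proof.
  split.
  - intros [_ H] eps He.
    assert (H1 := H w (fun P HP => HP) (mkposreal eps He)).
    apply locally_C in H1. apply locally_C_spec in H1. destruct H1 as [del [Hd H2]].
    exists del. split. exact Hd. intros v Hv. specialize (H2 v Hv).
    replace (f v - f w - d * (v - w))%C with (f v - f w - (v - w) * d)%C by ring.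
    exact H2.
  - intros H. split.
    + apply (is_linear_scal_l (K := C_AbsRing) (V := C_NormedModule)).
    + intros x Hx eps.
      assert (Hxw : w = x) by
        (apply (is_filter_lim_locally_unique (K := C_AbsRing) (V := AbsRing_NormedModule C_AbsRing)); exact Hx).
      subst x.
      apply locally_C. apply locally_C_spec. destruct (H eps (cond_pos eps)) as [del [Hd H2]].
      exists del. split. exact Hd. intros v Hv. specialize (H2 v Hv).
      change (Cmod (f v - f w - (v - w) * d) <= eps * Cmod (v - w)).
      replace (f v - f w - (v - w) * d)%C with (f v - f w - d * (v - w))%C by ring.
      exact H2.
Qed.

(* Coquelicot carries two distinct normed-module structures on C: as a product
   (C_NormedModule) and as an absolute ring; they have the same derivatives. *)
Lemma cderiv_AbsRing (f : C -> C) (w d : C) :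
  Cderiv f w d <-> @is_derive C_AbsRing (AbsRing_NormedModule C_AbsRing) f w d.
Proof.
  split; intros [_ H]; split; [|exact H| |exact H].
  - apply (is_linear_scal_l (K := C_AbsRing) (V := AbsRing_NormedModule C_AbsRing)).
  - apply (is_linear_scal_l (K := C_AbsRing) (V := C_NormedModule)).
Qed.

Lemma cderiv_eq (f : C -> C) (w d d' : C) : Cderiv f w d -> d = d' -> Cderiv f w d'.
Proof. now intros H <-. Qed.

Lemma cderiv_ext_loc (f g : C -> C) (w d : C) :
  locally w (fun v => f v = g v) -> Cderiv f w d -> Cderiv g w d.
Proof.
  intros H. apply (is_derive_ext_loc (K := C_AbsRing) (V := C_NormedModule)).
  now apply locally_C.
Qed.

Lemma cderiv_const (c w : C) : Cderiv (fun _ => c) w 0.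
Proof. apply (is_derive_const (K := C_AbsRing) (V := C_NormedModule)). Qed.

Lemma cderiv_id (w : C) : Cderiv (fun v => v) w 1.
Proof. apply cderiv_AbsRing. apply (is_derive_id (K := C_AbsRing)). Qed.

Lemma cderiv_plus (f g : C -> C) (w df dg : C) :
  Cderiv f w df -> Cderiv g w dg -> Cderiv (fun v => f v + g v)%C w (df + dg)%C.
Proof. apply (is_derive_plus (K := C_AbsRing) (V := C_NormedModule)). Qed.

Lemma cderiv_mult (f g : C -> C) (w df dg : C) :
  Cderiv f w df -> Cderiv g w dg ->
  Cderiv (fun v => f v * g v)%C w (df * g w + f w * dg)%C.
Proof.
  rewrite !cderiv_AbsRing. intros Hf Hg.
  apply (is_derive_mult (K := C_AbsRing) f g w df dg Hf Hg).
  intros n m. apply Cmult_comm.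
Qed.

Lemma cderiv_scal (c : C) (f : C -> C) (w df : C) :
  Cderiv f w df -> Cderiv (fun v => c * f v)%C w (c * df)%C.
Proof.
  intros Hf. apply cderiv_eq with (0 * f w + c * df)%C.
  apply cderiv_mult. apply cderiv_const. exact Hf. ring.
Qed.

Lemma cderiv_opp (f : C -> C) (w df : C) :
  Cderiv f w df -> Cderiv (fun v => - f v)%C w (- df)%C.
Proof. apply (is_derive_opp (K := C_AbsRing) (V := C_NormedModule)). Qed.

Lemma cderiv_minus (f g : C -> C) (w df dg : C) :
  Cderiv f w df -> Cderiv g w dg -> Cderiv (fun v => f v - g v)%C w (df - dg)%C.
Proof. apply (is_derive_minus (K := C_AbsRing) (V := C_NormedModule)). Qed.

Lemma cderiv_comp (f g : C -> C) (w df dg : C) :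
  Cderiv f (g w) df -> Cderiv g w dg -> Cderiv (fun v => f (g v)) w (dg * df)%C.
Proof.
  intros Hf Hg. apply cderiv_AbsRing in Hg.
  exact (is_derive_comp (K := C_AbsRing) (V := C_NormedModule) f g w df dg Hf Hg).
Qed.

Lemma cderiv_continuous (f : C -> C) (w d : C) :
  Cderiv f w d -> filterlim f (locally w) (locally (f w)).
Proof.
  intros H P HP. apply locally_C.
  refine (ex_derive_continuous (K := C_AbsRing) (V := C_NormedModule) f w _ P HP).
  now exists d.
Qed.

(** Quadratic remainders are preferred to plain differentiability because they can be summed term by
    term; inverse, exponential and series all pass through this lemma. *)
Lemma cderiv_second_order (f : C -> C) (w d : C) (eps M : R) : 0 < eps ->
  (forall v, Cmod (v - w) < eps ->
     Cmod (f v - f w - d * (v - w)) <= M * Cmod (v - w) ^ 2) -> Cderiv f w d.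
Proof.
  intros He H. apply cderiv_spec. intros e Hee.
  assert (Hm : 0 < Rabs M + 1) by (pose proof (Rabs_pos M); lra).
  exists (Rmin eps (e / (Rabs M + 1))). split.
  - apply Rmin_glb_lt. exact He. now apply Rdiv_lt_0_compat.
  - intros v Hv.
    apply Rle_trans with (1 := H v (Rlt_le_trans _ _ _ Hv (Rmin_l _ _))).
    pose proof (Rlt_le_trans _ _ _ Hv (Rmin_r _ _)) as H2.
    pose proof (Cmod_ge_0 (v - w)). set (x := Cmod (v - w)) in *.
    assert (M * x <= e).
    { apply Rle_trans with ((Rabs M + 1) * (e / (Rabs M + 1))).
      pose proof (Rle_abs M). nra. right. field. lra. }
    simpl. nra.
Qed.

Lemma cderiv_inv_id (w : C) : w <> 0 -> Cderiv (fun v => / v)%C w (- / (w * w))%C.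
Proof.
  intros Hw. assert (Hm : 0 < Cmod w) by now apply Cmod_gt_0.
  apply cderiv_second_order with (Cmod w / 2) (/ (Cmod w / 2 * (Cmod w * Cmod w))).
  lra.
  intros v Hv.
  assert (Hv2 : Cmod w / 2 <= Cmod v).
  { pose proof (Cmod_triangle_rev w v). rewrite Cmod_minus_sym in H. lra. }
  assert (Hv0 : v <> 0) by (apply Cmod_gt_0; lra).
  replace (/ v - / w - - / (w * w) * (v - w))%C
    with ((v - w) * (v - w) * / (v * (w * w)))%C by (field; auto).
  rewrite !Cmod_mult, Cmod_inv, !Cmod_mult by (repeat apply Cmult_neq_0; auto).
  pose proof (Cmod_ge_0 (v - w)).
  rewrite Rmult_comm. replace (Cmod (v - w) ^ 2) with (Cmod (v - w) * Cmod (v - w)) by ring.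
  apply Rmult_le_compat_r. apply Rmult_le_pos; assumption.
  assert (0 < Cmod w * Cmod w) by nra.
  apply Rinv_le_contravar. apply Rmult_lt_0_compat; lra.
  apply Rmult_le_compat_r; lra.
Qed.

Lemma cderiv_inv (f : C -> C) (w df : C) : f w <> 0 ->
  Cderiv f w df -> Cderiv (fun v => / f v)%C w (- df / (f w * f w))%C.
Proof.
  intros H0 H. apply cderiv_eq with (df * - / (f w * f w))%C.
  apply (cderiv_comp (fun v => / v)%C). now apply cderiv_inv_id. exact H.
  field. exact H0.
Qed.

Lemma cderiv_div (f g : C -> C) (w df dg : C) : g w <> 0 ->
  Cderiv f w df -> Cderiv g w dg ->
  Cderiv (fun v => f v / g v)%C w ((df * g w - f w * dg) / (g w * g w))%C.
Proof.
  intros H0 Hf Hg. eapply cderiv_eq.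
  apply cderiv_mult. exact Hf. apply cderiv_inv. exact H0. exact Hg.
  cbv beta. field. exact H0.
Qed.

Lemma ex_cderiv_pow (f : C -> C) (w : C) (n : nat) :
  (exists d, Cderiv f w d) -> exists d, Cderiv (fun v => f v ^ n)%C w d.
Proof.
  intros [d Hd]. induction n as [|n [e IH]].
  - exists (RtoC 0). apply (cderiv_const 1).
  - eexists. apply (cderiv_mult f (fun v => f v ^ n)%C). exact Hd. exact IH.
Qed.

Lemma cderiv_csum (f : nat -> C -> C) (d : nat -> C) (w : C) (n : nat) :
  (forall k, (k < n)%nat -> Cderiv (f k) w (d k)) ->
  Cderiv (fun v => csum (fun k => f k v) n) w (csum d n).
Proof.
  induction n as [|n IH]; intros H; simpl.
  - apply (cderiv_const 0).
  - apply (cderiv_plus (fun v => csum (fun k => f k v) n) (f n)). apply IH; intros; apply H; lia. apply H; lia.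
Qed.

(** * The complex exponential *)

Lemma cexp_plus (a b : C) : cexp (a + b) = (cexp a * cexp b)%C.
Proof.
  unfold cexp. rewrite Re_plus, Im_plus, exp_plus, cos_plus, sin_plus.
  apply C_ext; rewrite ?Re_mult, ?Im_mult; unfold Re, Im; simpl; ring.
Qed.

Lemma cexp_0 : cexp 0 = 1.
Proof.
  unfold cexp. rewrite re_RtoC, im_RtoC, exp_0, cos_0, sin_0.
  apply C_ext; unfold Re, Im; simpl; ring.
Qed.

Lemma cexp_neq_0 (a : C) : cexp a <> 0.
Proof.
  intros H. assert (E : (cexp a * cexp (- a))%C = 1).
  { rewrite <- cexp_plus. replace (a + - a)%C with (RtoC 0) by ring. apply cexp_0. }
  rewrite H, Cmult_0_l in E. now apply C1_nz.
Qed.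

Lemma cexp_opp (a : C) : cexp (- a) = (/ cexp a)%C.
Proof.
  assert (E : (cexp a * cexp (- a))%C = 1).
  { rewrite <- cexp_plus. replace (a + - a)%C with (RtoC 0) by ring. apply cexp_0. }
  pose proof (cexp_neq_0 a).
  replace (cexp (- a)) with (/ cexp a * (cexp a * cexp (- a)))%C by (field; auto).
  rewrite E. ring.
Qed.

Lemma cexp_minus (a b : C) : cexp (a - b) = (cexp a / cexp b)%C.
Proof. unfold Cminus. rewrite cexp_plus, cexp_opp. reflexivity. Qed.

Lemma cexp_RtoC (x : R) : cexp x = exp x.
Proof.
  unfold cexp. rewrite re_RtoC, im_RtoC, cos_0, sin_0.
  apply C_ext; unfold Re, Im; simpl; ring.
Qed.

Lemma Cmod_cexp (a : C) : Cmod (cexp a) = exp (Re a).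
Proof.
  unfold Cmod, cexp; simpl.
  replace (exp (Re a) * cos (Im a) * (exp (Re a) * cos (Im a) * 1) +
    exp (Re a) * sin (Im a) * (exp (Re a) * sin (Im a) * 1))
  with (Rsqr (exp (Re a)) * (Rsqr (sin (Im a)) + Rsqr (cos (Im a))))
    by (unfold Rsqr; ring).
  rewrite sin2_cos2, Rmult_1_r. apply sqrt_Rsqr. left. apply exp_pos.
Qed.

Lemma cexp_pow (a : C) (n : nat) : (cexp a ^ n)%C = cexp (RtoC (INR n) * a).
Proof.
  induction n as [|n IH].
  - simpl. rewrite Cmult_0_l. now rewrite cexp_0.
  - rewrite Cpow_S, IH, <- cexp_plus. f_equal. rewrite S_INR, RtoC_plus. ring.
Qed.

(** With m = |y|, each of the two components of the remainder is at most 4 m^2, from e^a - 1 - a <=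
    2 m^2, 1 - cos b <= m^2 and |sin b - b| <= m^2; together they give 8. *)
Lemma cexp_second_order (y : C) : Cmod y <= 1 / 2 ->
  Cmod (cexp y - 1 - y) <= 8 * Cmod y ^ 2.
Proof.
  intros Hy.
  pose proof (re_le_Cmod y) as Ha. pose proof (im_le_Cmod y) as Hb.
  set (m := Cmod y) in *. set (a := Re y) in *. set (b := Im y) in *.
  assert (Hm : 0 <= m) by apply Cmod_ge_0.
  assert (Ha' : - m <= a <= m) by (now apply Rabs_le_between).
  assert (Hb' : - m <= b <= m) by (now apply Rabs_le_between).
  assert (He : 0 <= exp a - 1 - a <= 2 * m ^ 2).
  { split. pose proof (exp_ineq1_le a). lra.
    (* This is 1 - a <= e^(-a), inverted. *)
    assert (exp a <= / (1 - a)).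
    { pose proof (exp_ineq1_le (- a)). rewrite exp_Ropp in H.
      pose proof (exp_pos a).
      apply Rmult_le_reg_l with (/ exp a). now apply Rinv_0_lt_compat.
      rewrite Rinv_l by lra. apply Rmult_le_reg_r with (1 - a). lra.
      rewrite Rmult_assoc, Rinv_l by lra. lra. }
    assert (/ (1 - a) - 1 - a <= 2 * m ^ 2); [|lra].
    apply Rmult_le_reg_r with (1 - a). lra.
    replace ((/ (1 - a) - 1 - a) * (1 - a)) with (a * a) by (field; lra).
    assert (a * a <= m * m) by nra. nra. }
  assert (Hc : 0 <= 1 - cos b <= m ^ 2).
  { split. pose proof (COS_bound b). lra.
    replace b with (2 * (b / 2)) by field. rewrite cos_2a_sin.
    assert (Hs : Rabs (sin (b / 2)) <= Rabs (b / 2)).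
    { destruct (Rle_lt_dec 0 (b / 2)) as [H|H].
      - rewrite (Rabs_pos_eq (b / 2)) by lra. apply Rabs_le. split.
        + destruct (Req_dec (b/2) 0) as [->|]. rewrite sin_0; lra.
          assert (0 <= sin (b / 2)); [|lra]. apply sin_ge_0. lra.
          pose proof PI2_1. lra.
        + destruct (Req_dec (b/2) 0) as [->|]. rewrite sin_0; lra.
          left. apply sin_lt_x. lra.
      - rewrite (Rabs_left (b / 2)) by lra. rewrite <- Rabs_Ropp, <- sin_neg.
        apply Rabs_le. split.
        + assert (0 <= sin (- (b / 2))); [|lra]. apply sin_ge_0. lra.
          pose proof PI2_1. lra.
        + left. apply sin_lt_x. lra. }
    assert (sin (b/2) * sin (b/2) <= b / 2 * (b / 2)).
    { apply Rsqr_le_abs_1 in Hs. exact Hs. }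
    nra. }
  assert (Hs : Rabs (sin b - b) <= m ^ 2).
  { assert (Hg : forall x, derivable_pt_lim (fun t => sin t - t) x (cos x - 1)).
    { intros x. apply derivable_pt_lim_minus. apply derivable_pt_lim_sin.
      apply derivable_pt_lim_id. }
    destruct (MVT_gen (fun t => sin t - t) 0 b (fun x => cos x - 1)) as [c [Hc1 Hc2]].
    - intros x _. apply is_derive_Reals. apply Hg.
    - intros x _. apply derivable_continuous_pt. exists (cos x - 1). apply Hg.
    - rewrite sin_0 in Hc2. replace (sin b - b) with ((cos c - 1) * b) by lra.
      rewrite Rabs_mult.
      assert (Hcc : - m <= c <= m).
      { revert Hc1. apply Rmin_case; apply Rmax_case; lra. }
      assert (Hcos : Rabs (cos c - 1) <= m).
      { destruct (MVT_gen cos 0 c (fun x => - sin x)) as [e [He1 He2]].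
        - intros x _. apply is_derive_Reals. apply derivable_pt_lim_cos.
        - intros x _. apply continuity_cos.
        - rewrite cos_0 in He2. rewrite He2, Rabs_mult, Rabs_Ropp.
          assert (Rabs (sin e) <= 1).
          { apply Rabs_le. pose proof (SIN_bound e). lra. }
          assert (Rabs (c - 0) <= m) by (apply Rabs_le; lra).
          pose proof (Rabs_pos (sin e)). pose proof (Rabs_pos (c - 0)). nra. }
      pose proof (Rabs_pos b). pose proof (Rabs_pos (cos c - 1)). simpl. nra. }
  apply Rle_trans with (1 := Cmod_le_components _).
  change (Re (cexp y - 1 - y)) with (exp a * cos b - 1 - a).
  change (Im (cexp y - 1 - y)) with (exp a * sin b - 0 - b).
  pose proof (COS_bound b). pose proof (SIN_bound b).
  assert (R1 : Rabs (exp a * cos b - 1 - a) <= 4 * m ^ 2).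
  { replace (exp a * cos b - 1 - a) with
      ((exp a - 1 - a) * cos b - (1 + a) * (1 - cos b)) by ring.
    apply Rabs_le. set (p := exp a - 1 - a) in *. set (c := 1 - cos b) in *.
    set (k := m ^ 2) in *. assert (0 <= k) by nra. split; nra. }
  assert (R2 : Rabs (exp a * sin b - 0 - b) <= 4 * m ^ 2).
  { replace (exp a * sin b - 0 - b) with
      ((exp a - 1 - a) * sin b + (a * sin b + (sin b - b))) by ring.
    apply Rle_trans with (1 := Rabs_triang _ _).
    pose proof (Rabs_triang (a * sin b) (sin b - b)).
    assert (Rabs ((exp a - 1 - a) * sin b) <= 2 * m ^ 2).
    { apply Rabs_le. set (p := exp a - 1 - a) in *. split; nra. }
    assert (Rabs (a * sin b) <= m ^ 2); [|lra].
    assert (- m <= sin b <= m).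
    { assert (Hsb : Rabs (sin b) <= m); [|now apply Rabs_le_between].
      destruct (MVT_gen sin 0 b cos) as [e [He1 He2]].
      - intros x _. apply is_derive_Reals. apply derivable_pt_lim_sin.
      - intros x _. apply continuity_sin.
      - rewrite sin_0 in He2. replace (sin b) with (cos e * (b - 0)) by lra.
        rewrite Rabs_mult.
        assert (Rabs (cos e) <= 1).
        { apply Rabs_le. pose proof (COS_bound e). lra. }
        assert (Rabs (b - 0) <= m) by (apply Rabs_le; lra).
        pose proof (Rabs_pos (cos e)). pose proof (Rabs_pos (b - 0)). nra. }
    apply Rabs_le. split; nra. }
  lra.
Qed.

Lemma cderiv_cexp (w : C) : Cderiv cexp w (cexp w).
Proof.
  apply cderiv_second_order with (1 / 2) (Cmod (cexp w) * 8). lra.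
  intros v Hv.
  replace v with (w + (v - w))%C at 1 by ring. rewrite cexp_plus.
  replace (cexp w * cexp (v - w) - cexp w - cexp w * (v - w))%C with
    (cexp w * (cexp (v - w) - 1 - (v - w)))%C by ring.
  rewrite Cmod_mult, Rmult_assoc.
  apply Rmult_le_compat_l. apply Cmod_ge_0. apply cexp_second_order. lra.
Qed.

Lemma cderiv_cexp_comp (f : C -> C) (w d : C) :
  Cderiv f w d -> Cderiv (fun v => cexp (f v)) w (d * cexp (f w))%C.
Proof. intros H. apply cderiv_comp. apply cderiv_cexp. exact H. Qed.

(** * Goursat's theorem on rectangles *)

Definition Rcont (f : R -> C) (x : R) : Prop := filterlim f (locally x) (locally (f x)).

Lemma Rcont_Re (f : R -> C) (x : R) : Rcont f x -> continuous (fun t => Re (f t)) x.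
Proof.
  intros H. apply filterlim_locally. intros eps.
  generalize (proj1 (clim_spec f (f x)) H eps (cond_pos eps)). apply filter_imp.
  intros t Ht. apply Rle_lt_trans with (2 := Ht).
  apply (re_le_Cmod (f t - f x)).
Qed.

Lemma Rcont_Im (f : R -> C) (x : R) : Rcont f x -> continuous (fun t => Im (f t)) x.
Proof.
  intros H. apply filterlim_locally. intros eps.
  generalize (proj1 (clim_spec f (f x)) H eps (cond_pos eps)). apply filter_imp.
  intros t Ht. apply Rle_lt_trans with (2 := Ht).
  apply (im_le_Cmod (f t - f x)).
Qed.

Lemma Rcont_Cmod (f : R -> C) (x : R) :
  Rcont f x -> continuity_pt (fun t => Cmod (f t)) x.
Proof.
  intros H. apply continuity_pt_filterlim. apply filterlim_locally. intros eps.
  generalize (proj1 (clim_spec f (f x)) H eps (cond_pos eps)). apply filter_imp.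
  intros t Ht. apply Rle_lt_trans with (2 := Ht).
  change (Rabs (Cmod (f t) - Cmod (f x)) <= Cmod (f t - f x)).
  apply Rabs_le. pose proof (Cmod_triangle_rev (f t) (f x)).
  pose proof (Cmod_triangle_rev (f x) (f t)) as H1.
  rewrite (Cmod_minus_sym (f x)) in H1. lra.
Qed.

Definition CInt (f : R -> C) (a b : R) : C :=
  (RInt (fun t => Re (f t)) a b, RInt (fun t => Im (f t)) a b).

Lemma ex_RInt_Re (f : R -> C) (a b : R) : a <= b ->
  (forall t, a <= t <= b -> Rcont f t) -> ex_RInt (fun t => Re (f t)) a b.
Proof.
  intros Hab H. apply (ex_RInt_continuous (V := R_CompleteNormedModule)).
  rewrite Rmin_left, Rmax_right by lra. intros z Hz. now apply Rcont_Re, H.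
Qed.

Lemma ex_RInt_Im (f : R -> C) (a b : R) : a <= b ->
  (forall t, a <= t <= b -> Rcont f t) -> ex_RInt (fun t => Im (f t)) a b.
Proof.
  intros Hab H. apply (ex_RInt_continuous (V := R_CompleteNormedModule)).
  rewrite Rmin_left, Rmax_right by lra. intros z Hz. now apply Rcont_Im, H.
Qed.

Lemma CInt_Chasles (f : R -> C) (a b c : R) : a <= b -> b <= c ->
  (forall t, a <= t <= c -> Rcont f t) -> CInt f a c = (CInt f a b + CInt f b c)%C.
Proof.
  intros Hab Hbc H.
  apply C_ext; rewrite ?Re_plus, ?Im_plus; unfold CInt; simpl; symmetry;
    apply (RInt_Chasles (V := R_CompleteNormedModule)).
  - apply ex_RInt_Re. lra. intros; apply H; lra.
  - apply ex_RInt_Re. lra. intros; apply H; lra.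
  - apply ex_RInt_Im. lra. intros; apply H; lra.
  - apply ex_RInt_Im. lra. intros; apply H; lra.
Qed.

Lemma CInt_minus (f g : R -> C) (a b : R) : a <= b ->
  (forall t, a <= t <= b -> Rcont f t) -> (forall t, a <= t <= b -> Rcont g t) ->
  CInt (fun t => f t - g t)%C a b = (CInt f a b - CInt g a b)%C.
Proof.
  intros Hab Hf Hg.
  apply C_ext; rewrite ?Re_minus, ?Im_minus; unfold CInt; simpl;
    apply (RInt_minus (V := R_CompleteNormedModule)).
  - now apply ex_RInt_Re.
  - now apply ex_RInt_Re.
  - now apply ex_RInt_Im.
  - now apply ex_RInt_Im.
Qed.

Lemma CInt_const (c : C) (a b : R) : CInt (fun _ => c) a b = (RtoC (b - a) * c)%C.
Proof.
  apply C_ext; rewrite ?re_scal_l, ?im_scal_l; unfold CInt; simpl;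
    apply (RInt_const (V := R_CompleteNormedModule)).
Qed.

Lemma CInt_ext (f g : R -> C) (a b : R) :
  (forall t, f t = g t) -> CInt f a b = CInt g a b.
Proof.
  intros H. unfold CInt. f_equal; apply RInt_ext; intros; now rewrite H.
Qed.

Lemma CInt_bound (f : R -> C) (a b M : R) : a <= b ->
  (forall t, a <= t <= b -> Rcont f t) -> (forall t, a <= t <= b -> Cmod (f t) <= M) ->
  Cmod (CInt f a b) <= 2 * M * (b - a).
Proof.
  intros Hab Hf HM. apply Rle_trans with (1 := Cmod_le_components _).
  unfold CInt; simpl.
  assert (H1 : Rabs (RInt (fun t => Re (f t)) a b) <= (b - a) * M).
  { apply abs_RInt_le_const. exact Hab. now apply ex_RInt_Re.
    intros t Ht. apply Rle_trans with (2 := HM t Ht). apply re_le_Cmod. }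
  assert (H2 : Rabs (RInt (fun t => Im (f t)) a b) <= (b - a) * M).
  { apply abs_RInt_le_const. exact Hab. now apply ex_RInt_Im.
    intros t Ht. apply Rle_trans with (2 := HM t Ht). apply im_le_Cmod. }
  lra.
Qed.

Definition Ccont (f : C -> C) (w : C) : Prop := filterlim f (locally w) (locally (f w)).

Lemma Rcont_horizontal (f : C -> C) (x y : R) :
  Ccont f (x, y) -> Rcont (fun t => f (t, y)) x.
Proof.
  intros H. apply clim_spec. intros eps He.
  assert (H1 := proj1 (clim_spec f _) H eps He).
  apply locally_C_spec in H1. destruct H1 as [d [Hd H1]].
  assert (G : forall t, Rabs (t - x) < d -> Cmod (f (t, y) - f (x, y)) < eps).
  { intros t Ht. apply H1. replace ((t, y) - (x, y))%C with (RtoC (t - x)).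
    now rewrite Cmod_R. apply C_ext; unfold Re, Im; simpl; ring. }
  exists (mkposreal d Hd). exact G.
Qed.

Lemma Rcont_vertical (f : C -> C) (x y : R) :
  Ccont f (x, y) -> Rcont (fun t => f (x, t)) y.
Proof.
  intros H. apply clim_spec. intros eps He.
  assert (H1 := proj1 (clim_spec f _) H eps He).
  apply locally_C_spec in H1. destruct H1 as [d [Hd H1]].
  assert (G : forall t, Rabs (t - y) < d -> Cmod (f (x, t) - f (x, y)) < eps).
  { intros t Ht. apply H1. replace ((x, t) - (x, y))%C with (Ci * RtoC (t - y))%C.
    now rewrite Cmod_mult, Cmod_Ci, Cmod_R, Rmult_1_l.
    apply C_ext; unfold Re, Im; simpl; ring. }
  exists (mkposreal d Hd). exact G.
Qed.

(** The integral of f along the boundary, counterclockwise. *)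
Definition rect_int (f : C -> C) (x0 x1 y0 y1 : R) : C :=
  (CInt (fun t => f (t, y0)) x0 x1 - CInt (fun t => f (t, y1)) x0 x1
   + Ci * (CInt (fun t => f (x1, t)) y0 y1 - CInt (fun t => f (x0, t)) y0 y1))%C.

Definition Ccont_rect (f : C -> C) (x0 x1 y0 y1 : R) : Prop :=
  forall x y, x0 <= x <= x1 -> y0 <= y <= y1 -> Ccont f (x, y).

(** Each inner edge is traversed twice in opposite directions and cancels. *)
Lemma rect_int_split (f : C -> C) (x0 x1 x2 y0 y1 y2 : R) :
  x0 <= x1 <= x2 -> y0 <= y1 <= y2 -> Ccont_rect f x0 x2 y0 y2 ->
  rect_int f x0 x2 y0 y2 =
  (rect_int f x0 x1 y0 y1 + rect_int f x1 x2 y0 y1 +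
   (rect_int f x0 x1 y1 y2 + rect_int f x1 x2 y1 y2))%C.
Proof.
  intros Hx Hy H. unfold rect_int.
  rewrite (CInt_Chasles (fun t => f (t, y0)) x0 x1 x2) by
    (try lra; intros; apply Rcont_horizontal, H; lra).
  rewrite (CInt_Chasles (fun t => f (t, y2)) x0 x1 x2) by
    (try lra; intros; apply Rcont_horizontal, H; lra).
  rewrite (CInt_Chasles (fun t => f (x0, t)) y0 y1 y2) by
    (try lra; intros; apply Rcont_vertical, H; lra).
  rewrite (CInt_Chasles (fun t => f (x2, t)) y0 y1 y2) by
    (try lra; intros; apply Rcont_vertical, H; lra).
  ring.
Qed.

Lemma rect_int_minus (f g : C -> C) (x0 x1 y0 y1 : R) : x0 <= x1 -> y0 <= y1 ->
  Ccont_rect f x0 x1 y0 y1 -> Ccont_rect g x0 x1 y0 y1 ->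
  rect_int (fun v => f v - g v)%C x0 x1 y0 y1
  = (rect_int f x0 x1 y0 y1 - rect_int g x0 x1 y0 y1)%C.
Proof.
  intros Hx Hy Hf Hg. unfold rect_int.
  rewrite !(CInt_minus (fun t => f (t, _)) (fun t => g (t, _))) by
    (try lra; intros; apply Rcont_horizontal; (apply Hf || apply Hg); lra).
  rewrite !(CInt_minus (fun t => f (_, t)) (fun t => g (_, t))) by
    (try lra; intros; apply Rcont_vertical; (apply Hf || apply Hg); lra).
  ring.
Qed.

Lemma Ccont_affine (a b w : C) : Ccont (fun v => a + b * v)%C w.
Proof.
  apply clim_plus. apply clim_const. apply clim_mult. apply clim_const.
  intros P HP. exact HP.
Qed.

(** On opposite edges an affine function differs by a constant, b times the displacement between the
    edges, so the two pairs of edges give opposite multiples of i b times the area. *)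
Lemma rect_int_affine (a b : C) (x0 x1 y0 y1 : R) : x0 <= x1 -> y0 <= y1 ->
  rect_int (fun v => a + b * v)%C x0 x1 y0 y1 = 0.
Proof.
  intros Hx Hy. unfold rect_int.
  rewrite <- !CInt_minus by (try lra; intros;
    (apply (Rcont_horizontal (fun v => a + b * v)%C) ||
     apply (Rcont_vertical (fun v => a + b * v)%C)); apply Ccont_affine).
  rewrite (CInt_ext _ (fun _ => b * Ci * RtoC (y0 - y1))%C x0 x1).
  rewrite (CInt_ext _ (fun _ => b * RtoC (x1 - x0))%C y0 y1).
  - rewrite !CInt_const, !RtoC_minus. ring.
  - intros t. replace (RtoC (x1 - x0)) with ((x1, t) - (x0, t))%C. ring.
    apply C_ext; unfold Re, Im; simpl; ring.
  - intros t. replace (b * Ci * RtoC (y0 - y1))%C with (b * ((t, y0) - (t, y1)))%C. ring.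
    rewrite <- Cmult_assoc. f_equal. apply C_ext; unfold Re, Im; simpl; ring.
Qed.

Lemma rect_int_bound (f : C -> C) (x0 x1 y0 y1 M : R) : x0 <= x1 -> y0 <= y1 ->
  Ccont_rect f x0 x1 y0 y1 ->
  (forall x y, x0 <= x <= x1 -> y0 <= y <= y1 -> Cmod (f (x, y)) <= M) ->
  Cmod (rect_int f x0 x1 y0 y1) <= 4 * M * ((x1 - x0) + (y1 - y0)).
Proof.
  intros Hx Hy Hf HM. unfold rect_int.
  apply Rle_trans with (1 := Cmod_triangle _ _).
  rewrite Cmod_mult, Cmod_Ci, Rmult_1_l.
  pose proof (Cmod_minus_triangle (CInt (fun t => f (t, y0)) x0 x1)
    (CInt (fun t => f (t, y1)) x0 x1)).
  pose proof (Cmod_minus_triangle (CInt (fun t => f (x1, t)) y0 y1)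
    (CInt (fun t => f (x0, t)) y0 y1)).
  assert (forall y, y0 <= y <= y1 ->
    Cmod (CInt (fun t => f (t, y)) x0 x1) <= 2 * M * (x1 - x0)).
  { intros y Hy'. apply CInt_bound. lra.
    intros; apply Rcont_horizontal, Hf; lra. intros; apply HM; lra. }
  assert (forall x, x0 <= x <= x1 ->
    Cmod (CInt (fun t => f (x, t)) y0 y1) <= 2 * M * (y1 - y0)).
  { intros x Hx'. apply CInt_bound. lra.
    intros; apply Rcont_vertical, Hf; lra. intros; apply HM; lra. }
  pose proof (H1 y0 ltac:(lra)). pose proof (H1 y1 ltac:(lra)).
  pose proof (H2 x0 ltac:(lra)). pose proof (H2 x1 ltac:(lra)). lra.
Qed.

Lemma nested_intervals (u e : nat -> R) :
  (forall n, u n <= u (S n)) -> (forall n, u (S n) + e (S n) <= u n + e n) ->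
  (forall n, 0 <= e n) -> exists X, forall n, u n <= X <= u n + e n.
Proof.
  intros H1 H2 He.
  assert (Hu : forall n m, (n <= m)%nat -> u n <= u m).
  { intros n m H. induction H as [|m H IH]. lra. specialize (H1 m). lra. }
  assert (Hv : forall n m, (n <= m)%nat -> u m + e m <= u n + e n).
  { intros n m H. induction H as [|m H IH]. lra. specialize (H2 m). lra. }
  assert (Huv : forall n m, u m <= u n + e n).
  { intros n m. destruct (Nat.le_ge_cases n m) as [H|H].
    - specialize (Hv n m H). specialize (He m). lra.
    - specialize (Hu m n H). specialize (He n). lra. }
  destruct (completeness (fun x => exists n, x = u n)) as [X [HX1 HX2]].
  - exists (u O + e O). intros x [n ->]. apply Huv.
  - exists (u O). now exists O.
  - exists X. intros n. split. apply HX1. now exists n.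
    apply HX2. intros x [m ->]. apply Huv.
Qed.

(** * Subdivision of a rectangle *)

Section Bisection.
Variables (x0 y0 a b : R).
Hypotheses (Ha : 0 <= a) (Hb : 0 <= b).
Variable Q : R -> R -> R -> Prop.
Hypothesis Qdec : forall x y h, {Q x y h} + {~ Q x y h}.

(** A triple (x, y, h) stands for the rectangle with lower left corner (x, y) and sides a h and b h;
    it is to lie in the one of scale 1 at (x0, y0). *)
Definition inside (x y h : R) : Prop :=
  x0 <= x /\ x + a * h <= x0 + a /\ y0 <= y /\ y + b * h <= y0 + b.

Hypothesis Qsplit : forall x y h, 0 <= h -> inside x y h ->
  Q x y (h / 2) -> Q (x + a * (h / 2)) y (h / 2) ->
  Q x (y + b * (h / 2)) (h / 2) ->
  Q (x + a * (h / 2)) (y + b * (h / 2)) (h / 2) -> Q x y h.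
Hypothesis Qloc : forall X Y, x0 <= X <= x0 + a -> y0 <= Y <= y0 + b ->
  exists del, 0 < del /\ forall x y h, 0 <= h < del -> inside x y h ->
    x <= X <= x + a * h -> y <= Y <= y + b * h -> Q x y h.

(** Moves to a quarter on which Q fails. If the first three satisfy Q, the fourth is taken by
    elimination: [Qsplit] forces the failure there. *)
Definition bisect_step (p : R * R * R) : R * R * R :=
  let '(x, y, h) := p in
  let k := h / 2 in
  if Qdec x y k then
    if Qdec (x + a * k) y k then
      if Qdec x (y + b * k) k then (x + a * k, y + b * k, k)
      else (x, y + b * k, k)
    else (x + a * k, y, k)
  else (x, y, k).

Fixpoint bisect_seq (n : nat) : R * R * R :=
  match n with O => (x0, y0, 1) | S m => bisect_step (bisect_seq m) end.

Lemma bisect_step_spec (x y h x' y' h' : R) : 0 <= h -> inside x y h -> ~ Q x y h ->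
  bisect_step (x, y, h) = (x', y', h') ->
  h' = h / 2 /\ inside x' y' h' /\ ~ Q x' y' h' /\
  x <= x' /\ x' + a * h' <= x + a * h /\ y <= y' /\ y' + b * h' <= y + b * h.
Proof.
  intros Hh Hin HQ. unfold bisect_step.
  assert (0 <= a * (h / 2)) by (apply Rmult_le_pos; lra).
  assert (0 <= b * (h / 2)) by (apply Rmult_le_pos; lra).
  unfold inside in *.
  destruct (Qdec x y (h / 2)) as [q1|q1].
  2:{ intros E; injection E as <- <- <-. repeat split; trivial; lra. }
  destruct (Qdec (x + a * (h / 2)) y (h / 2)) as [q2|q2].
  2:{ intros E; injection E as <- <- <-. repeat split; trivial; lra. }
  destruct (Qdec x (y + b * (h / 2)) (h / 2)) as [q3|q3].
  2:{ intros E; injection E as <- <- <-. repeat split; trivial; lra. }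
  intros E; injection E as <- <- <-. repeat split; trivial; try lra.
  intros q4. apply HQ. now apply Qsplit.
Qed.

(** A failure of Q would propagate to nested rectangles shrinking to a point (X, Y), and [Qloc] at
    that point contradicts it. *)
Lemma bisection : Q x0 y0 1.
Proof.
  apply NNPP. intros HQ.
  assert (Hs : forall n, let '(x, y, h) := bisect_seq n in
    h = (1 / 2) ^ n /\ inside x y h /\ ~ Q x y h).
  { induction n as [|n IH]; simpl.
    - repeat split; trivial; lra.
    - destruct (bisect_seq n) as [[x y] h]. destruct IH as [Hh [Hi Hq]].
      destruct (bisect_step (x, y, h)) as [[x' y'] h'] eqn:E.
      apply bisect_step_spec in E; trivial.
      + destruct E as [E1 [E2 [E3 _]]]. repeat split; try apply E2; trivial. lra.
      + rewrite Hh. apply pow_le. lra. }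
  set (u n := fst (fst (bisect_seq n))).
  set (v n := snd (fst (bisect_seq n))).
  set (k n := snd (bisect_seq n)).
  assert (Hk : forall n, k n = (1 / 2) ^ n).
  { intros n. unfold k. specialize (Hs n). destruct (bisect_seq n) as [[x y] h]. apply Hs. }
  assert (Hk0 : forall n, 0 <= k n) by (intros; rewrite Hk; apply pow_le; lra).
  assert (Hi : forall n, inside (u n) (v n) (k n) /\ ~ Q (u n) (v n) (k n)).
  { intros n. unfold u, v, k. specialize (Hs n). destruct (bisect_seq n) as [[x y] h].
    split; apply Hs. }
  assert (Hst : forall n, u n <= u (S n) /\ u (S n) + a * k (S n) <= u n + a * k n /\
     v n <= v (S n) /\ v (S n) + b * k (S n) <= v n + b * k n).
  { intros n. specialize (Hi n). specialize (Hk0 n). revert Hi Hk0. unfold u, v, k.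
    change (bisect_seq (S n)) with (bisect_step (bisect_seq n)).
    destruct (bisect_seq n) as [[x y] h]. cbn [fst snd]. intros [Hin HnQ] Hh.
    destruct (bisect_step (x, y, h)) as [[x' y'] h'] eqn:E.
    apply bisect_step_spec in E; trivial. cbn [fst snd]. tauto. }
  destruct (nested_intervals u (fun n => a * k n)) as [X HX].
  { intros; apply Hst. } { intros; apply Hst. }
  { intros; apply Rmult_le_pos; auto. }
  destruct (nested_intervals v (fun n => b * k n)) as [Y HY].
  { intros; apply Hst. } { intros; apply Hst. }
  { intros; apply Rmult_le_pos; auto. }
  destruct (Qloc X Y) as [del [Hdel HL]].
  { specialize (HX O). unfold u, k in HX; simpl in HX. lra. }
  { specialize (HY O). unfold v, k in HY; simpl in HY. lra. }
  destruct (pow_lt_1_zero (1 / 2) ltac:(rewrite Rabs_pos_eq; lra) del Hdel) as [N HN].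
  specialize (HN N (le_n _)). rewrite <- Hk, Rabs_pos_eq in HN by auto.
  apply (proj2 (Hi N)). apply HL.
  - split; auto.
  - apply Hi.
  - apply HX.
  - apply HY.
Qed.

End Bisection.

(** The bound eps h^2 is additive under quartering, so by [bisection] it only has to hold for small
    rectangles. Near a point of differentiability f may be replaced by f minus its affine part,
    since affine functions integrate to 0, and this difference is small compared with the
    diameter. *)
Lemma goursat (f : C -> C) (x0 x1 y0 y1 : R) : x0 <= x1 -> y0 <= y1 ->
  (forall x y, x0 <= x <= x1 -> y0 <= y <= y1 -> exists d, Cderiv f (x, y) d) ->
  rect_int f x0 x1 y0 y1 = 0.
Proof.
  intros Hx Hy Hf.
  assert (Hc : Ccont_rect f x0 x1 y0 y1).
  { intros x y H1 H2. destruct (Hf x y H1 H2) as [d Hd].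
    now apply cderiv_continuous with d. }
  set (a := x1 - x0). set (b := y1 - y0).
  assert (Ha : 0 <= a) by (unfold a; lra). assert (Hb : 0 <= b) by (unfold b; lra).
  set (J x y h := rect_int f x (x + a * h) y (y + b * h)).
  assert (Hsmall : forall eps, 0 < eps -> Cmod (J x0 y0 1) <= eps * 1 ^ 2).
  { intros eps He.
    apply (bisection x0 y0 a b Ha Hb (fun x y h => Cmod (J x y h) <= eps * h ^ 2)).
    - intros x y h. apply Rle_dec.
    - intros x y h Hh Hin. unfold J.
      assert (0 <= a * (h / 2)) by (apply Rmult_le_pos; lra).
      assert (0 <= b * (h / 2)) by (apply Rmult_le_pos; lra).
      unfold inside, a, b in Hin.
      rewrite (rect_int_split f x (x + a * (h / 2)) (x + a * h)
        y (y + b * (h / 2)) (y + b * h)).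
      + replace (x + a * (h / 2) + a * (h / 2)) with (x + a * h) by field.
        replace (y + b * (h / 2) + b * (h / 2)) with (y + b * h) by field.
        intros q1 q2 q3 q4.
        apply Rle_trans with (1 := Cmod_triangle _ _).
        apply Rle_trans with (eps * (h / 2) ^ 2 + eps * (h / 2) ^ 2 +
          (eps * (h / 2) ^ 2 + eps * (h / 2) ^ 2)).
        2: right; field.
        apply Rplus_le_compat; apply Rle_trans with (1 := Cmod_triangle _ _); lra.
      + lra.
      + lra.
      + intros s t Hs Ht. apply Hc; unfold a, b in *; lra.
    - intros X Y HX HY.
      destruct (Hf X Y) as [d Hd]. unfold a in HX; lra. unfold b in HY; lra.
      (* [rect_int_bound] with sup bound (eps / c) (a + b) h yields eps h^2 times 4 (a + b)^2 / c,
         hence this c; the added 1 keeps it positive when a = b = 0. *)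
      set (c := 4 * (a + b) * (a + b) + 1).
      assert (Hc0 : 0 < c) by (unfold c; nra).
      destruct (proj1 (cderiv_spec _ _ _) Hd (eps / c)) as [del [Hdel Hd2]].
      { now apply Rdiv_lt_0_compat. }
      exists (del / (a + b + 1)). split. apply Rdiv_lt_0_compat; lra.
      intros x y h Hh Hin HXx HYy.
      assert (Hah : 0 <= a * h) by (apply Rmult_le_pos; lra).
      assert (Hbh : 0 <= b * h) by (apply Rmult_le_pos; lra).
      set (al := (f (X, Y) - d * (X, Y))%C).
      assert (E : J x y h =
        rect_int (fun v => f v - (al + d * v))%C x (x + a * h) y (y + b * h)).
      { rewrite rect_int_minus; try lra.
        - rewrite rect_int_affine by lra. unfold J. ring.
        - unfold inside in Hin. intros s t Hs Ht. apply Hc; unfold a, b in *; lra.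
        - intros s t _ _. apply Ccont_affine. }
      rewrite E.
      assert (Hdist : (a + b) * h < del).
      { apply Rle_lt_trans with ((a + b + 1) * h). nra.
        apply Rlt_le_trans with ((a + b + 1) * (del / (a + b + 1))).
        apply Rmult_lt_compat_l; lra. right; field; lra. }
      eapply Rle_trans. apply (rect_int_bound _ _ _ _ _ (eps / c * ((a + b) * h))).
      + lra.
      + lra.
      + intros s t Hs Ht. apply clim_minus. apply Hc; unfold inside, a, b in *; lra.
        apply Ccont_affine.
      + intros s t Hs Ht.
        replace (f (s, t) - (al + d * (s, t)))%C with
          (f (s, t) - f (X, Y) - d * ((s, t) - (X, Y)))%C by (unfold al; ring).
        assert (Hst : Cmod ((s, t) - (X, Y)) <= (a + b) * h).
        { apply Rle_trans with (1 := Cmod_le_components _).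
          change (Rabs (s - X) + Rabs (t - Y) <= (a + b) * h).
          assert (Rabs (s - X) <= a * h) by (apply Rabs_le; lra).
          assert (Rabs (t - Y) <= b * h) by (apply Rabs_le; lra). lra. }
        apply Rle_trans with (1 := Hd2 (s, t) (Rle_lt_trans _ _ _ Hst Hdist)).
        apply Rmult_le_compat_l. left; now apply Rdiv_lt_0_compat. exact Hst.
      + replace (4 * (eps / c * ((a + b) * h)) * (x + a * h - x + (y + b * h - y)))
          with (eps * h ^ 2 * (4 * (a + b) * (a + b) / c)) by (field; lra).
        rewrite <- (Rmult_1_r (eps * h ^ 2)) at 2.
        apply Rmult_le_compat_l. nra.
        apply Rmult_le_reg_r with c. exact Hc0.
        unfold Rdiv. rewrite Rmult_assoc, Rinv_l by lra. unfold c; lra. }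
  replace (rect_int f x0 x1 y0 y1) with (J x0 y0 1).
  - apply Cmod_eq_0. apply Rle_antisym. 2: apply Cmod_ge_0.
    apply le_epsilon. intros eps He. specialize (Hsmall eps He). lra.
  - unfold J, a, b. f_equal; ring.
Qed.

(** * The identity theorem *)

Lemma cexp_period (w : C) : cexp (w + (0, 2 * PI)) = cexp w.
Proof.
  unfold cexp. rewrite Re_plus, Im_plus. 
  change (Re (0, 2 * PI)) with 0. change (Im (0, 2 * PI)) with (2 * PI).
  rewrite Rplus_0_r, cos_plus, sin_plus, cos_2PI, sin_2PI.
  f_equal; ring.
Qed.

(* In the coordinate v = a + exp zeta a disc becomes a half-plane on which the
   integral over a vertical period does not depend on the abscissa; letting the
   abscissa tend to -oo gives the value at the centre. The constant 2 comes
   from the componentwise bound of complex integrals. *)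
Lemma mean_value_bound (f : C -> C) (a : C) (rad x1 M : R) : exp x1 < rad ->
  (forall v, Cmod (v - a) < rad -> exists d, Cderiv f v d) ->
  (forall t, 0 <= t <= 2 * PI -> Cmod (f (a + cexp (x1, t))%C) <= M) ->
  Cmod (f a) <= 2 * M.
Proof.
  intros Hr Hf HM.
  assert (Hpi := PI_RGT_0).
  set (g v := f (a + cexp v)%C).
  assert (Hg : forall x y, x <= x1 -> exists d, Cderiv g (x, y) d).
  { intros x y Hx. destruct (Hf (a + cexp (x, y))%C) as [d Hd].
    - replace (a + cexp (x, y) - a)%C with (cexp (x, y)) by ring.
      rewrite Cmod_cexp. apply Rle_lt_trans with (2 := Hr).
      destruct (Rle_lt_or_eq_dec _ _ Hx) as [H| ->]; [left; now apply exp_increasing|simpl; lra].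
    - eexists. apply (cderiv_comp f (fun v => a + cexp v)%C). exact Hd.
      apply cderiv_plus. apply cderiv_const. apply cderiv_cexp. }
  set (I x := CInt (fun t => g (x, t)) 0 (2 * PI)).
  assert (Hcont : forall x, x <= x1 -> forall t, Rcont (fun t => g (x, t)) t).
  { intros x Hx t. apply Rcont_vertical. destruct (Hg x t Hx) as [d Hd].
    now apply cderiv_continuous with d. }
  assert (HI : forall x, x <= x1 -> I x = I x1).
  { intros x Hx.
    assert (H := goursat g x x1 0 (2 * PI) Hx ltac:(lra)).
    unfold rect_int in H.
    (* The two horizontal edges are one period 2 pi i apart and cancel. *)
    rewrite (CInt_ext (fun t => g (t, 2 * PI)) (fun t => g (t, 0))) in H.
    2:{ intros t. unfold g. do 2 f_equal. rewrite <- (cexp_period (t, 0)). f_equal.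
        apply C_ext; unfold Re, Im; simpl; ring. }
    fold (I x) in H. fold (I x1) in H.
    assert (E : (Ci * (I x1 - I x))%C = 0).
    { rewrite <- H. ring. intros; apply Hg; lra. }
    assert (E2 : (I x1 - I x)%C = 0).
    { apply (f_equal (fun w => - Ci * w)%C) in E. rewrite Cmult_assoc in E.
      replace (- Ci * Ci)%C with (RtoC 1) in E
        by (apply C_ext; unfold Re, Im; simpl; ring).
      rewrite Cmult_1_l in E. rewrite E. ring. }
    symmetry. now apply Ceq_minus. }
  destruct (Hf a) as [d Hd].
  { replace (a - a)%C with (RtoC 0) by ring. rewrite Cmod_0. 
    apply Rlt_trans with (2 := Hr). apply exp_pos. }
  apply le_epsilon. intros eps He.
  assert (Hfa := proj1 (clim_spec _ _) (cderiv_continuous f a d Hd) (eps / 2) ltac:(lra)).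
  apply locally_C_spec in Hfa. destruct Hfa as [del [Hdel Hfa]].
  set (x := Rmin x1 (ln del - 1)).
  assert (Hx : x <= x1) by apply Rmin_l.
  assert (Hx2 : exp x < del).
  { rewrite <- (exp_ln del Hdel). apply exp_increasing.
    apply Rle_lt_trans with (1 := Rmin_r _ _). lra. }
  assert (HB : Cmod (I x1) <= 2 * M * (2 * PI - 0)).
  { apply CInt_bound. lra. intros; now apply Hcont, Rle_refl. intros; now apply HM. }
  assert (HB2 : Cmod (I x - RtoC (2 * PI - 0) * f a) <= 2 * (eps / 2) * (2 * PI - 0)).
  { unfold I. rewrite <- (CInt_const (f a)), <- CInt_minus.
    - apply CInt_bound. lra. 
      + intros. apply clim_minus. now apply Hcont. apply clim_const.
      + intros t Ht. left. apply Hfa.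
        replace (a + cexp (x, t) - a)%C with (cexp (x, t)) by ring.
        now rewrite Cmod_cexp.
    - lra.
    - intros; now apply Hcont.
    - intros; apply clim_const. }
  rewrite (HI x Hx) in HB2.
  assert (HB3 : Cmod (RtoC (2 * PI - 0) * f a) <= 4 * M * PI + 2 * eps * PI).
  { pose proof (Cmod_triangle_rev (RtoC (2 * PI - 0) * f a) (I x1)) as H.
    rewrite Cmod_minus_sym in H. lra. }
  rewrite Cmod_mult, Cmod_R, Rabs_pos_eq in HB3 by lra.
  apply Rmult_le_reg_r with (2 * PI). lra. lra.
Qed.

Lemma continuous_bounded (f : R -> R) (a b : R) : a <= b ->
  (forall t, a <= t <= b -> continuity_pt f t) ->
  exists M, forall t, a <= t <= b -> f t <= M.
Proof.
  intros Hab Hf. destruct (continuity_ab_maj f a b Hab Hf) as [t [Ht _]].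
  now exists (f t).
Qed.

Lemma geometric_bound_zero (x A k : R) : 0 <= k < 1 -> 0 <= x ->
  (forall n, x <= A * k ^ n) -> x = 0.
Proof.
  intros Hk Hx H. apply Rle_antisym; [|assumption].
  apply le_epsilon. intros eps He.
  assert (HA : 0 < Rabs A + 1) by (pose proof (Rabs_pos A); lra).
  destruct (pow_lt_1_zero k ltac:(rewrite Rabs_pos_eq; lra) (eps / (Rabs A + 1)))
    as [N HN]. now apply Rdiv_lt_0_compat.
  specialize (HN N (le_n _)). rewrite Rabs_pos_eq in HN by (apply pow_le; lra).
  specialize (H N). pose proof (pow_le k N ltac:(lra)).
  assert ((Rabs A + 1) * k ^ N <= eps).
  { apply Rle_trans with ((Rabs A + 1) * (eps / (Rabs A + 1))).
    apply Rmult_le_compat_l; lra. right; field; lra. }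
  pose proof (Rle_abs A). nra.
Qed.

Lemma moebius_identity (w v : C) :
  Cmod (1 + Cconj w * v) ^ 2 - Cmod (v + w) ^ 2 = (1 - Cmod v ^ 2) * (1 - Cmod w ^ 2).
Proof.
  rewrite !Cmod2_alt. destruct w as [a b], v as [c d].
  unfold Re, Im; simpl; ring.
Qed.

Lemma moebius_denominator (w v : C) : Cmod v <= 1 ->
  1 - Cmod w <= Cmod (1 + Cconj w * v).
Proof.
  intros Hv. pose proof (Cmod_triangle_rev 1 (- (Cconj w * v))) as H.
  rewrite Cmod_opp, Cmod_mult, Cmod_conj, Cmod_1 in H.
  replace (1 - - (Cconj w * v))%C with (1 + Cconj w * v)%C in H by ring.
  pose proof (Cmod_ge_0 w). nra.
Qed.

(* The Moebius map phi sends 0 to w and a circle of radius t close to 1 onto a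
   curve where |phi| >= kap > |w|. The mean value bound for (f o phi) / phi^n
   at 0 then bounds |f w| by a constant times (|w| / kap)^n. *)
Lemma unit_disc_zero (f : C -> C) (r0 : R) : 0 < r0 ->
  (forall v, Cmod v < 1 -> exists d, Cderiv f v d) ->
  (forall v, Cmod v < r0 -> f v = 0) ->
  forall w, Cmod w < 1 -> f w = 0.
Proof.
  intros Hr0 Hf Hz w Hw.
  destruct (Rlt_le_dec (Cmod w) r0) as [|Hwr]. now apply Hz.
  set (be := Cmod w) in *. assert (Hbe : 0 < be < 1) by lra.
  set (phi v := ((v + w) / (1 + Cconj w * v))%C).
  assert (Hden : forall v, Cmod v < 1 -> (1 + Cconj w * v)%C <> 0).
  { intros v Hv. apply Cmod_gt_0. pose proof (moebius_denominator w v ltac:(lra)).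
    fold be in H. lra. }
  assert (Hphi : forall v, Cmod v < 1 -> Cmod (phi v) ^ 2 =
    1 - (1 - Cmod v ^ 2) * (1 - be ^ 2) / Cmod (1 + Cconj w * v) ^ 2).
  { intros v Hv. unfold phi. rewrite Cmod_div by auto.
    pose proof (moebius_identity w v) as H. fold be in H. rewrite <- H.
    assert (0 < Cmod (1 + Cconj w * v)) by (apply Cmod_gt_0; auto).
    field. lra. }
  assert (Hphi1 : forall v, Cmod v < 1 -> Cmod (phi v) < 1).
  { intros v Hv. pose proof (Cmod_ge_0 v). pose proof (Cmod_ge_0 (phi v)).
    assert (0 < Cmod (1 + Cconj w * v)) by (apply Cmod_gt_0; auto).
    assert (Cmod (phi v) ^ 2 < 1); [|nra].
    rewrite Hphi by assumption.
    assert (0 < (1 - Cmod v ^ 2) * (1 - be ^ 2) / Cmod (1 + Cconj w * v) ^ 2); [|lra].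
    apply Rdiv_lt_0_compat. apply Rmult_lt_0_compat; nra. nra. }
  assert (Hphid : forall v, Cmod v < 1 -> exists d, Cderiv phi v d).
  { intros v Hv. eexists. apply cderiv_div. auto.
    apply cderiv_plus. apply cderiv_id. apply cderiv_const.
    apply cderiv_plus. apply cderiv_const. apply cderiv_scal. apply cderiv_id. }
  assert (Hphi0 : phi 0 = w).
  { unfold phi. rewrite Cmult_0_r, Cplus_0_l, Cplus_0_r. field. }
  assert (Hgd : forall v, Cmod v < 1 -> exists d, Cderiv (fun v => f (phi v)) v d).
  { intros v Hv. destruct (Hphid v Hv) as [d1 H1].
    destruct (Hf (phi v) (Hphi1 v Hv)) as [d2 H2]. eexists.
    apply (cderiv_comp f phi). exact H2. exact H1. }
  (* Chosen so that 1 - t^2 = (1 - be)^2 / 2. Since |1 + conj(w) v| >= 1 - be, the formula for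
     |phi|^2 then gives |phi|^2 >= 1 - (1 - be^2) / 2 on |v| = t, which is kap^2, the midpoint of
     be^2 and 1. *)
  set (t := sqrt (1 - (1 - be) ^ 2 / 2)).
  assert (Ht2 : t ^ 2 = 1 - (1 - be) ^ 2 / 2).
  { unfold t. apply pow2_sqrt. nra. }
  assert (Ht0 : 0 < t) by (apply sqrt_lt_R0; nra).
  assert (Ht1 : t < 1) by nra.
  set (kap := sqrt ((1 + be ^ 2) / 2)).
  assert (Hk2 : kap ^ 2 = (1 + be ^ 2) / 2).
  { unfold kap. apply pow2_sqrt. nra. }
  assert (Hk0 : 0 < kap) by (apply sqrt_lt_R0; nra).
  assert (Hkb : be < kap) by nra.
  assert (Hcirc : forall th, Cmod (cexp (ln t, th)) = t).
  { intros th. rewrite Cmod_cexp. simpl. now apply exp_ln. }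
  assert (Hlow : forall v, Cmod v = t -> kap <= Cmod (phi v)).
  { intros v Hv. pose proof (Cmod_ge_0 (phi v)).
    assert (kap ^ 2 <= Cmod (phi v) ^ 2); [|nra].
    rewrite Hphi by lra. rewrite Hv, Ht2, Hk2.
    pose proof (moebius_denominator w v ltac:(lra)) as Hm. fold be in Hm.
    set (D := Cmod (1 + Cconj w * v)) in *.
    assert (HD : (1 - be) ^ 2 <= D ^ 2) by nra.
    assert (HD0 : 0 < D ^ 2) by nra.
    assert ((1 - be) ^ 2 / 2 * (1 - be ^ 2) / D ^ 2 <= (1 - be ^ 2) / 2).
    { apply Rmult_le_reg_r with (D ^ 2). exact HD0.
      replace ((1 - be) ^ 2 / 2 * (1 - be ^ 2) / D ^ 2 * D ^ 2)
        with ((1 - be) ^ 2 * (1 - be ^ 2) / 2) by (field; nra).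
      assert ((1 - be) ^ 2 * (1 - be ^ 2) <= D ^ 2 * (1 - be ^ 2)).
      { apply Rmult_le_compat_r. nra. exact HD. }
      lra. }
    replace (1 - (1 - (1 - be) ^ 2 / 2)) with ((1 - be) ^ 2 / 2) by ring. lra. }
  destruct (continuous_bounded (fun th => Cmod (f (phi (0 + cexp (ln t, th))%C))) 0 (2 * PI))
    as [M HM].
  { pose proof PI_RGT_0; lra. }
  { intros th _.
    apply (Rcont_Cmod (fun th => f (phi (0 + cexp (ln t, th))%C))).
    apply (Rcont_vertical (fun v => f (phi (0 + cexp v)%C))).
    destruct (Hgd (0 + cexp (ln t, th))%C) as [d Hd].
    rewrite Cplus_0_l, Hcirc. lra.
    eapply cderiv_continuous.
    apply (cderiv_comp (fun v => f (phi v)) (fun v => 0 + cexp v)%C). exact Hd.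
    apply cderiv_plus. apply cderiv_const. apply cderiv_cexp. }
  apply Cmod_eq_0. apply geometric_bound_zero with (2 * M) (be / kap).
  { split. apply Rdiv_le_0_compat; lra. apply Rmult_lt_reg_r with kap. lra.
    unfold Rdiv. rewrite Rmult_assoc, Rinv_l; lra. }
  { apply Cmod_ge_0. }
  intros n.
  assert (Hn := mean_value_bound (fun v => f (phi v) * (/ phi v) ^ n)%C 0 1 (ln t)
    (M * (/ kap) ^ n)).
  rewrite exp_ln in Hn by assumption. specialize (Hn Ht1).
  assert (Hh : forall v, Cmod (v - 0) < 1 ->
    exists d, Cderiv (fun v => f (phi v) * (/ phi v) ^ n)%C v d).
  { intros v Hv. replace (v - 0)%C with v in Hv by ring.
    destruct (Hphid v Hv) as [d1 H1].
    (* At a zero of phi the factor 1 / phi^n is singular, but f vanishes near 0, so the product is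
       identically 0 around v. *)
    destruct (classic (phi v = 0)) as [E|E].
    - exists (RtoC 0). apply cderiv_ext_loc with (fun _ => RtoC 0).
      2: apply cderiv_const.
      generalize (proj1 (clim_spec _ _) (cderiv_continuous _ _ _ H1) r0 Hr0).
      apply filter_imp. intros u Hu. rewrite Hz. ring.
      rewrite E in Hu. now replace (phi u - 0)%C with (phi u) in Hu by ring.
    - destruct (Hgd v Hv) as [d2 H2].
      destruct (ex_cderiv_pow (fun v => / phi v)%C v n) as [d3 H3].
      eexists. apply cderiv_inv. exact E. exact H1.
      eexists. apply (cderiv_mult (fun v => f (phi v)) (fun v => (/ phi v) ^ n)%C).
      exact H2. exact H3. }
  specialize (Hn Hh).
  assert (Hc : forall th, 0 <= th <= 2 * PI ->
    Cmod (f (phi (0 + cexp (ln t, th))%C) * (/ phi (0 + cexp (ln t, th))%C) ^ n)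
      <= M * (/ kap) ^ n).
  { intros th Hth.
    assert (Hl := Hlow (0 + cexp (ln t, th))%C). rewrite Cplus_0_l in Hl at 1.
    specialize (Hl (Hcirc th)). specialize (HM th Hth).
    set (p := phi (0 + cexp (ln t, th))%C) in *.
    rewrite Cmod_mult, Cmod_pow, Cmod_inv by (apply Cmod_gt_0; lra).
    apply Rmult_le_compat. apply Cmod_ge_0. apply pow_le.
    left; apply Rinv_0_lt_compat; lra. exact HM.
    apply pow_incr. split. left; apply Rinv_0_lt_compat; lra.
    apply Rinv_le_contravar; lra. }
  specialize (Hn Hc). rewrite Hphi0 in Hn.
  rewrite Cmod_mult, Cmod_pow, Cmod_inv in Hn by (apply Cmod_gt_0; fold be; lra).
  fold be in Hn.
  apply Rmult_le_reg_r with ((/ be) ^ n). apply pow_lt, Rinv_0_lt_compat; lra.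
  apply Rle_trans with (1 := Hn). right.
  rewrite !Rmult_assoc, <- !Rpow_mult_distr. do 3 f_equal. field. lra.
Qed.

Lemma disc_zero (f : C -> C) (a : C) (rad r0 : R) : 0 < r0 ->
  (forall v, Cmod (v - a) < rad -> exists d, Cderiv f v d) ->
  (forall v, Cmod (v - a) < r0 -> f v = 0) ->
  forall w, Cmod (w - a) < rad -> f w = 0.
Proof.
  intros Hr0 Hf Hz w Hw.
  assert (Hrad : 0 < rad) by (pose proof (Cmod_ge_0 (w - a)); lra).
  assert (Hscale : forall v, Cmod (a + RtoC rad * v - a) = rad * Cmod v).
  { intros v. replace (a + RtoC rad * v - a)%C with (RtoC rad * v)%C by ring.
    rewrite Cmod_mult, Cmod_R, Rabs_pos_eq; lra. }
  assert (H := unit_disc_zero (fun v => f (a + RtoC rad * v)%C) (r0 / rad)).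
  assert (Hw' : (a + RtoC rad * ((w - a) / RtoC rad))%C = w) by (field; C_nz).
  cbv beta in H. rewrite <- Hw'. apply H.
  - now apply Rdiv_lt_0_compat.
  - intros v Hv. destruct (Hf (a + RtoC rad * v)%C) as [d Hd].
    rewrite Hscale. nra.
    eexists. apply (cderiv_comp f (fun v => a + RtoC rad * v)%C). exact Hd.
    apply cderiv_plus. apply cderiv_const. apply cderiv_scal. apply cderiv_id.
  - intros v Hv. apply Hz. rewrite Hscale.
    apply Rlt_le_trans with (rad * (r0 / rad)). now apply Rmult_lt_compat_l.
    right; field; lra.
  - rewrite Cmod_div, Cmod_R, Rabs_pos_eq by (try C_nz; lra).
    apply Rmult_lt_reg_r with rad. assumption.
    unfold Rdiv. rewrite Rmult_assoc, Rinv_l; lra.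
Qed.

Lemma cexp_surj (v : C) : v <> 0 -> exists u, cexp u = v.
Proof.
  intros Hv. assert (Hm : 0 < Cmod v) by now apply Cmod_gt_0.
  set (c := Re v / Cmod v). set (s := Im v / Cmod v).
  assert (Hcs : c ^ 2 + s ^ 2 = 1).
  { unfold c, s. pose proof (Cmod2_alt v).
    replace ((Re v / Cmod v) ^ 2 + (Im v / Cmod v) ^ 2)
      with ((Re v ^ 2 + Im v ^ 2) / Cmod v ^ 2) by (field; lra).
    rewrite <- H. field. lra. }
  assert (Hth : exists th, cos th = c /\ sin th = s).
  { assert (Hc : -1 <= c <= 1) by nra.
    assert (E : sqrt (1 - Rsqr c) = Rabs s).
    { rewrite <- sqrt_Rsqr_abs. f_equal. unfold Rsqr. nra. }
    destruct (Rle_lt_dec 0 s) as [Hs|Hs].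
    - exists (acos c). split. now apply cos_acos.
      rewrite sin_acos, E by assumption. now apply Rabs_pos_eq.
    - exists (- acos c). rewrite cos_neg, sin_neg. split. now apply cos_acos.
      rewrite sin_acos, E by assumption. rewrite Rabs_left; lra. }
  destruct Hth as [th [H1 H2]]. exists (ln (Cmod v), th).
  unfold cexp. simpl. rewrite exp_ln by assumption. rewrite H1, H2.
  apply C_ext; unfold c, s, Re, Im; simpl; field; lra.
Qed.

Lemma punctured_disc_zero (f : C -> C) (p v0 : C) (eps r0 : R) : 0 < r0 ->
  (forall v, 0 < Cmod (v - p) < eps -> exists d, Cderiv f v d) ->
  0 < Cmod (v0 - p) < eps -> (forall v, Cmod (v - v0) < r0 -> f v = 0) ->
  forall v, 0 < Cmod (v - p) < eps -> f v = 0.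
Proof.
  intros Hr0 Hf Hv0 Hz v1 Hv1.
  assert (Heps : 0 < eps) by lra.
  set (L := ln eps).
  set (g u := f (p + cexp u)%C).
  assert (Hg : forall u, Re u < L -> exists d, Cderiv g u d).
  { intros u Hu. destruct (Hf (p + cexp u)%C) as [d Hd].
    - replace (p + cexp u - p)%C with (cexp u) by ring. rewrite Cmod_cexp. split.
      apply exp_pos. rewrite <- (exp_ln eps Heps). now apply exp_increasing.
    - eexists. apply (cderiv_comp f (fun v => p + cexp v)%C). exact Hd.
      apply cderiv_plus. apply cderiv_const. apply cderiv_cexp. }
  assert (Hlog : forall v, 0 < Cmod (v - p) < eps ->
    exists u, (p + cexp u)%C = v /\ Re u < L).
  { intros v Hv. destruct (cexp_surj (v - p)) as [u Hu]. now apply Cmod_gt_0.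
    exists u. rewrite Hu. split. ring.
    apply exp_lt_inv. unfold L. rewrite exp_ln by assumption.
    rewrite <- Cmod_cexp, Hu. apply Hv. }
  set (Z u := exists r, 0 < r /\ forall v, Cmod (v - u) < r -> g v = 0).
  assert (Hstep : forall u u', Z u -> Cmod (u' - u) < L - Re u -> Z u').
  { intros u u' [r [Hr Hu]] Hd.
    exists (L - Re u - Cmod (u' - u)). split. lra.
    intros v Hv. apply (disc_zero g u (L - Re u) r Hr); trivial.
    - intros x Hx. apply Hg. pose proof (re_le_Cmod (x - u)) as H.
      rewrite Re_minus in H. pose proof (Rle_abs (Re x - Re u)). lra.
    - replace (v - u)%C with ((v - u') + (u' - u))%C by ring.
      apply Rle_lt_trans with (1 := Cmod_triangle _ _). lra. }
  destruct (Hlog v0 Hv0) as [u0 [Hu0 HL0]].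
  destruct (Hlog v1 Hv1) as [u1 [Hu1 HL1]].
  assert (HZ0 : Z u0).
  { destruct (proj1 (clim_spec _ _) (cderiv_continuous cexp u0 _ (cderiv_cexp u0)) r0 Hr0)
      as [e He].
    destruct (proj1 (locally_C_spec u0 (fun v => Cmod (cexp v - cexp u0) < r0)))
      as [e' [He' H]]. now exists e.
    exists e'. split. exact He'. intros v Hv. apply Hz. rewrite <- Hu0.
    replace (p + cexp v - (p + cexp u0))%C with (cexp v - cexp u0)%C by ring. auto. }
  set (rho := L - Re u0). assert (Hrho : 0 < rho) by (unfold rho; lra).
  assert (Hleft : forall k, Z (u0 - RtoC (INR k * (rho / 2)))%C).
  { induction k as [|k IH].
    - simpl INR. rewrite Rmult_0_l. now replace (u0 - RtoC 0)%C with u0 by ring.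
    - apply Hstep with (1 := IH).
      replace (u0 - RtoC (INR (S k) * (rho / 2)) - (u0 - RtoC (INR k * (rho / 2))))%C
        with (- RtoC (rho / 2))%C.
      2:{ rewrite S_INR, Rmult_plus_distr_r, RtoC_plus. rewrite Rmult_1_l. ring. }
      rewrite Cmod_opp, Cmod_R, Rabs_pos_eq by lra.
      rewrite Re_minus, re_RtoC. pose proof (pos_INR k). unfold rho in *. nra. }
  set (X := Re (u1 - u0)). set (Y := Im (u1 - u0)).
  assert (HX : X < rho) by (unfold X, rho; rewrite Re_minus; lra).
  (* With m = (k + 1) rho / 2 this k makes X^2 + Y^2 < 2 m (rho - X), whence (X + m)^2 + Y^2 < (rho
     + m)^2: u1 lies in the disc about u0 - m. *)
  destruct (nfloor_ex (Rmax 0 ((X ^ 2 + Y ^ 2) / (rho - X) / rho))) as [k [_ Hk]].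
  apply Rmax_l.
  assert (Hk2 : X ^ 2 + Y ^ 2 < 2 * (INR (S k) * (rho / 2)) * (rho - X)).
  { rewrite S_INR.
    assert (H : (X ^ 2 + Y ^ 2) / (rho - X) / rho < INR k + 1).
    { apply Rle_lt_trans with (2 := Hk). apply Rmax_r. }
    apply Rmult_lt_compat_r with (r := rho * (rho - X)) in H. 2: nra.
    replace ((X ^ 2 + Y ^ 2) / (rho - X) / rho * (rho * (rho - X)))
      with (X ^ 2 + Y ^ 2) in H by (field; lra). lra. }
  set (m := INR (S k) * (rho / 2)) in *.
  assert (Hm : 0 <= m) by (unfold m; pose proof (pos_INR (S k)); nra).
  destruct (Hstep _ u1 (Hleft (S k))) as [r [Hr H]].
  - fold m. rewrite Re_minus, re_RtoC.
    apply Rsqr_incrst_0. 2: apply Cmod_ge_0. 2: unfold rho in *; lra.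
    unfold Rsqr. 
    replace (Cmod (u1 - (u0 - RtoC m)) * Cmod (u1 - (u0 - RtoC m)))
      with (Cmod (u1 - (u0 - RtoC m)) ^ 2) by ring.
    rewrite Cmod2_alt, !Re_minus, !Im_minus, re_RtoC, im_RtoC.
    replace (L - (Re u0 - m)) with (rho + m) by (unfold rho; ring).
    replace (Re u1 - (Re u0 - m)) with (X + m) by (unfold X; rewrite Re_minus; ring).
    replace (Im u1 - (Im u0 - 0)) with Y by (unfold Y; rewrite Im_minus; ring).
    nra.
  - rewrite <- Hu1. apply (H u1). replace (u1 - u1)%C with (RtoC 0) by ring.
    now rewrite Cmod_0.
Qed.

(** The centre is left out because the value of f at an isolated singularity carries no
    information. *)
Definition zero_near (f : C -> C) (p : C) : Prop :=
  exists eps, 0 < eps /\ forall v, 0 < Cmod (v - p) < eps -> f v = 0.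

Lemma zero_near_spread (f : C -> C) (p p' : C) (eps : R) :
  (forall v, 0 < Cmod (v - p) < eps -> exists d, Cderiv f v d) ->
  Cmod (p' - p) < eps -> zero_near f p' ->
  forall v, 0 < Cmod (v - p) < eps -> f v = 0.
Proof.
  intros Hf Hp [e [He Hz]].
  set (del := Rmin e (eps - Cmod (p' - p)) / 2).
  assert (Hdel : 0 < del) by (unfold del; apply Rdiv_lt_0_compat; [apply Rmin_glb_lt|]; lra).
  assert (Hde : 2 * del <= e).
  { unfold del. pose proof (Rmin_l e (eps - Cmod (p' - p))). lra. }
  assert (Hdp : 2 * del <= eps - Cmod (p' - p)).
  { unfold del. pose proof (Rmin_r e (eps - Cmod (p' - p))). lra. }
  (* The auxiliary centre p' + tau must differ from the possible singularity p; two candidates for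
     tau suffice, as at most one of them hits p. *)
  assert (Htau : exists tau, 0 < tau <= del /\ (p' + RtoC tau)%C <> p).
  { destruct (classic ((p' + RtoC del)%C = p)) as [E|E].
    - exists (del / 2). split. lra. rewrite <- E. intros E2.
      apply (f_equal Re) in E2. rewrite !Re_plus, !re_RtoC in E2. lra.
    - exists del. split. lra. exact E. }
  destruct Htau as [tau [Ht Hne]].
  apply (punctured_disc_zero f p (p' + RtoC tau)%C eps tau).
  - lra.
  - exact Hf.
  - split. apply Cmod_gt_0. now apply Cminus_eq_contra.
    replace (p' + RtoC tau - p)%C with (RtoC tau + (p' - p))%C by ring.
    apply Rle_lt_trans with (1 := Cmod_triangle _ _).
    rewrite Cmod_R, Rabs_pos_eq; lra.
  - intros v Hv. apply Hz. split.
    + replace (v - p')%C with (RtoC tau - (p' + RtoC tau - v))%C by ring.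
      rewrite Cmod_minus_sym in Hv.
      pose proof (Cmod_triangle_rev (RtoC tau) (p' + RtoC tau - v)) as H.
      rewrite Cmod_R, Rabs_pos_eq in H; lra.
    + replace (v - p')%C with ((v - (p' + RtoC tau)) + RtoC tau)%C by ring.
      apply Rle_lt_trans with (1 := Cmod_triangle _ _).
      rewrite Cmod_R, Rabs_pos_eq; lra.
Qed.

Lemma zero_near_inside (f : C -> C) (p p' : C) (eps : R) :
  (forall v, 0 < Cmod (v - p) < eps -> f v = 0) -> Cmod (p' - p) < eps -> zero_near f p'.
Proof.
  intros Hz Hp. pose proof (Cmod_ge_0 (p' - p)) as H0.
  destruct (classic (p' = p)) as [->|E].
  - exists eps. split. lra. exact Hz.
  - apply Cminus_eq_contra, Cmod_gt_0 in E.
    exists (Rmin (Cmod (p' - p)) (eps - Cmod (p' - p))). split.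
    apply Rmin_glb_lt; lra.
    intros v [_ Hv]. apply Hz.
    pose proof (Rlt_le_trans _ _ _ Hv (Rmin_l _ _)).
    pose proof (Rlt_le_trans _ _ _ Hv (Rmin_r _ _)). split.
    + replace (v - p)%C with ((p' - p) - (p' - v))%C by ring.
      pose proof (Cmod_triangle_rev (p' - p) (p' - v)).
      rewrite (Cmod_minus_sym p' v) in H2. lra.
    + replace (v - p)%C with ((v - p') + (p' - p))%C by ring.
      apply Rle_lt_trans with (1 := Cmod_triangle _ _). lra.
Qed.

(** Connectedness along the segment from p0 to p: the supremum of the parameters reached so far is
    passed by [zero_near_spread]. The segment may run through singularities, since [zero_near]
    ignores the centre. *)
Lemma identity_theorem (f : C -> C) (p0 p : C) :
  (forall w, exists eps, 0 < eps /\
     forall v, 0 < Cmod (v - w) < eps -> exists d, Cderiv f v d) ->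
  zero_near f p0 -> zero_near f p.
Proof.
  intros Hf H0.
  set (ga t := (p0 + RtoC t * (p - p0))%C).
  assert (Hga : forall s t, Cmod (ga s - ga t) = Rabs (s - t) * Cmod (p - p0)).
  { intros s t. unfold ga. rewrite <- Cmod_R, <- Cmod_mult. f_equal.
    rewrite RtoC_minus. ring. }
  set (K := Cmod (p - p0) + 1).
  assert (HK : 0 < K) by (unfold K; pose proof (Cmod_ge_0 (p - p0)); lra).
  assert (Hclose : forall s t e, Rabs (s - t) < e / K -> Cmod (ga s - ga t) < e).
  { intros s t e Hst. rewrite Hga. pose proof (Rabs_pos (s - t)).
    apply Rle_lt_trans with (Rabs (s - t) * K).
    apply Rmult_le_compat_l. assumption. unfold K; lra.
    apply Rmult_lt_compat_r with (r := K) in Hst. 2: assumption.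
    replace (e / K * K) with e in Hst by (field; lra). exact Hst. }
  set (E t := 0 <= t <= 1 /\ forall u, 0 <= u <= t -> zero_near f (ga u)).
  assert (HE0 : E 0).
  { split. lra. intros u Hu. replace u with 0 by lra. unfold ga.
    now replace (p0 + RtoC 0 * (p - p0))%C with p0 by ring. }
  destruct (completeness E) as [ts [Hts1 Hts2]].
  { exists 1. intros t [Ht _]. lra. } { now exists 0. }
  assert (Hts : 0 <= ts <= 1).
  { split. now apply Hts1. apply Hts2. intros t [Ht _]. lra. }
  destruct (Hf (ga ts)) as [eps [He Hd]].
  assert (HeK : 0 < eps / K) by now apply Rdiv_lt_0_compat.
  assert (Ht : exists t, E t /\ ts - eps / K < t).
  { apply NNPP. intros Hn. assert (ts <= ts - eps / K); [|lra].
    apply Hts2. intros t Ht. apply Rnot_lt_le. intros Hlt. apply Hn. now exists t. }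
  destruct Ht as [t [[Ht01 Ht] Htts]].
  assert (Htle : t <= ts) by now apply Hts1.
  assert (Hzero := zero_near_spread f (ga ts) (ga t) eps Hd).
  assert (Hzero' : forall v, 0 < Cmod (v - ga ts) < eps -> f v = 0).
  { apply Hzero. apply Hclose. rewrite Rabs_left1; lra. apply Ht. lra. }
  set (t' := Rmin 1 (ts + eps / K / 2)).
  assert (HE' : E t').
  { split. unfold t'. split. apply Rmin_glb; lra. apply Rmin_l.
    intros u Hu. destruct (Rle_lt_dec u t) as [Hut|Hut]. apply Ht; lra.
    apply (zero_near_inside f (ga ts) (ga u) eps Hzero').
    apply Hclose.
    assert (u <= ts + eps / K / 2) by (apply Rle_trans with (1 := proj2 Hu); apply Rmin_r).
    apply Rabs_lt_between. lra. }
  assert (Ht'1 : t' = 1).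
  { unfold t'. apply Rmin_left. apply Rnot_lt_le. intros Hlt.
    pose proof (Hts1 t' HE'). unfold t' in H. rewrite Rmin_right in H; lra. }
  assert (Hfin : zero_near f (ga 1)) by (apply HE'; lra).
  unfold ga in Hfin. now replace (p0 + RtoC 1 * (p - p0))%C with p in Hfin by ring.
Qed.

(** * Differentiation of series *)

(** One constant bounds value, derivative d and quadratic remainder at once. Such constants multiply
    under products and, when summable, allow termwise differentiation. *)
Definition quad (f : C -> C) (w d : C) (eps M : R) : Prop :=
  Cmod (f w) <= M /\ Cmod d <= M /\
  forall v, Cmod (v - w) < eps ->
    Cmod (f v - f w - d * (v - w)) <= M * Cmod (v - w) ^ 2.

Lemma quad_ge0 (f : C -> C) (w d : C) (eps M : R) : quad f w d eps M -> 0 <= M.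
Proof. intros [H _]. pose proof (Cmod_ge_0 (f w)). lra. Qed.

Lemma quad_lipschitz (f : C -> C) (w d : C) (eps M : R) : eps <= 1 ->
  quad f w d eps M -> forall v, Cmod (v - w) < eps ->
  Cmod (f v - f w) <= 2 * M * Cmod (v - w).
Proof.
  intros He H v Hv. assert (HM := quad_ge0 _ _ _ _ _ H). destruct H as [_ [H2 H3]].
  specialize (H3 v Hv).
  replace (f v - f w)%C with (f v - f w - d * (v - w) + d * (v - w))%C by ring.
  apply Rle_trans with (1 := Cmod_triangle _ _). rewrite Cmod_mult.
  pose proof (Cmod_ge_0 (v - w)) as Hx. set (x := Cmod (v - w)) in *.
  assert (Cmod d * x <= M * x) by (apply Rmult_le_compat_r; lra).
  assert (M * x ^ 2 <= M * x).
  { apply Rmult_le_compat_l. exact HM. simpl. nra. }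
  lra.
Qed.

Lemma quad_bound (f : C -> C) (w d : C) (eps M : R) : eps <= 1 ->
  quad f w d eps M -> forall v, Cmod (v - w) < eps -> Cmod (f v) <= 3 * M.
Proof.
  intros He H v Hv. assert (HM := quad_ge0 _ _ _ _ _ H).
  pose proof (quad_lipschitz _ _ _ _ _ He H v Hv) as H1. destruct H as [H0 _].
  replace (f v) with (f v - f w + f w)%C by ring.
  apply Rle_trans with (1 := Cmod_triangle _ _).
  pose proof (Cmod_ge_0 (v - w)). nra.
Qed.

Lemma quad_le (f : C -> C) (w d : C) (eps M eps' M' : R) : eps' <= eps -> M <= M' ->
  quad f w d eps M -> quad f w d eps' M'.
Proof.
  intros He HM [H1 [H2 H3]]. split. lra. split. lra.
  intros v Hv. apply Rle_trans with (1 := H3 v ltac:(lra)).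
  apply Rmult_le_compat_r. apply pow2_ge_0. exact HM.
Qed.

(** The remainder of the product costs 6 M N: one for the remainder of each factor and 4 for the
    product of the two increments, by [quad_lipschitz]. The derivative costs 2 M N. *)
Lemma quad_mult (f g : C -> C) (w d e : C) (eps M N : R) : eps <= 1 ->
  quad f w d eps M -> quad g w e eps N ->
  quad (fun v => f v * g v)%C w (d * g w + f w * e)%C eps (7 * M * N).
Proof.
  intros He Hf Hg.
  assert (HM := quad_ge0 _ _ _ _ _ Hf). assert (HN := quad_ge0 _ _ _ _ _ Hg).
  assert (Lf := quad_lipschitz _ _ _ _ _ He Hf).
  assert (Lg := quad_lipschitz _ _ _ _ _ He Hg).
  destruct Hf as [F1 [F2 F3]], Hg as [G1 [G2 G3]].
  pose proof (Cmod_ge_0 (f w)). pose proof (Cmod_ge_0 (g w)).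
  pose proof (Cmod_ge_0 d). pose proof (Cmod_ge_0 e).
  assert (HMN : 0 <= M * N) by nra.
  split. rewrite Cmod_mult. 
  { apply Rle_trans with (M * N). now apply Rmult_le_compat. lra. }
  split.
  { apply Rle_trans with (1 := Cmod_triangle _ _). rewrite !Cmod_mult.
    assert (Cmod d * Cmod (g w) <= M * N) by now apply Rmult_le_compat.
    assert (Cmod (f w) * Cmod e <= M * N) by now apply Rmult_le_compat. lra. }
  intros v Hv. specialize (F3 v Hv). specialize (G3 v Hv).
  specialize (Lf v Hv). specialize (Lg v Hv).
  replace (f v * g v - f w * g w - (d * g w + f w * e) * (v - w))%C with
    ((f v - f w - d * (v - w)) * g w + (f w * (g v - g w - e * (v - w)) +
     (f v - f w) * (g v - g w)))%C by ring.
  apply Rle_trans with (1 := Cmod_triangle _ _).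
  pose proof (Cmod_triangle (f w * (g v - g w - e * (v - w))) ((f v - f w) * (g v - g w))) as T.
  rewrite !Cmod_mult in T. rewrite Cmod_mult.
  pose proof (Cmod_ge_0 (v - w)) as Hx. set (x := Cmod (v - w)) in *.
  assert (0 <= x ^ 2) by apply pow2_ge_0.
  assert (Cmod (f v - f w - d * (v - w)) * Cmod (g w) <= M * x ^ 2 * N).
  { apply Rmult_le_compat; trivial. apply Cmod_ge_0. }
  assert (Cmod (f w) * Cmod (g v - g w - e * (v - w)) <= M * (N * x ^ 2)).
  { apply Rmult_le_compat; trivial. apply Cmod_ge_0. }
  assert (Cmod (f v - f w) * Cmod (g v - g w) <= (2 * M * x) * (2 * N * x)).
  { apply Rmult_le_compat; trivial; apply Cmod_ge_0. }
  nra.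
Qed.

(** The three summands of the constant bound, in this order, the value, the derivative and the
    remainder of 1 / f. *)
Lemma quad_inv (f : C -> C) (w d : C) (eps M del : R) : 0 < eps <= 1 -> 0 < del ->
  (forall v, Cmod (v - w) < eps -> del <= Cmod (f v)) ->
  quad f w d eps M ->
  quad (fun v => / f v)%C w (- d / (f w * f w))%C eps (/ del + M / del ^ 2 + 3 * M ^ 2 / del ^ 3).
Proof.
  intros He Hd Hlow Hf. assert (HM := quad_ge0 _ _ _ _ _ Hf).
  assert (Lf := quad_lipschitz _ _ _ _ _ (proj2 He) Hf).
  assert (Hw : del <= Cmod (f w)).
  { apply Hlow. replace (w - w)%C with (RtoC 0) by ring. rewrite Cmod_0. lra. }
  assert (Hfw : f w <> 0) by (apply Cmod_gt_0; lra).
  destruct Hf as [F1 [F2 F3]].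
  assert (P1 : 0 < / del) by now apply Rinv_0_lt_compat.
  assert (P2 : 0 <= M / del ^ 2) by (apply Rdiv_le_0_compat; [|apply pow_lt]; lra).
  assert (P3 : 0 <= 3 * M ^ 2 / del ^ 3).
  { apply Rdiv_le_0_compat. pose proof (pow2_ge_0 M). lra. apply pow_lt; lra. }
  assert (Hinv : forall x, del <= x -> 0 < / x <= / del).
  { intros x Hx. split. apply Rinv_0_lt_compat; lra. apply Rinv_le_contravar; lra. }
  split. { rewrite Cmod_inv by assumption. specialize (Hinv _ Hw). lra. }
  split.
  { rewrite Cmod_div, Cmod_opp, Cmod_mult by now apply Cmult_neq_0.
    specialize (Hinv _ Hw). unfold Rdiv at 1. rewrite Rinv_mult.
    assert (Cmod d * (/ Cmod (f w) * / Cmod (f w)) <= M * (/ del * / del)).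
    { apply Rmult_le_compat; try apply Rmult_le_compat; try lra. apply Cmod_ge_0.
      apply Rmult_le_pos; lra. }
    replace (M / del ^ 2) with (M * (/ del * / del)) in * by (field; lra). lra. }
  intros v Hv. specialize (Hlow v Hv). specialize (F3 v Hv). specialize (Lf v Hv).
  assert (Hfv : f v <> 0) by (apply Cmod_gt_0; lra).
  replace (/ f v - / f w - - d / (f w * f w) * (v - w))%C with
    ((d * (v - w) * (f v - f w) - (f v - f w - d * (v - w)) * f w) *
     (/ f v * (/ f w * / f w)))%C by (field; auto).
  rewrite !Cmod_mult, !Cmod_inv by assumption.
  pose proof (Hinv _ Hw) as I1. pose proof (Hinv _ Hlow) as I2.
  pose proof (Cmod_minus_triangle (d * (v - w) * (f v - f w))
    ((f v - f w - d * (v - w)) * f w)) as T.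
  rewrite !Cmod_mult in T.
  pose proof (Cmod_ge_0 (v - w)) as Hx. set (x := Cmod (v - w)) in *.
  assert (0 <= x ^ 2) by apply pow2_ge_0.
  assert (T1 : Cmod d * x * Cmod (f v - f w) <= M * x * (2 * M * x)).
  { apply Rmult_le_compat; trivial. apply Rmult_le_pos; trivial. apply Cmod_ge_0.
    apply Cmod_ge_0. now apply Rmult_le_compat_r. }
  assert (T2 : Cmod (f v - f w - d * (v - w)) * Cmod (f w) <= M * x ^ 2 * M).
  { apply Rmult_le_compat; trivial; apply Cmod_ge_0. }
  assert (T3 : Cmod (d * (v - w) * (f v - f w) - (f v - f w - d * (v - w)) * f w)
    <= 3 * M ^ 2 * x ^ 2) by (simpl in *; lra).
  apply Rle_trans with ((3 * M ^ 2 * x ^ 2) * (/ del * (/ del * / del))).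
  - apply Rmult_le_compat; trivial. apply Cmod_ge_0.
    apply Rmult_le_pos. lra. apply Rmult_le_pos; lra.
    apply Rmult_le_compat; try lra. apply Rmult_le_pos; lra.
    apply Rmult_le_compat; lra.
  - replace (3 * M ^ 2 * x ^ 2 * (/ del * (/ del * / del)))
      with (3 * M ^ 2 / del ^ 3 * x ^ 2) by (field; lra).
    apply Rmult_le_compat_r; lra.
Qed.

(** With a radius common to all terms, the remainders add up to a quadratic remainder whose constant
    is a bound of the partial sums of M. *)
Lemma cderiv_CS (f : nat -> C -> C) (w : C) (d : nat -> C) (eps : R) (M : nat -> R) :
  0 < eps <= 1 -> summable M -> (forall r, quad (f r) w (d r) eps (M r)) ->
  Cderiv (fun v => CS (fun r => f r v)) w (CS d).
Proof.
  intros He HM Hf.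
  assert (HM3 : summable (fun r => 3 * M r)) by (apply summable_scal; [lra|exact HM]).
  destruct (proj2 HM) as [B HB].
  apply cderiv_second_order with eps B. apply He.
  intros v Hv.
  assert (Hb : forall r, Cmod (f r v) <= 3 * M r).
  { intros r. apply (quad_bound (f r) w (d r) eps); trivial. apply He. }
  assert (Hbw : forall r, Cmod (f r w) <= M r) by (intros r; apply (Hf r)).
  assert (Hbd : forall r, Cmod (d r) <= M r) by (intros r; apply (Hf r)).
  set (x := Cmod (v - w)).
  assert (E : (CS (fun r => f r v) - CS (fun r => f r w) - CS d * (v - w))%C =
    CS (fun r => f r v - f r w - d r * (v - w))%C).
  { symmetry. rewrite (CS_ext _ (fun r => f r v + (- (1) * f r w + - (v - w) * d r))%C)
      by (intros; ring).
    rewrite (CS_plus (fun r => f r v) _ (fun r => 3 * M r) (fun r => (1 + x) * M r)); trivial.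
    rewrite (CS_plus (fun r => - (1) * f r w)%C (fun r => - (v - w) * d r)%C M
      (fun r => x * M r)); trivial.
    rewrite !(CS_scal _ _ M) by trivial. ring.
    - apply summable_scal; trivial. apply Cmod_ge_0.
    - intros r. rewrite Cmod_mult, Cmod_opp, Cmod_1, Rmult_1_l. trivial.
    - intros r. rewrite Cmod_mult, Cmod_opp. apply Rmult_le_compat_l.
      apply Cmod_ge_0. trivial.
    - apply summable_scal; trivial. assert (0 <= x) by apply Cmod_ge_0. lra.
    - intros r. apply Rle_trans with (1 := Cmod_triangle _ _).
      rewrite !Cmod_mult, !Cmod_opp, Cmod_1. fold x.
      assert (x * Cmod (d r) <= x * M r).
      { apply Rmult_le_compat_l. apply Cmod_ge_0. trivial. }
      specialize (Hbw r). lra. }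
  rewrite E.
  apply CS_bound with (fun r => x ^ 2 * M r).
  - apply summable_scal; trivial. apply pow2_ge_0.
  - intros r. rewrite Rmult_comm. now apply Hf.
  - intros n. rewrite rsum_scal, Rmult_comm.
    apply Rmult_le_compat_r. apply pow2_ge_0. apply HB.
Qed.

Lemma is_derive_Re (f : C -> C) (t : R) (d : C) :
  Cderiv f t d -> is_derive (fun u : R => Re (f u)) t (Re d).
Proof.
  intros H. apply is_derive_Reals. intros eps He.
  destruct (proj1 (cderiv_spec _ _ _) H (eps / 2) ltac:(lra)) as [del [Hd H1]].
  exists (mkposreal del Hd). intros h Hh0 Hh. simpl in Hh.
  specialize (H1 (RtoC (t + h))).
  replace (RtoC (t + h) - RtoC t)%C with (RtoC h) in H1 by (rewrite RtoC_plus; ring).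
  rewrite Cmod_R in H1. specialize (H1 Hh).
  pose proof (re_le_Cmod (f (t + h) - f t - d * h)) as H2.
  rewrite !Re_minus, re_scal_r in H2.
  replace ((Re (f (t + h)) - Re (f t)) / h - Re d) with
    ((Re (f (t + h)) - Re (f t) - Re d * h) / h) by (field; exact Hh0).
  unfold Rdiv. rewrite Rabs_mult, Rabs_inv.
  assert (0 < Rabs h) by now apply Rabs_pos_lt.
  apply Rmult_lt_reg_r with (Rabs h). assumption.
  rewrite Rmult_assoc, Rinv_l by lra. nra.
Qed.

Lemma is_derive_Im (f : C -> C) (t : R) (d : C) :
  Cderiv f t d -> is_derive (fun u : R => Im (f u)) t (Im d).
Proof.
  intros H.
  assert (H1 := is_derive_Re (fun v => - Ci * f v)%C t _ (cderiv_scal (- Ci) f t d H)).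
  replace (Im d) with (Re (- Ci * d)) by (unfold Re, Im; simpl; ring).
  revert H1. apply is_derive_ext. intros u. unfold Re, Im; simpl; ring.
Qed.

(** There is no mean value theorem for complex values; it is applied to each component, which costs
    the factor 2. *)
Lemma mean_value_inequality (f : C -> C) (d : R -> C) (a b M : R) : a <= b ->
  (forall t, a <= t <= b -> Cderiv f t (d t)) ->
  (forall t, a <= t <= b -> Cmod (d t) <= M) ->
  Cmod (f b - f a) <= 2 * M * (b - a).
Proof.
  intros Hab Hf HM.
  assert (H1 : Rabs (Re (f b) - Re (f a)) <= M * (b - a)).
  { destruct (MVT_gen (fun u : R => Re (f u)) a b (fun t => Re (d t))) as [c [Hc E]].
    - rewrite Rmin_left, Rmax_right by lra. intros x Hx. apply is_derive_Re, Hf. lra.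
    - rewrite Rmin_left, Rmax_right by lra. intros x Hx.
      apply derivable_continuous_pt. exists (Re (d x)).
      apply is_derive_Reals. apply is_derive_Re, Hf. lra.
    - rewrite Rmin_left, Rmax_right in Hc by lra. rewrite E, Rabs_mult.
      rewrite (Rabs_pos_eq (b - a)) by lra. apply Rmult_le_compat_r. lra.
      apply Rle_trans with (2 := HM c Hc). apply re_le_Cmod. }
  assert (H2 : Rabs (Im (f b) - Im (f a)) <= M * (b - a)).
  { destruct (MVT_gen (fun u : R => Im (f u)) a b (fun t => Im (d t))) as [c [Hc E]].
    - rewrite Rmin_left, Rmax_right by lra. intros x Hx. apply is_derive_Im, Hf. lra.
    - rewrite Rmin_left, Rmax_right by lra. intros x Hx.
      apply derivable_continuous_pt. exists (Im (d x)).
      apply is_derive_Reals. apply is_derive_Im, Hf. lra.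
    - rewrite Rmin_left, Rmax_right in Hc by lra. rewrite E, Rabs_mult.
      rewrite (Rabs_pos_eq (b - a)) by lra. apply Rmult_le_compat_r. lra.
      apply Rle_trans with (2 := HM c Hc). apply im_le_Cmod. }
  apply Rle_trans with (1 := Cmod_le_components _).
  rewrite Re_minus, Im_minus. lra.
Qed.

(** * The binomial series *)

Fixpoint bcoef (s : C) (r : nat) : C :=
  match r with
  | O => 1
  | S m => (bcoef s m * (s + RtoC (INR m)) / RtoC (INR (S m)))%C
  end.

(** The binomial coefficient [bcoef] at a real argument k; it majorizes [bcoef s r] whenever |s| <=
    k. *)
Fixpoint bmaj (k : R) (r : nat) : R :=
  match r with
  | O => 1
  | S m => bmaj k m * (k + INR m) / INR (S m)
  end.

Lemma INR_S_pos (n : nat) : 0 < INR (S n).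
Proof. apply lt_0_INR. lia. Qed.

Lemma RtoC_INR_S (n : nat) : RtoC (INR (S n)) <> 0.
Proof. apply RtoC_neq. pose proof (INR_S_pos n). lra. Qed.

Lemma bmaj_S (k : R) (m : nat) : bmaj k (S m) = bmaj k m * (k + INR m) / INR (S m).
Proof. reflexivity. Qed.

Lemma bcoef_S (s : C) (m : nat) :
  bcoef s (S m) = (bcoef s m * (s + RtoC (INR m)) / RtoC (INR (S m)))%C.
Proof. reflexivity. Qed.

Lemma bmaj_pos (k : R) (r : nat) : 0 <= k -> 0 <= bmaj k r.
Proof.
  intros Hk. induction r as [|r IH]; [simpl; lra|]; rewrite ?bmaj_S.
  apply Rdiv_le_0_compat. 2: apply INR_S_pos.
  pose proof (pos_INR r). apply Rmult_le_pos; lra.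
Qed.

Lemma bmaj_mono (k k' : R) (r : nat) : 0 <= k <= k' -> bmaj k r <= bmaj k' r.
Proof.
  intros Hk. induction r as [|r IH]; [simpl; lra|]; rewrite ?bmaj_S.
  apply Rmult_le_compat_r. left; apply Rinv_0_lt_compat, INR_S_pos.
  pose proof (pos_INR r). pose proof (bmaj_pos k r ltac:(lra)).
  apply Rmult_le_compat; lra.
Qed.

Lemma bmaj_summable (k x : R) : 0 <= k -> 0 <= x < 1 -> summable (fun r => bmaj k r * x ^ r).
Proof.
  intros Hk Hx.
  (* Beyond this index the ratio x (k + n) / (n + 1) is at most (1 + x) / 2, halfway between its
     limit x and 1. *)
  destruct (nfloor_ex (2 * k / (1 - x))) as [J [_ HJ]].
  { apply Rdiv_le_0_compat; lra. }
  apply summable_ratio with (S J) ((1 + x) / 2). lra.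
  - intros n. apply Rmult_le_pos. now apply bmaj_pos. apply pow_le; lra.
  - intros n Hn. rewrite bmaj_S. simpl pow.
    assert (Hn' : INR J + 1 <= INR n) by (rewrite <- S_INR; now apply le_INR).
    pose proof (INR_S_pos n) as HS.
    replace (bmaj k n * (k + INR n) / INR (S n) * (x * x ^ n)) with
      (x * (k + INR n) / INR (S n) * (bmaj k n * x ^ n)) by (field; lra).
    apply Rmult_le_compat_r.
    apply Rmult_le_pos. now apply bmaj_pos. apply pow_le; lra.
    apply Rmult_le_reg_r with (INR (S n)). exact HS.
    replace (x * (k + INR n) / INR (S n) * INR (S n)) with (x * (k + INR n)) by (field; lra).
    rewrite S_INR.
    assert (2 * k < (1 - x) * (INR n)).
    { apply Rmult_lt_reg_r with (/ (1 - x)). apply Rinv_0_lt_compat; lra.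
      replace ((1 - x) * INR n * / (1 - x)) with (INR n) by (field; lra).
      unfold Rdiv in HJ. lra. }
    nra.
Qed.

Lemma bcoef_bound (s : C) (k : R) (r : nat) : Cmod s <= k -> Cmod (bcoef s r) <= bmaj k r.
Proof.
  intros Hk. pose proof (Cmod_ge_0 s) as Hs.
  induction r as [|r IH]; [simpl; rewrite Cmod_1; lra|].
  rewrite bcoef_S, bmaj_S.
  rewrite Cmod_div, Cmod_mult, Cmod_R, Rabs_pos_eq
    by (try apply RtoC_INR_S; left; apply INR_S_pos).
  apply Rmult_le_compat_r. left; apply Rinv_0_lt_compat, INR_S_pos.
  apply Rmult_le_compat; try apply Cmod_ge_0; trivial.
  apply Rle_trans with (1 := Cmod_triangle _ _).
  rewrite Cmod_R, Rabs_pos_eq by apply pos_INR. lra.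
Qed.

Fixpoint dbcoef (s : C) (r : nat) : C :=
  match r with
  | O => 0
  | S m => ((dbcoef s m * (s + RtoC (INR m)) + bcoef s m) / RtoC (INR (S m)))%C
  end.

Lemma dbcoef_S (s : C) (m : nat) : dbcoef s (S m) =
  ((dbcoef s m * (s + RtoC (INR m)) + bcoef s m) / RtoC (INR (S m)))%C.
Proof. reflexivity. Qed.

(* b_r has nonnegative coefficients as a polynomial, so its derivative and
   second-order remainder are majorized by its values at larger arguments. *)
Lemma bcoef_quad (w : C) (r : nat) :
  quad (fun v => bcoef v r) w (dbcoef w r) 1 (bmaj (Cmod w + 3) r).
Proof.
  pose proof (Cmod_ge_0 w) as Hw. set (k := Cmod w + 1).
  assert (Hk : 1 <= k) by (unfold k; lra).
  assert (Hd : forall r, Cmod (dbcoef w r) <= bmaj (k + 1) r).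
  { clear r. induction r as [|r IH]; [simpl; rewrite Cmod_0; lra|].
    rewrite dbcoef_S, bmaj_S.
    rewrite Cmod_div, Cmod_R, Rabs_pos_eq by (try apply RtoC_INR_S; left; apply INR_S_pos).
    apply Rmult_le_compat_r. left; apply Rinv_0_lt_compat, INR_S_pos.
    apply Rle_trans with (1 := Cmod_triangle _ _). rewrite Cmod_mult.
    pose proof (Cmod_triangle w (INR r)) as HT.
    rewrite Cmod_R, Rabs_pos_eq in HT by apply pos_INR. pose proof (pos_INR r).
    assert (Cmod (dbcoef w r) * Cmod (w + INR r) <= bmaj (k + 1) r * (k + INR r)).
    { apply Rmult_le_compat; try apply Cmod_ge_0; trivial. unfold k; lra. }
    assert (Cmod (bcoef w r) <= bmaj (k + 1) r) by (apply bcoef_bound; unfold k; lra).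
    lra. }
  replace (Cmod w + 3) with (k + 2) by (unfold k; ring).
  split. { apply bcoef_bound. unfold k; lra. }
  split. { apply Rle_trans with (1 := Hd r). apply bmaj_mono; lra. }
  intros v Hv. rewrite Rmult_comm.
  pose proof (pow2_ge_0 (Cmod (v - w))) as Hh.
  induction r as [|r IH].
  - simpl bcoef. simpl dbcoef. replace (1 - 1 - 0 * (v - w))%C with (RtoC 0) by ring.
    rewrite Cmod_0. simpl bmaj. lra.
  - rewrite !bcoef_S, dbcoef_S, bmaj_S.
    replace (bcoef v r * (v + INR r) / INR (S r) - bcoef w r * (w + INR r) / INR (S r)
      - (dbcoef w r * (w + INR r) + bcoef w r) / INR (S r) * (v - w))%C with
      (((v + INR r) * (bcoef v r - bcoef w r - dbcoef w r * (v - w))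
       + (v - w) * (v - w) * dbcoef w r) / INR (S r))%C
      by (field; apply RtoC_INR_S).
    rewrite Cmod_div, Cmod_R, Rabs_pos_eq by (try apply RtoC_INR_S; left; apply INR_S_pos).
    unfold Rdiv at 2. rewrite <- Rmult_assoc.
    apply Rmult_le_compat_r. left; apply Rinv_0_lt_compat, INR_S_pos.
    apply Rle_trans with (1 := Cmod_triangle _ _). rewrite !Cmod_mult.
    pose proof (Cmod_triangle v (INR r)) as HT.
    rewrite Cmod_R, Rabs_pos_eq in HT by apply pos_INR. pose proof (pos_INR r).
    assert (Hvk : Cmod v <= k).
    { replace v with ((v - w) + w)%C by ring.
      apply Rle_trans with (1 := Cmod_triangle _ _). unfold k; lra. }
    set (h2 := Cmod (v - w) ^ 2) in *.
    replace (Cmod (v - w) * Cmod (v - w)) with h2 by (unfold h2; ring).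
    set (e := Cmod (bcoef v r - bcoef w r - dbcoef w r * (v - w))) in *.
    assert (Cmod (v + INR r) * e <= (k + INR r) * (h2 * bmaj (k + 2) r)).
    { apply Rmult_le_compat; try apply Cmod_ge_0; trivial. lra. }
    assert (h2 * Cmod (dbcoef w r) <= h2 * bmaj (k + 2) r).
    { apply Rmult_le_compat_l. exact Hh. apply Rle_trans with (1 := Hd r).
      apply bmaj_mono; lra. }
    assert (0 <= h2 * bmaj (k + 2) r).
    { apply Rmult_le_pos. exact Hh. apply bmaj_pos; lra. }
    nra.
Qed.

(** This is r x^(r-1), written by the product rule so that no predecessor of r appears. *)
Fixpoint dpow (x : C) (r : nat) : C :=
  match r with O => 0 | S m => (x * dpow x m + x ^ m)%C end.

Lemma dpow_S (x : C) (r : nat) : dpow x (S r) = (RtoC (INR (S r)) * x ^ r)%C.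
Proof.
  induction r as [|r IH].
  - simpl. ring.
  - change (dpow x (S (S r))) with (x * dpow x (S r) + x ^ S r)%C.
    rewrite IH, (S_INR (S r)), RtoC_plus. simpl Cpow. ring.
Qed.

(** A Cauchy-type estimate by induction on r. The step closes exactly: |v| <= rho - eta multiplies
    the old bound, and the missing eta times that bound pays for the new term, which is controlled
    by rho^r / eta. *)
Lemma pow_quad (x : C) (rho eta : R) (r : nat) : 0 < eta <= 1 -> Cmod x <= rho - 2 * eta ->
  quad (fun v => v ^ r)%C x (dpow x r) eta (rho ^ r / eta ^ 2).
Proof.
  intros He Hx. pose proof (Cmod_ge_0 x) as Hx0.
  assert (Hrho : 0 < rho) by lra.
  assert (He2 : 0 < eta ^ 2) by (apply pow_lt; lra).
  assert (Hp : forall n, 0 <= rho ^ n) by (intros; apply pow_le; lra).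
  assert (Hpow : forall n, Cmod (x ^ n) <= rho ^ n).
  { intros n. rewrite Cmod_pow. apply pow_incr. lra. }
  assert (Hd : forall n, Cmod (dpow x n) <= rho ^ n / eta).
  { induction n as [|n IH]; simpl.
    - rewrite Cmod_0. apply Rdiv_le_0_compat; lra.
    - apply Rle_trans with (1 := Cmod_triangle _ _). rewrite Cmod_mult.
      assert (Cmod x * Cmod (dpow x n) <= (rho - 2 * eta) * (rho ^ n / eta)).
      { apply Rmult_le_compat; trivial. apply Cmod_ge_0. }
      assert (E : (rho - 2 * eta) * (rho ^ n / eta) = rho * rho ^ n / eta - 2 * rho ^ n)
        by (field; lra).
      specialize (Hpow n). specialize (Hp n). lra. }
  assert (Hinv : forall n, rho ^ n / eta <= rho ^ n / eta ^ 2).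
  { intros n. apply Rmult_le_compat_l. apply Hp. apply Rinv_le_contravar; nra. }
  assert (Hone : forall n, rho ^ n <= rho ^ n / eta).
  { intros n. apply Rmult_le_reg_r with eta. lra.
    unfold Rdiv. rewrite Rmult_assoc, Rinv_l by lra. specialize (Hp n). nra. }
  split. { specialize (Hpow r). specialize (Hinv r). specialize (Hone r). lra. }
  split. { specialize (Hd r). specialize (Hinv r). lra. }
  intros v Hv.
  pose proof (pow2_ge_0 (Cmod (v - x))) as Hh.
  induction r as [|r IH].
  - simpl Cpow. simpl dpow. replace (1 - 1 - 0 * (v - x))%C with (RtoC 0) by ring.
    rewrite Cmod_0. apply Rmult_le_pos; trivial.
    apply Rdiv_le_0_compat; simpl; lra.
  - simpl dpow. rewrite !Cpow_S.
    replace (v * v ^ r - x * x ^ r - (x * dpow x r + x ^ r) * (v - x))%C with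
      (v * (v ^ r - x ^ r - dpow x r * (v - x)) + (v - x) * (v - x) * dpow x r)%C by ring.
    apply Rle_trans with (1 := Cmod_triangle _ _). rewrite !Cmod_mult.
    assert (Hvk : Cmod v <= rho - eta).
    { replace v with ((v - x) + x)%C by ring.
      apply Rle_trans with (1 := Cmod_triangle _ _). lra. }
    set (h2 := Cmod (v - x) ^ 2) in *.
    replace (Cmod (v - x) * Cmod (v - x)) with h2 by (unfold h2; ring).
    set (e := Cmod (v ^ r - x ^ r - dpow x r * (v - x))) in *.
    assert (Cmod v * e <= (rho - eta) * (rho ^ r / eta ^ 2 * h2)).
    { apply Rmult_le_compat; try apply Cmod_ge_0; trivial. }
    assert (h2 * Cmod (dpow x r) <= h2 * (rho ^ r / eta)).
    { apply Rmult_le_compat_l; trivial. }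
    replace (rho ^ S r / eta ^ 2 * h2) with
      ((rho - eta) * (rho ^ r / eta ^ 2 * h2) + h2 * (rho ^ r / eta))
      by (simpl; field; lra).
    lra.
Qed.

Lemma quad_scal (c : C) (f : C -> C) (w d : C) (eps M : R) : quad f w d eps M ->
  quad (fun v => c * f v)%C w (c * d)%C eps (Cmod c * M).
Proof.
  intros [H1 [H2 H3]]. pose proof (Cmod_ge_0 c). split; [|split].
  - rewrite Cmod_mult. now apply Rmult_le_compat_l.
  - rewrite Cmod_mult. now apply Rmult_le_compat_l.
  - intros v Hv. replace (c * f v - c * f w - c * d * (v - w))%C with
      (c * (f v - f w - d * (v - w)))%C by ring.
    rewrite Cmod_mult, Rmult_assoc. apply Rmult_le_compat_l; auto.
Qed.

Lemma CS_head (a : nat -> C) (M : nat -> R) : summable M ->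
  (forall n, Cmod (a n) <= M n) -> CS a = (a O + CS (fun n => a (S n)))%C.
Proof.
  intros HM Ha.
  assert (HM1 : summable (fun n => M (S n))).
  { destruct HM as [H0 [B HB]]. split. intros; apply H0. exists B. intros n.
    apply Rle_trans with (2 := HB (S n)). clear HB Ha.
    induction n as [|n IH]; simpl in *. specialize (H0 O). lra. lra. }
  apply CS_unique. apply clim_incr_1.
  apply clim_ext with (fun n => a O + csum (fun k => a (S k)) n)%C.
  - intros n. symmetry. apply csum_head.
  - apply clim_plus. apply clim_const. apply CS_lim with (fun n => M (S n)).
    exact HM1. intros; apply Ha.
Qed.

(* t |-> f (1 - e^(-t)) e^(-s t) has derivative zero, where f is the series. *)
Lemma binomial_series (s : C) (x : R) : 0 <= x < 1 ->
  CS (fun r => bcoef s r * RtoC (x ^ r))%C = cpowR (1 - x) (- s).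
Proof.
  intros Hx.
  set (f v := CS (fun r => bcoef s r * v ^ r)%C).
  (* The series satisfies (1 - v) f' = s f, which is the recursion (r + 1) b_(r+1) = (s + r) b_r
     summed against v^r. *)
  assert (Hf : forall v, Cmod v < 1 ->
    exists d, Cderiv f v d /\ ((1 - v) * d)%C = (s * f v)%C).
  { intros v Hv. pose proof (Cmod_ge_0 v) as Hv0. pose proof (Cmod_ge_0 s) as Hs0.
    set (eta := (1 - Cmod v) / 4). set (rho := Cmod v + 2 * eta).
    assert (Heta : 0 < eta <= 1) by (unfold eta; lra).
    assert (Hrho : 0 <= rho < 1) by (unfold rho, eta; lra).
    assert (He2 : 0 < eta ^ 2) by (apply pow_lt; lra).
    set (M r := bmaj (Cmod s) r * (rho ^ r / eta ^ 2)).
    assert (HB := bmaj_summable (Cmod s) rho Hs0 Hrho).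
    assert (HM : summable M).
    { apply summable_le with (fun r => / eta ^ 2 * (bmaj (Cmod s) r * rho ^ r)).
      2:{ apply summable_scal. left; now apply Rinv_0_lt_compat. exact HB. }
      intros r. unfold M. split.
      apply Rmult_le_pos. now apply bmaj_pos. apply Rdiv_le_0_compat.
      apply pow_le; lra. assumption. right. field. lra. }
    assert (Hq : forall r, quad (fun v => bcoef s r * v ^ r)%C v (bcoef s r * dpow v r)%C eta (M r)).
    { intros r. apply quad_le with eta (Cmod (bcoef s r) * (rho ^ r / eta ^ 2)). lra.
      - apply Rmult_le_compat_r. apply Rdiv_le_0_compat. apply pow_le; lra. lra.
        apply bcoef_bound. lra.
      - apply quad_scal. apply pow_quad. exact Heta. unfold rho; lra. }
    exists (CS (fun r => bcoef s r * dpow v r)%C). split.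
    - apply (cderiv_CS (fun r v => bcoef s r * v ^ r)%C v _ eta M); trivial.
    - unfold f.
      assert (Hbd : forall r, Cmod (bcoef s r * dpow v r) <= M r) by (intros; apply (Hq r)).
      assert (Hbp : forall r, Cmod (bcoef s r * v ^ r) <= M r) by (intros; apply (Hq r)).
      assert (HMv : summable (fun r => Cmod v * M r)) by now apply summable_scal.
      assert (HMs : summable (fun r => Cmod s * M r)) by now apply summable_scal.
      assert (Hbvd : forall r, Cmod (v * (bcoef s r * dpow v r)) <= Cmod v * M r).
      { intros r. rewrite Cmod_mult. apply Rmult_le_compat_l; trivial. }
      assert (Hbsp : forall r, Cmod (s * (bcoef s r * v ^ r)) <= Cmod s * M r).
      { intros r. rewrite Cmod_mult. apply Rmult_le_compat_l; trivial. }
      rewrite <- (CS_scal s _ M HM Hbp).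
      assert (E : CS (fun r => bcoef s r * dpow v r)%C =
        (CS (fun r => s * (bcoef s r * v ^ r)) + CS (fun r => v * (bcoef s r * dpow v r)))%C).
      { rewrite (CS_head _ M HM Hbd). simpl bcoef at 1. simpl dpow at 1.
        replace (1 * 0)%C with (RtoC 0) by ring. rewrite Cplus_0_l.
        rewrite <- (CS_plus _ _ _ _ HMs HMv Hbsp Hbvd).
        apply CS_ext. intros r. rewrite dpow_S, bcoef_S.
        assert (Er : (v * dpow v r)%C = (RtoC (INR r) * v ^ r)%C).
        { destruct r as [|r]. simpl. ring. rewrite dpow_S, Cpow_S. ring. }
        replace (v * (bcoef s r * dpow v r))%C with (bcoef s r * (v * dpow v r))%C by ring.
        rewrite Er. field. apply RtoC_INR_S. }
      rewrite (CS_scal v _ M HM Hbd) in E.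
      replace ((1 - v) * CS (fun r => bcoef s r * dpow v r))%C with
        (CS (fun r => bcoef s r * dpow v r) - v * CS (fun r => bcoef s r * dpow v r))%C by ring.
      rewrite E at 1. ring. }
  set (T := - ln (1 - x)).
  assert (HT : 0 <= T).
  { unfold T. assert (ln (1 - x) <= 0); [|lra]. rewrite <- ln_1.
    destruct (Req_dec x 0) as [->|]. rewrite Rminus_0_r; lra.
    left. apply ln_increasing; lra. }
  set (phi t := (f (1 - cexp (- t)) * cexp (- s * t))%C).
  assert (Hphi : forall t, 0 <= t <= T -> Cderiv phi (RtoC t) 0).
  { intros t Ht.
    assert (Hlt : Cmod (1 - cexp (- RtoC t)) < 1).
    { rewrite <- RtoC_opp, cexp_RtoC, <- RtoC_minus, Cmod_R.
      assert (0 < exp (- t) <= 1).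
      { split. apply exp_pos. rewrite <- exp_0.
        destruct (Req_dec t 0) as [->|]. rewrite Ropp_0. lra.
        left. apply exp_increasing. lra. }
      rewrite Rabs_pos_eq; lra. }
    destruct (Hf _ Hlt) as [d [Hd1 Hd2]].
    eapply cderiv_eq.
    - apply (cderiv_mult (fun v => f (1 - cexp (- v))%C) (fun v => cexp (- s * v))%C).
      + apply (cderiv_comp f (fun v => 1 - cexp (- v))%C). exact Hd1.
        apply cderiv_minus. apply cderiv_const.
        apply (cderiv_cexp_comp (fun v => - v)%C). apply cderiv_opp, cderiv_id.
      + apply (cderiv_cexp_comp (fun v => - s * v)%C). apply cderiv_scal, cderiv_id.
    - cbv beta.
      set (e := cexp (- RtoC t)) in *. set (g := cexp (- s * RtoC t)).
      replace ((0 - - (1) * e) * d * g + f (1 - e) * (- s * 1 * g))%C with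
        (g * ((1 - (1 - e)) * d - s * f (1 - e)))%C by ring.
      rewrite Hd2. ring. }
  assert (Hmv := mean_value_inequality phi (fun _ => RtoC 0) 0 T 0 HT Hphi).
  assert (H0 : Cmod (phi T - phi 0) <= 0).
  { apply Rle_trans with (2 * 0 * (T - 0)). apply Hmv. intros. rewrite Cmod_0; lra. lra. }
  assert (E : phi T = phi 0).
  { apply Ceq_minus. apply Cmod_eq_0. apply Rle_antisym. exact H0. apply Cmod_ge_0. }
  unfold phi in E.
  replace (1 - cexp (- RtoC 0))%C with (RtoC 0) in E.
  2:{ replace (- RtoC 0)%C with (RtoC 0) by ring. rewrite cexp_0. ring. }
  replace (1 - cexp (- RtoC T))%C with (RtoC x) in E.
  2:{ rewrite <- RtoC_opp, cexp_RtoC. unfold T. rewrite Ropp_involutive, exp_ln by lra.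
      rewrite RtoC_minus. ring. }
  rewrite Cmult_0_r, cexp_0 in E.
  assert (Ef0 : f 0 = 1).
  { apply CS_unique. apply clim_incr_1. apply clim_ext with (fun _ => RtoC 1).
    2: apply clim_const.
    intros n. rewrite csum_head. simpl.
    assert (Z : csum (fun k => bcoef s (S k) * 0 ^ S k)%C n = 0).
    { induction n as [|n IH]. reflexivity. simpl csum. simpl in IH. rewrite IH.
      simpl. ring. }
    simpl in Z. rewrite Z. ring. }
  rewrite Ef0 in E.
  assert (Ex : f x = cexp (s * T)).
  { replace (s * RtoC T)%C with (- (- s * RtoC T))%C by ring. rewrite cexp_opp.
    pose proof (cexp_neq_0 (- s * RtoC T)).
    replace (f x) with ((f x * cexp (- s * T)) / cexp (- s * T))%C by (field; trivial).
    rewrite E. field. trivial. }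
  unfold cpowR. replace (- s * RtoC (ln (1 - x)))%C with (s * T)%C
    by (unfold T; rewrite RtoC_opp; ring).
  rewrite <- Ex. unfold f. apply CS_ext. intros r. now rewrite RtoC_pow.
Qed.

(** * The continuation of the q-zeta series *)

(** This is 1 - q^(v + r), with zeros at v = -r + delta l. *)
Definition pden (q : R) (r : nat) (v : C) : C :=
  (1 - cexp ((v + RtoC (INR r)) * RtoC (ln q)))%C.

Definition qzG (q z : R) (w : C) : C :=
  (cpowR (q - q ^ 2) w *
   CS (fun r => bcoef w r * RtoC (exp (z * ln q) ^ r) * / pden q r w))%C.

Section Continuation.
Variables q z : R.
Hypotheses (hq0 : 0 < q) (hq1 : q < 1) (hz0 : 0 < z).

Lemma ln_q_neg : ln q < 0.
Proof. rewrite <- ln_1. now apply ln_increasing. Qed.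

Lemma pden_derive (r : nat) (w : C) :
  Cderiv (pden q r) w (- RtoC (ln q) * cexp ((w + RtoC (INR r)) * RtoC (ln q)))%C.
Proof.
  eapply cderiv_eq.
  - apply cderiv_minus. apply cderiv_const.
    apply (cderiv_cexp_comp (fun v => (v + RtoC (INR r)) * RtoC (ln q))%C).
    apply (cderiv_mult (fun v => v + RtoC (INR r))%C (fun _ => RtoC (ln q))).
    apply cderiv_plus. apply cderiv_id. apply cderiv_const. apply cderiv_const.
  - cbv beta. ring.
Qed.

Lemma Cmod_pow_q (r : nat) (v : C) :
  Cmod (cexp ((v + RtoC (INR r)) * RtoC (ln q))) = exp ((Re v + INR r) * ln q).
Proof.
  rewrite Cmod_cexp. f_equal. rewrite re_scal_r, Re_plus, re_RtoC. reflexivity.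
Qed.

(** For large r, Re (v + r) >= 1 / |ln q| and hence |q^(v+r)| <= 1 / e. Near w only finitely many
    denominators can be small, which reduces the next lemmas to inductions over r < J. *)
Lemma pden_large (w : C) : exists J, forall r v, (J <= r)%nat -> Cmod (v - w) < 1 ->
  1 / 2 <= Cmod (pden q r v).
Proof.
  pose proof ln_q_neg as Hl.
  destruct (nfloor_ex (Rmax 0 (1 - Re w + / - ln q))) as [J [_ HJ]]. apply Rmax_l.
  exists (S J). intros r v Hr Hv.
  unfold pden. 
  pose proof (Cmod_triangle_rev 1 (cexp ((v + RtoC (INR r)) * RtoC (ln q)))) as H.
  rewrite Cmod_1, Cmod_pow_q in H.
  assert (HrJ : INR J + 1 <= INR r) by (rewrite <- S_INR; now apply le_INR).
  pose proof (re_le_Cmod (v - w)) as H1. rewrite Re_minus in H1.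
  assert (H2 : - 1 < Re v - Re w < 1) by (apply Rabs_lt_between; lra).
  pose proof (Rmax_r 0 (1 - Re w + / - ln q)) as H3.
  assert (H4 : / - ln q <= Re v + INR r) by lra.
  assert (H5 : (Re v + INR r) * ln q <= - 1).
  { apply Rmult_le_compat_r with (r := - ln q) in H4. 2: lra.
    rewrite Rinv_l in H4 by lra. lra. }
  assert (H6 : exp ((Re v + INR r) * ln q) <= exp (- 1)).
  { destruct (Rle_lt_or_eq_dec _ _ H5) as [H6| ->]; [|lra]. left. now apply exp_increasing. }
  assert (H7 : exp (- 1) <= 1 / 2).
  { replace (- 1) with (- (1)) by ring. rewrite exp_Ropp. pose proof (exp_ineq1_le 1).
    apply Rle_trans with (/ 2). apply Rinv_le_contravar; lra. lra. }
  lra.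
Qed.

Lemma pden_isolated (w : C) : exists eps, 0 < eps /\
  forall r v, 0 < Cmod (v - w) < eps -> pden q r v <> 0.
Proof.
  destruct (pden_large w) as [J HJ].
  assert (Hfin : forall n, exists eps, 0 < eps /\
    forall r v, (r < n)%nat -> 0 < Cmod (v - w) < eps -> pden q r v <> 0).
  { induction n as [|n [e [He IH]]].
    - exists 1. split. lra. intros; lia.
    - assert (Hn : exists e', 0 < e' /\
        forall v, 0 < Cmod (v - w) < e' -> pden q n v <> 0).
      { destruct (classic (pden q n w = 0)) as [E|E].
        (* If w and v were both zeros, y = (v - w) ln q would satisfy e^y = 1, so |y| <= 8 |y|^2 by
           [cexp_second_order]; this radius keeps 0 < |y| < 1/16, where that is impossible. *)
        - pose proof ln_q_neg as Hl. exists (/ (16 * - ln q)).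
          assert (0 < 16 * - ln q) by lra. split. now apply Rinv_0_lt_compat.
          intros v Hv HE. unfold pden in E, HE.
          set (y := ((v - w) * RtoC (ln q))%C).
          assert (Ey : cexp y = 1).
          { replace y with ((v + INR n) * ln q - (w + INR n) * ln q)%C by (unfold y; ring).
            rewrite cexp_minus.
            apply Ceq_minus in E. rewrite <- E.
            apply Ceq_minus in HE. rewrite <- HE. field. }
          assert (Hy : Cmod y = Cmod (v - w) * - ln q).
          { unfold y. rewrite Cmod_mult, Cmod_R, Rabs_left; lra. }
          assert (Hy2 : 0 < Cmod y < / 16).
          { rewrite Hy. split. nra.
            apply Rlt_le_trans with (/ (16 * - ln q) * - ln q).
            apply Rmult_lt_compat_r; lra. right; field; lra. }
          pose proof (cexp_second_order y ltac:(lra)) as H2.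
          rewrite Ey in H2. replace (1 - 1 - y)%C with (- y)%C in H2 by ring.
          rewrite Cmod_opp in H2. simpl in H2. nra.
        - apply Cmod_gt_0 in E.
          assert (H := proj1 (clim_spec _ _)
            (cderiv_continuous _ _ _ (pden_derive n w)) _ E).
          apply locally_C_spec in H. destruct H as [e' [He' H]].
          exists e'. split. exact He'. intros v Hv HE. specialize (H v (proj2 Hv)).
          rewrite HE in H. replace (0 - pden q n w)%C with (- pden q n w)%C in H by ring.
          rewrite Cmod_opp in H. lra. }
      destruct Hn as [e' [He' Hn]].
      exists (Rmin e e'). split. now apply Rmin_glb_lt.
      intros r v Hr Hv.
      destruct (Nat.eq_dec r n) as [->|Hrn].
      + apply Hn. split. apply Hv. apply Rlt_le_trans with (1 := proj2 Hv). apply Rmin_r.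
      + apply IH. lia. split. apply Hv. apply Rlt_le_trans with (1 := proj2 Hv). apply Rmin_l. }
  destruct (Hfin J) as [e [He H]].
  exists (Rmin e 1). split. apply Rmin_glb_lt; lra.
  intros r v Hv. destruct (Nat.lt_ge_cases r J) as [Hr|Hr].
  - apply H. exact Hr. split. apply Hv. apply Rlt_le_trans with (1 := proj2 Hv). apply Rmin_l.
  - apply Cmod_gt_0. apply Rlt_le_trans with (1 / 2). lra. apply HJ. exact Hr.
    apply Rlt_le_trans with (1 := proj2 Hv). apply Rmin_r.
Qed.

Lemma pden_lower_bound (w : C) : (forall r, pden q r w <> 0) ->
  exists eps del, 0 < eps <= 1 /\ 0 < del /\
  forall r v, Cmod (v - w) < eps -> del <= Cmod (pden q r v).
Proof.
  intros Hw. destruct (pden_large w) as [J HJ].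
  assert (Hfin : forall n, exists eps del, 0 < eps /\ 0 < del /\
    forall r v, (r < n)%nat -> Cmod (v - w) < eps -> del <= Cmod (pden q r v)).
  { induction n as [|n [e [d [He [Hd IH]]]]].
    - exists 1, 1. repeat split; try lra. intros; lia.
    - assert (E := proj1 (Cmod_gt_0 _) (Hw n)).
      assert (H := proj1 (clim_spec _ _)
        (cderiv_continuous _ _ _ (pden_derive n w)) (Cmod (pden q n w) / 2) ltac:(lra)).
      apply locally_C_spec in H. destruct H as [e' [He' H]].
      exists (Rmin e e'), (Rmin d (Cmod (pden q n w) / 2)).
      split. now apply Rmin_glb_lt. split. apply Rmin_glb_lt; lra.
      intros r v Hr Hv.
      destruct (Nat.eq_dec r n) as [->|Hrn].
      + apply Rle_trans with (1 := Rmin_r _ _).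
        specialize (H v (Rlt_le_trans _ _ _ Hv (Rmin_r _ _))).
        rewrite Cmod_minus_sym in H.
        pose proof (Cmod_triangle_rev (pden q n w) (pden q n v)). lra.
      + apply Rle_trans with (1 := Rmin_l _ _). apply IH. lia.
        exact (Rlt_le_trans _ _ _ Hv (Rmin_l _ _)). }
  destruct (Hfin J) as [e [d [He [Hd H]]]].
  exists (Rmin e 1), (Rmin d (1 / 2)).
  split. split. apply Rmin_glb_lt; lra. apply Rmin_r.
  split. apply Rmin_glb_lt; lra.
  intros r v Hv. destruct (Nat.lt_ge_cases r J) as [Hr|Hr].
  - apply Rle_trans with (1 := Rmin_l _ _). apply H. exact Hr.
    exact (Rlt_le_trans _ _ _ Hv (Rmin_l _ _)).
  - apply Rle_trans with (1 := Rmin_r _ _). apply HJ. exact Hr.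
    exact (Rlt_le_trans _ _ _ Hv (Rmin_r _ _)).
Qed.

(** The constants do not depend on r because |q^(w+r)| <= |q^w| for r >= 0. *)
Lemma pden_quad (w : C) : exists eps M, 0 < eps <= 1 /\ forall r,
  quad (pden q r) w (- RtoC (ln q) * cexp ((w + RtoC (INR r)) * RtoC (ln q)))%C eps M.
Proof.
  pose proof ln_q_neg as Hl.
  set (A := exp (Re w * ln q)). set (l := - ln q).
  assert (HA : 0 < A) by apply exp_pos.
  exists (Rmin 1 (/ (2 * l))), (1 + A + l * A + 8 * l ^ 2 * A).
  assert (Hl2 : 0 < 2 * l) by (unfold l; lra).
  split. split. apply Rmin_glb_lt. lra. now apply Rinv_0_lt_compat. apply Rmin_l.
  intros r.
  assert (Hc : Cmod (cexp ((w + INR r) * ln q)) <= A).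
  { rewrite Cmod_pow_q. unfold A. rewrite Rmult_plus_distr_r.
    assert (INR r * ln q <= 0) by (pose proof (pos_INR r); nra).
    destruct (Rle_lt_or_eq_dec (Re w * ln q + INR r * ln q) (Re w * ln q)) as [H1| ->]; try lra.
    left. now apply exp_increasing. }
  pose proof (Cmod_ge_0 (cexp ((w + INR r) * ln q))) as Hc0.
  assert (0 <= l * A) by nra. assert (0 <= l ^ 2 * A) by (apply Rmult_le_pos; [apply pow2_ge_0|lra]).
  split; [|split].
  - unfold pden. pose proof (Cmod_minus_triangle 1 (cexp ((w + INR r) * ln q))) as H1.
    rewrite Cmod_1 in H1. lra.
  - rewrite Cmod_mult, Cmod_opp, Cmod_R, Rabs_left by lra. fold l.
    assert (l * Cmod (cexp ((w + INR r) * ln q)) <= l * A).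
    { apply Rmult_le_compat_l. lra. exact Hc. }
    lra.
  - intros v Hv. unfold pden.
    replace ((v + INR r) * ln q)%C with ((w + INR r) * ln q + (v - w) * ln q)%C by ring.
    rewrite cexp_plus. set (e := cexp ((w + INR r) * ln q)) in *.
    replace (1 - e * cexp ((v - w) * ln q) - (1 - e) - - ln q * e * (v - w))%C with
      (- (e * (cexp ((v - w) * ln q) - 1 - (v - w) * ln q)))%C by ring.
    rewrite Cmod_opp, Cmod_mult.
    assert (Hy : Cmod ((v - w) * ln q) = l * Cmod (v - w)).
    { rewrite Cmod_mult, Cmod_R, Rabs_left by lra. unfold l; ring. }
    assert (Hv2 : l * Cmod (v - w) <= 1 / 2).
    { apply Rle_trans with (l * / (2 * l)).
      apply Rmult_le_compat_l. lra. left. apply Rlt_le_trans with (1 := Hv). apply Rmin_r.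
      right. field. lra. }
    pose proof (cexp_second_order ((v - w) * ln q) ltac:(lra)) as H2.
    rewrite Hy in H2.
    apply Rle_trans with (A * (8 * (l * Cmod (v - w)) ^ 2)).
    apply Rmult_le_compat; trivial. apply Cmod_ge_0.
    replace (A * (8 * (l * Cmod (v - w)) ^ 2)) with (8 * l ^ 2 * A * Cmod (v - w) ^ 2) by ring.
    apply Rmult_le_compat_r. apply pow2_ge_0. lra.
Qed.

Lemma qz_ratio : 0 < exp (z * ln q) < 1.
Proof.
  split. apply exp_pos. rewrite <- exp_0. apply exp_increasing.
  pose proof ln_q_neg. nra.
Qed.

(** Away from the zeros of the denominators their inverses have [quad] constants independent of r,
    so the terms are dominated by [bmaj (Cmod w + 3) r] times X^r, summable because X = q^z < 1. *)
Lemma ex_cderiv_qzG (w : C) : (forall r, pden q r w <> 0) ->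
  exists d, Cderiv (qzG q z) w d.
Proof.
  intros Hw. pose proof qz_ratio as HX. set (X := exp (z * ln q)) in *.
  destruct (pden_lower_bound w Hw) as [e1 [del [He1 [Hdel Hlow]]]].
  destruct (pden_quad w) as [e2 [N [He2 HN]]].
  set (eps := Rmin e1 e2).
  assert (Heps : 0 < eps <= 1).
  { split. now apply Rmin_glb_lt. apply Rle_trans with (1 := Rmin_l _ _). lra. }
  set (N' := / del + N / del ^ 2 + 3 * N ^ 2 / del ^ 3).
  set (pd r := (- RtoC (ln q) * cexp ((w + RtoC (INR r)) * RtoC (ln q)))%C).
  set (id r := (- pd r / (pden q r w * pden q r w))%C).
  assert (Hinv : forall r, quad (fun v => / pden q r v)%C w (id r) eps N').
  { intros r. apply quad_inv. exact Heps. exact Hdel.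
    - intros v Hv. apply Hlow. apply Rlt_le_trans with (1 := Hv). apply Rmin_l.
    - apply quad_le with (3 := HN r). apply Rmin_r. lra. }
  assert (HN' : 0 <= N') by exact (quad_ge0 _ _ _ _ _ (Hinv O)).
  set (M r := 7 * (X ^ r * bmaj (Cmod w + 3) r) * N').
  assert (HM : summable M).
  { apply summable_le with (fun r => (7 * N') * (bmaj (Cmod w + 3) r * X ^ r)).
    - intros r. unfold M. pose proof (Cmod_ge_0 w).
      assert (0 <= X ^ r * bmaj (Cmod w + 3) r).
      { apply Rmult_le_pos. apply pow_le; lra. apply bmaj_pos; lra. }
      split. apply Rmult_le_pos; lra. right; ring.
    - apply summable_scal. lra. apply bmaj_summable. pose proof (Cmod_ge_0 w); lra. lra. }
  set (dd r := (RtoC (X ^ r) * dbcoef w r)%C).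
  assert (Hterm : forall r, quad (fun v => bcoef v r * RtoC (X ^ r) * / pden q r v)%C w
    (dd r * / pden q r w + bcoef w r * RtoC (X ^ r) * id r)%C eps (M r)).
  { intros r. assert (H1 : quad (fun v => bcoef v r * RtoC (X ^ r))%C w (dd r) eps
      (X ^ r * bmaj (Cmod w + 3) r)).
    { assert (H := quad_scal (RtoC (X ^ r)) _ _ _ _ _ (bcoef_quad w r)).
      rewrite Cmod_R, Rabs_pos_eq in H by (apply pow_le; lra).
      apply (quad_le _ _ _ 1 _ eps (X ^ r * bmaj (Cmod w + 3) r)) in H; [|apply Heps|lra].
      destruct H as [A1 [A2 A3]]. split; [|split].
      - rewrite Cmult_comm. exact A1.
      - exact A2.
      - intros v Hv. specialize (A3 v Hv). rewrite !(Cmult_comm (bcoef _ _)). exact A3. }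
    exact (quad_mult _ _ _ _ _ _ _ _ (proj2 Heps) H1 (Hinv r)). }
  eexists. unfold qzG.
  apply (cderiv_mult (fun w => cpowR (q - q ^ 2) w)).
  - unfold cpowR. apply (cderiv_cexp_comp (fun v => v * RtoC (ln (q - q ^ 2)))%C).
    apply cderiv_mult. apply cderiv_id. apply cderiv_const.
  - fold X. apply (cderiv_CS (fun r v => bcoef v r * RtoC (X ^ r) * / pden q r v)%C
      w _ eps M Heps HM Hterm).
Qed.

(** * Agreement with the q-zeta series on the right half-plane *)

Lemma CS_csum (a : nat -> nat -> C) (M : nat -> R) (n : nat) : summable M ->
  (forall k r, Cmod (a k r) <= M r) ->
  csum (fun k => CS (a k)) n = CS (fun r => csum (fun k => a k r) n).
Proof.
  intros HM Ha. induction n as [|n IH]; simpl.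
  - symmetry. apply CS_unique. apply clim_ext with (fun _ => RtoC 0).
    2: apply clim_const.
    induction t as [|t IHt]; simpl. reflexivity. rewrite <- IHt. ring.
  - rewrite IH. symmetry.
    apply CS_plus with (fun r => INR n * M r) M; trivial.
    + apply summable_scal; trivial. apply pos_INR.
    + intros r. clear IH. induction n as [|n IHn].
      * simpl. rewrite Cmod_0. lra.
      * rewrite S_INR. simpl csum. apply Rle_trans with (1 := Cmod_triangle _ _).
        specialize (Ha n r). lra.
Qed.

Lemma csum_geom (y : C) (n : nat) : ((1 - y) * csum (fun k => y ^ k) n)%C = (1 - y ^ n)%C.
Proof.
  induction n as [|n IH]; simpl. ring.
  rewrite Cmult_plus_distr_l, IH. ring.
Qed.

Lemma clim_pow_0 (y : C) : Cmod y < 1 ->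
  filterlim (fun n => y ^ n)%C eventually (locally (RtoC 0)).
Proof.
  intros Hy. apply clim_seq_spec. intros eps He.
  destruct (pow_lt_1_zero (Cmod y)
    ltac:(rewrite Rabs_pos_eq; [exact Hy|apply Cmod_ge_0]) eps He) as [N HN].
  exists N. intros n Hn. specialize (HN n Hn).
  replace (y ^ n - 0)%C with (y ^ n)%C by ring. rewrite Cmod_pow.
  rewrite Rabs_pos_eq in HN. exact HN. apply pow_le, Cmod_ge_0.
Qed.

Lemma pow_q_lt_1 (s : C) (r : nat) : 0 < Re s ->
  Cmod (cexp ((s + RtoC (INR r)) * RtoC (ln q))) <= exp (Re s * ln q) < 1.
Proof.
  intros Hs. pose proof ln_q_neg as Hl. rewrite Cmod_pow_q, Rmult_plus_distr_r. split.
  - assert (INR r * ln q <= 0) by (pose proof (pos_INR r); nra).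
    destruct (Rle_lt_or_eq_dec (Re s * ln q + INR r * ln q) (Re s * ln q)) as [H1| ->]; try lra.
    left. now apply exp_increasing.
  - rewrite <- exp_0. apply exp_increasing. nra.
Qed.

Lemma pden_neq_0_right (s : C) (r : nat) : 0 < Re s -> pden q r s <> 0.
Proof.
  intros Hs E. unfold pden in E. apply Ceq_minus in E.
  pose proof (pow_q_lt_1 s r Hs) as H. rewrite <- E, Cmod_1 in H. lra.
Qed.

Lemma exp_pow_INR (x : R) (n : nat) : exp x ^ n = exp (INR n * x).
Proof.
  induction n as [|n IH].
  - simpl. now rewrite Rmult_0_l, exp_0.
  - rewrite S_INR, Rmult_plus_distr_r, exp_plus, Rmult_1_l, <- IH. simpl. ring.
Qed.

(** The binomial series is taken at x = q^(k+z). Then x^r q^(sk) = X^r (q^(s+r))^k with X = q^z is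
    geometric in k, and q^s (1 - q)^s = (q - q^2)^s goes to the front. *)
Lemma qzeta_term_binomial (s : C) (k : nat) :
  qzeta_term q z s k = (cpowR (q - q ^ 2) s *
    CS (fun r => bcoef s r * RtoC (exp (z * ln q) ^ r) *
      cexp ((s + RtoC (INR r)) * RtoC (ln q)) ^ k))%C.
Proof.
  pose proof ln_q_neg as Hl. pose proof qz_ratio as HX.
  set (X := exp (z * ln q)) in *.
  set (x := exp ((INR k + z) * ln q)).
  assert (Hx : 0 <= x < 1).
  { split. left; apply exp_pos. unfold x. rewrite <- exp_0. apply exp_increasing.
    pose proof (pos_INR k). nra. }
  assert (Ex : forall r, (cexp (s * RtoC (ln q)) ^ k * (bcoef s r * RtoC (x ^ r)))%C =
    (bcoef s r * RtoC (X ^ r) * cexp ((s + RtoC (INR r)) * RtoC (ln q)) ^ k)%C).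
  { intros r. rewrite !cexp_pow.
    replace (RtoC (INR k) * ((s + INR r) * ln q))%C with
      (RtoC (INR k) * (s * ln q) + RtoC (INR k * INR r * ln q))%C
      by (rewrite !RtoC_mult; ring).
    rewrite cexp_plus, cexp_RtoC.
    replace (x ^ r) with (X ^ r * exp (INR k * INR r * ln q)).
    - rewrite RtoC_mult. ring.
    - unfold x, X. rewrite !exp_pow_INR, <- exp_plus. f_equal. ring. }
  rewrite <- (CS_ext _ _ Ex).
  rewrite (CS_scal _ _ (fun r => bmaj (Cmod s) r * x ^ r)).
  2:{ apply bmaj_summable. apply Cmod_ge_0. exact Hx. }
  2:{ intros r. rewrite Cmod_mult, Cmod_R, Rabs_pos_eq by (apply pow_le; lra).
      apply Rmult_le_compat_r. apply pow_le; lra. apply bcoef_bound; lra. }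
  rewrite binomial_series by exact Hx.
  unfold qzeta_term, cpowR, qnum, Rpower. fold x.
  rewrite cexp_pow.
  assert (E1 : ln ((1 - x) / (1 - q)) = ln (1 - x) - ln (1 - q)).
  { unfold Rdiv. rewrite ln_mult, ln_Rinv; try lra. apply Rinv_0_lt_compat; lra. }
  assert (E2 : ln (q - q ^ 2) = ln q + ln (1 - q)).
  { rewrite <- ln_mult by lra. f_equal. ring. }
  rewrite E1, E2. unfold Cdiv. rewrite <- cexp_opp, <- !cexp_plus. f_equal.
  rewrite (RtoC_minus (ln (1 - x))), (RtoC_plus (ln q)). rewrite (RtoC_plus (INR k)). ring.
Qed.

(** A finite sum over k passes inside the sum over r exactly and becomes (1 - y^n) / (1 - y) with y
    = q^(s+r). As |y| <= t < 1 for all r, this is at most 2 / (1 - t), and y^n -> 0 is taken under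
    the sum. *)
Lemma qzeta_series_eq (s : C) : 0 < Re s ->
  filterlim (csum (qzeta_term q z s)) eventually (locally (qzG q z s)).
Proof.
  intros Hs. pose proof ln_q_neg as Hl. pose proof qz_ratio as HX.
  set (X := exp (z * ln q)) in *.
  set (y r := cexp ((s + RtoC (INR r)) * RtoC (ln q))).
  set (t := exp (Re s * ln q)).
  assert (Hy : forall r, Cmod (y r) <= t < 1) by (intros; now apply pow_q_lt_1).
  assert (Ht : t < 1) by apply (Hy O).
  set (B r := bmaj (Cmod s) r * X ^ r).
  assert (HB : summable B) by (apply bmaj_summable; [apply Cmod_ge_0|lra]).
  assert (Hb : forall r, Cmod (bcoef s r * RtoC (X ^ r)) <= B r).
  { intros r. rewrite Cmod_mult, Cmod_R, Rabs_pos_eq by (apply pow_le; lra).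
    apply Rmult_le_compat_r. apply pow_le; lra. apply bcoef_bound; lra. }
  assert (Hsum : forall n r, csum (fun k => y r ^ k)%C n = ((1 - y r ^ n) * / pden q r s)%C).
  { intros n r. rewrite <- csum_geom. unfold pden. fold (y r).
    field. apply (pden_neq_0_right s r Hs). }
  apply clim_ext with (fun n => cpowR (q - q ^ 2) s *
    CS (fun r => bcoef s r * RtoC (X ^ r) * ((1 - y r ^ n) * / pden q r s)))%C.
  - intros n.
    rewrite (csum_ext (qzeta_term q z s) (fun k => cpowR (q - q ^ 2) s *
      CS (fun r => bcoef s r * RtoC (X ^ r) * y r ^ k))%C)
      by (intros; apply qzeta_term_binomial).
    rewrite csum_scal. f_equal.
    rewrite (CS_csum (fun k r => bcoef s r * RtoC (X ^ r) * y r ^ k)%C B n HB).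
    + apply CS_ext. intros r. rewrite csum_scal, Hsum. reflexivity.
    + intros k r. rewrite Cmod_mult, Cmod_pow. rewrite <- (Rmult_1_r (B r)).
      apply Rmult_le_compat; trivial. apply Cmod_ge_0. apply pow_le, Cmod_ge_0.
      rewrite <- (pow1 k). apply pow_incr. specialize (Hy r).
      pose proof (Cmod_ge_0 (y r)). lra.
  - unfold qzG. fold X. apply clim_mult. apply clim_const.
    apply (CS_dominated _ _ (fun r => 2 / (1 - t) * B r)).
    + apply summable_scal. apply Rdiv_le_0_compat; lra. exact HB.
    + exists O. intros n _ r. rewrite Cmod_mult, Rmult_comm.
      apply Rmult_le_compat; trivial; try apply Cmod_ge_0.
      rewrite Cmod_mult. unfold Rdiv. 
      pose proof (Cmod_triangle_rev 1 (y r)) as H1. rewrite Cmod_1 in H1.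
      apply Rmult_le_compat; try apply Cmod_ge_0.
      * apply Rle_trans with (1 := Cmod_minus_triangle _ _). rewrite Cmod_1, Cmod_pow.
        assert (Cmod (y r) ^ n <= 1); [|lra]. rewrite <- (pow1 n). apply pow_incr.
        specialize (Hy r). pose proof (Cmod_ge_0 (y r)). lra.
      * rewrite Cmod_inv by now apply pden_neq_0_right.
        apply Rinv_le_contravar. lra. unfold pden. fold (y r). specialize (Hy r). lra.
    + intros r. eapply clim_eq.
      * apply clim_mult. apply clim_const. apply clim_mult. 2: apply clim_const.
        apply clim_minus. apply clim_const. apply clim_pow_0. specialize (Hy r). lra.
      * ring.
Qed.

Lemma near_point (w : C) (eps : R) : 0 < eps ->
  exists v, v <> w /\ 0 < Cmod (v - w) < eps.
Proof.
  intros He. exists (w + RtoC (eps / 2))%C.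
  assert (E : Cmod (w + RtoC (eps / 2) - w) = eps / 2).
  { replace (w + RtoC (eps / 2) - w)%C with (RtoC (eps / 2)) by ring.
    rewrite Cmod_R, Rabs_pos_eq; lra. }
  split. 2: lra. intros H. rewrite H in E.
  replace (w - w)%C with (RtoC 0) in E by ring. rewrite Cmod_0 in E. lra.
Qed.

(** The difference vanishes near 1, inside the region of convergence, hence on a punctured disc
    about w. The value at w itself follows by continuity if w is in U. *)
Lemma continuation_eq (F : C -> C) : is_qzeta_continuation q z F ->
  forall w, (forall r, pden q r w <> 0) -> F w = qzG q z w.
Proof.
  intros [U [Uo [Ui [Ud [Up Us]]]]] w Hw.
  set (D v := (F v - qzG q z v)%C).
  assert (HD : forall v, U v -> (forall r, pden q r v <> 0) -> exists d, Cderiv D v d).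
  { intros v Hv Hp. destruct (Ud v Hv) as [d1 H1].
    destruct (ex_cderiv_qzG v Hp) as [d2 H2]. eexists. apply cderiv_minus.
    exact H1. exact H2. }
  assert (Hzero : zero_near D w).
  { apply identity_theorem with (RtoC 1).
    - intros p. destruct (pden_isolated p) as [e1 [He1 H1]].
      assert (H2 : exists e2, 0 < e2 /\ forall v, 0 < Cmod (v - p) < e2 -> U v).
      { destruct (classic (U p)) as [HU|HU].
        - destruct (Uo p HU) as [e2 H2]. exists e2. split. apply cond_pos.
          intros v Hv. apply H2. apply Hv.
        - destruct (Ui p HU) as [e2 H2]. exists e2. split. apply cond_pos. exact H2. }
      destruct H2 as [e2 [He2 H2]].
      exists (Rmin e1 e2). split. now apply Rmin_glb_lt.
      intros v [Hv0 Hv]. apply HD.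
      + apply H2. split. exact Hv0. apply Rlt_le_trans with (1 := Hv). apply Rmin_r.
      + intros r. apply H1. split. exact Hv0. apply Rlt_le_trans with (1 := Hv). apply Rmin_l.
    - exists 1. split. lra. intros v Hv.
      assert (Hre : 0 < Re v).
      { pose proof (re_le_Cmod (v - 1)) as H. rewrite Re_minus, re_RtoC in H.
        assert (-1 < Re v - 1 < 1); [|lra]. apply Rabs_lt_between. lra. }
      unfold D. apply (proj1 (Ceq_minus _ _)).
      apply (clim_unique (F := eventually) (csum (qzeta_term q z v))).
      + apply is_series_csum. now apply Us.
      + now apply qzeta_series_eq. }
  destruct Hzero as [e [He Hz]].
  destruct (ex_cderiv_qzG w Hw) as [d Hd].
  destruct (classic (U w)) as [HU|HU].
  - apply NNPP. intros Hne. apply Cminus_eq_contra in Hne. fold (D w) in Hne.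
    apply Cmod_gt_0 in Hne.
    destruct (HD w HU Hw) as [d' Hd'].
    assert (H := proj1 (clim_spec _ _) (cderiv_continuous _ _ _ Hd') _ Hne).
    apply locally_C_spec in H. destruct H as [e' [He' H]].
    destruct (near_point w (Rmin e e')) as [v [_ [Hv1 Hv2]]]. now apply Rmin_glb_lt.
    specialize (H v (Rlt_le_trans _ _ _ Hv2 (Rmin_r _ _))).
    rewrite Hz in H. 2: split; [exact Hv1|exact (Rlt_le_trans _ _ _ Hv2 (Rmin_l _ _))].
    replace (0 - D w)%C with (- D w)%C in H by ring. rewrite Cmod_opp in H. lra.
  (* Outside U the point w would be a pole, yet F agrees around it with [qzG], which is continuous
     at w and so bounded. *)
  - exfalso.
    assert (H := proj1 (clim_spec _ _) (cderiv_continuous _ _ _ Hd) 1 ltac:(lra)).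
    apply locally_C_spec in H. destruct H as [e1 [He1 H1]].
    assert (H2 := Up w HU (fun x => Cmod (qzG q z w) + 1 < x)).
    assert (H3 : filtermap (fun w0 => Cmod (F w0))
      (within (fun w0 => w0 <> w) (locally w)) (fun x => Cmod (qzG q z w) + 1 < x)).
    { apply H2. exists (Cmod (qzG q z w) + 1). intros x Hx. exact Hx. }
    unfold filtermap, within in H3. apply locally_C_spec in H3.
    destruct H3 as [e2 [He2 H3]].
    destruct (near_point w (Rmin e (Rmin e1 e2))) as [v [Hne [Hv1 Hv2]]].
    { repeat apply Rmin_glb_lt; trivial. }
    assert (Hm := Rlt_le_trans _ _ _ Hv2 (Rmin_r _ _)).
    specialize (H1 v (Rlt_le_trans _ _ _ Hm (Rmin_l _ _))).
    specialize (H3 v (Rlt_le_trans _ _ _ Hm (Rmin_r _ _)) Hne).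
    assert (E : F v = qzG q z v).
    { apply Ceq_minus. apply Hz. split. exact Hv1. exact (Rlt_le_trans _ _ _ Hv2 (Rmin_l _ _)). }
    rewrite E in H3.
    pose proof (Cmod_triangle_rev (qzG q z v) (qzG q z w)). lra.
Qed.

End Continuation.

(** * Fourier series of exponentials *)

(** This is e^(i pi a x): even integers a give the characters of period 1, odd ones the half
    frequencies in the closed form of the Dirichlet kernel. *)
Definition Hx (a : R) (x : C) : C := cexp (RtoC (a * PI) * Ci * x)%C.

(** The terms of index n+1 and -(n+1) of the series of e^(2 pi i m x) / (c - m) over m; convergence
    is meant for symmetric partial sums. *)
Definition fpair (x c : C) (n : nat) : C :=
  (Hx (2 * INR (S n)) x / (c - RtoC (INR (S n)))
   + Hx (- (2 * INR (S n))) x / (c + RtoC (INR (S n))))%C.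

Definition nonint (c : C) : Prop :=
  forall n : nat, (c - RtoC (INR n))%C <> 0 /\ (c + RtoC (INR n))%C <> 0.

Lemma Hx_plus (a b : R) (x : C) : (Hx a x * Hx b x)%C = Hx (a + b) x.
Proof.
  unfold Hx. rewrite <- cexp_plus. f_equal.
  rewrite Rmult_plus_distr_r, RtoC_plus. ring.
Qed.

Lemma Hx_0 (x : C) : Hx 0 x = 1.
Proof.
  unfold Hx. rewrite Rmult_0_l. replace (0 * Ci * x)%C with (RtoC 0) by ring.
  apply cexp_0.
Qed.

Lemma Hx_deriv (a : R) (x : C) : Cderiv (Hx a) x (RtoC (a * PI) * Ci * Hx a x)%C.
Proof.
  eapply cderiv_eq.
  - apply (cderiv_cexp_comp (fun v => RtoC (a * PI) * Ci * v)%C).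
    apply cderiv_scal. apply cderiv_id.
  - unfold Hx. ring.
Qed.

Lemma Hx_real (a t : R) : Hx a t = (cos (a * PI * t), sin (a * PI * t)).
Proof.
  unfold Hx. replace (RtoC (a * PI) * Ci * RtoC t)%C with ((0, a * PI * t) : C).
  - unfold cexp. simpl. now rewrite exp_0, !Rmult_1_l.
  - apply C_ext; unfold Re, Im; simpl; ring.
Qed.

Lemma Cmod_Hx (a t : R) : Cmod (Hx a t) = 1.
Proof.
  unfold Hx. rewrite Cmod_cexp.
  replace (Re (RtoC (a * PI) * Ci * RtoC t)) with 0 by (unfold Re; simpl; ring).
  apply exp_0.
Qed.

Lemma Hx_int (n : nat) : Hx (2 * INR n) 1 = 1 /\ Hx (- (2 * INR n)) 1 = 1.
Proof.
  rewrite !Hx_real. rewrite !Rmult_1_r.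
  assert (H : cos (2 * INR n * PI) = 1 /\ sin (2 * INR n * PI) = 0).
  { pose proof (cos_period 0 n) as H1. pose proof (sin_period 0 n) as H2.
    rewrite cos_0 in H1. rewrite sin_0 in H2. now rewrite !Rplus_0_l in H1, H2. }
  destruct H as [H1 H2].
  replace (- (2 * INR n) * PI) with (- (2 * INR n * PI)) by ring.
  rewrite cos_neg, sin_neg, H1, H2. split; apply C_ext; unfold Re, Im; simpl; ring.
Qed.

Definition dirichlet (N : nat) (x : C) : C :=
  (1 + csum (fun n => Hx (2 * INR (S n)) x + Hx (- (2 * INR (S n))) x) N)%C.

(** Multiplication by 2 i sin(pi x) makes the kernel telescope; the product form holds also where
    the sine vanishes. *)
Lemma dirichlet_closed (N : nat) (x : C) :
  (dirichlet N x * (Hx 1 x - Hx (-1) x))%C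
  = (Hx (2 * INR N + 1) x - Hx (- (2 * INR N + 1)) x)%C.
Proof.
  unfold dirichlet. induction N as [|N IH].
  - simpl csum. simpl INR. rewrite Rmult_0_r, Rplus_0_l.
    replace (- (1)) with (-1) by lra. ring.
  - rewrite csum_S, Cplus_assoc, Cmult_plus_distr_r, IH.
    replace ((Hx (2 * INR (S N)) x + Hx (- (2 * INR (S N))) x) * (Hx 1 x - Hx (-1) x))%C
      with (Hx (2 * INR (S N)) x * Hx 1 x - Hx (2 * INR (S N)) x * Hx (-1) x +
        (Hx (- (2 * INR (S N))) x * Hx 1 x - Hx (- (2 * INR (S N))) x * Hx (-1) x))%C by ring.
    rewrite !Hx_plus.
    replace (2 * INR (S N) + -1) with (2 * INR N + 1) by (rewrite S_INR; ring).
    replace (- (2 * INR (S N)) + 1) with (- (2 * INR N + 1)) by (rewrite S_INR; ring).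
    replace (- (2 * INR (S N)) + -1) with (- (2 * INR (S N) + 1)) by ring.
    ring.
Qed.

Lemma Hx_den_neq_0 (t : R) : 0 < t < 1 -> (Hx 1 t - Hx (-1) t)%C <> 0.
Proof.
  intros Ht E. rewrite !Hx_real in E. apply (f_equal Im) in E.
  rewrite Im_minus in E. simpl in E.
  replace (-1 * PI * t) with (- (1 * PI * t)) in E by ring. rewrite sin_neg in E.
  assert (0 < sin (1 * PI * t)); [|lra]. pose proof PI_RGT_0. apply sin_gt_0; nra.
Qed.

Lemma Rcont_RtoC (f : C -> C) (t : R) : Ccont f (RtoC t) -> Rcont (fun u => f (RtoC u)) t.
Proof. exact (Rcont_horizontal f t 0). Qed.

(* Integration by parts against W = (e^{i(2N+1)pi x} + e^{-i(2N+1)pi x})/(i(2N+1)pi),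
   which is O(1/N), in the form of a mean value inequality. *)
Lemma riemann_lebesgue (c : C) (p : nat -> C -> C) (z1 z2 : R) : 0 < z1 -> z1 <= z2 -> z2 < 1 ->
  (forall N t, z1 <= t <= z2 -> Cderiv (p N) (RtoC t)
    (- (RtoC (2 * PI) * Ci) * cexp (- (RtoC (2 * PI) * Ci * c) * RtoC t) * dirichlet N t)%C) ->
  filterlim (fun N => p N z2 - p N z1)%C eventually (locally (RtoC 0)).
Proof.
  intros H1 H12 H2 Hp. pose proof PI_RGT_0 as Hpi.
  set (k := (- (RtoC (2 * PI) * Ci * c))%C).
  set (den x := (Hx 1 x - Hx (-1) x)%C).
  set (h x := (cexp (k * x) / den x)%C).
  set (dden x := (RtoC (1 * PI) * Ci * Hx 1 x - RtoC (-1 * PI) * Ci * Hx (-1) x)%C).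
  set (dh x := ((k * cexp (k * x) * den x - cexp (k * x) * dden x) / (den x * den x))%C).
  assert (Hdden : forall x, Cderiv den x (dden x)).
  { intros x. apply cderiv_minus; apply Hx_deriv. }
  assert (Hek : forall x, Cderiv (fun x => cexp (k * x)) x (k * cexp (k * x))%C).
  { intros x. eapply cderiv_eq. apply (cderiv_cexp_comp (fun x => k * x)%C).
    apply cderiv_scal, cderiv_id. ring. }
  assert (Hden : forall t, z1 <= t <= z2 -> den (RtoC t) <> 0).
  { intros t Ht. apply Hx_den_neq_0. lra. }
  assert (Hh : forall t, z1 <= t <= z2 -> Cderiv h (RtoC t) (dh t)).
  { intros t Ht. apply (cderiv_div (fun x => cexp (k * x)) den); auto. }
  destruct (continuous_bounded (fun t => Cmod (h t)) z1 z2 H12) as [B HB].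
  { intros t Ht. apply (Rcont_Cmod (fun t => h (RtoC t))). apply Rcont_RtoC.
    eapply cderiv_continuous. now apply Hh. }
  destruct (continuous_bounded (fun t => Cmod (dh t)) z1 z2 H12) as [B' HB'].
  { intros t Ht. apply (Rcont_Cmod (fun t => dh (RtoC t))). apply Rcont_RtoC.
    assert (Cd : Ccont den t) by (eapply cderiv_continuous; apply Hdden).
    assert (Ce : Ccont (fun x => cexp (k * x)) t) by (eapply cderiv_continuous; apply Hek).
    apply clim_div.
    - apply Cmult_neq_0; auto.
    - apply clim_minus; apply clim_mult; trivial.
      apply clim_mult. apply clim_const. trivial.
      apply clim_minus; apply clim_mult; try apply clim_const;
        eapply cderiv_continuous; apply Hx_deriv.
    - now apply clim_mult. }
  set (m N := 2 * INR N + 1).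
  assert (Hm : forall N, 0 < m N) by (intros N; unfold m; pose proof (pos_INR N); lra).
  assert (HCi : forall N, (RtoC (m N * PI) * Ci)%C <> 0).
  { intros N. apply Cmult_neq_0. apply RtoC_neq. specialize (Hm N). nra. apply Ci_nz. }
  set (W N x := ((Hx (m N) x + Hx (- m N) x) / (RtoC (m N * PI) * Ci))%C).
  assert (HW : forall N x, Cderiv (W N) x (Hx (m N) x - Hx (- m N) x)%C).
  { intros N x. eapply cderiv_eq.
    - apply (cderiv_mult (fun x => Hx (m N) x + Hx (- m N) x)%C
        (fun _ => / (RtoC (m N * PI) * Ci))%C).
      apply cderiv_plus; apply Hx_deriv. apply cderiv_const.
    - cbv beta. replace (- m N * PI) with (- (m N * PI)) by ring. rewrite RtoC_opp.
      specialize (HCi N). field. split. apply Ci_nz.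
      intros E. apply HCi. rewrite E. ring. }
  assert (HWb : forall N t, Cmod (W N (RtoC t)) <= 2 / (m N * PI)).
  { intros N t. unfold W. rewrite Cmod_div by apply HCi.
    rewrite Cmod_mult, Cmod_Ci, Cmod_R, Rabs_pos_eq, Rmult_1_r
      by (specialize (Hm N); nra).
    apply Rmult_le_compat_r. left. apply Rinv_0_lt_compat. specialize (Hm N). nra.
    apply Rle_trans with (1 := Cmod_triangle _ _). rewrite !Cmod_Hx. lra. }
  (* The added boundary term cancels the oscillating derivative of p, since (Hx m - Hx (-m)) h is
     the exponential times the Dirichlet kernel; what is left is 2 pi i h' W, of size 1/N. *)
  set (RR N x := (p N x + RtoC (2 * PI) * Ci * (h x * W N x))%C).
  assert (HR : forall N t, z1 <= t <= z2 ->
    Cderiv (RR N) (RtoC t) (RtoC (2 * PI) * Ci * (dh t * W N t))%C).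
  { intros N t Ht. eapply cderiv_eq.
    - apply cderiv_plus. now apply Hp. apply cderiv_scal.
      apply cderiv_mult. now apply Hh. apply HW.
    - pose proof (dirichlet_closed N t) as HD. fold (m N) (den t) in HD.
      rewrite <- HD. fold k. unfold h. 
      field. now apply Hden. }
  assert (Hmv : forall N, Cmod (RR N z2 - RR N z1) <= 2 * (2 * PI * (B' * (2 / (m N * PI)))) * (z2 - z1)).
  { intros N. apply mean_value_inequality with (1 := H12) (2 := HR N).
    intros t Ht. rewrite !Cmod_mult, Cmod_Ci, Cmod_R, Rabs_pos_eq, Rmult_1_r by lra.
    apply Rmult_le_compat_l. lra.
    apply Rmult_le_compat; try apply Cmod_ge_0; auto. }
  assert (HhW : forall N t, z1 <= t <= z2 ->
    Cmod (RtoC (2 * PI) * Ci * (h t * W N t)) <= 2 * PI * (B * (2 / (m N * PI)))).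
  { intros N t Ht. rewrite !Cmod_mult, Cmod_Ci, Cmod_R, Rabs_pos_eq, Rmult_1_r by lra.
    apply Rmult_le_compat_l. lra.
    apply Rmult_le_compat; try apply Cmod_ge_0; auto. }
  set (K := 8 * Rabs B' * (z2 - z1) + 8 * Rabs B).
  assert (Hfin : forall N, Cmod (p N z2 - p N z1) <= K / m N).
  { intros N.
    replace (p N z2 - p N z1)%C with ((RR N z2 - RR N z1) -
      (RtoC (2 * PI) * Ci * (h z2 * W N z2) - RtoC (2 * PI) * Ci * (h z1 * W N z1)))%C
      by (unfold RR; ring).
    apply Rle_trans with (1 := Cmod_minus_triangle _ _).
    pose proof (Cmod_minus_triangle (RtoC (2 * PI) * Ci * (h z2 * W N z2))
      (RtoC (2 * PI) * Ci * (h z1 * W N z1))) as T.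
    pose proof (HhW N z1 ltac:(lra)). pose proof (HhW N z2 ltac:(lra)).
    specialize (Hmv N). specialize (Hm N).
    assert (E1 : 2 * (2 * PI * (B' * (2 / (m N * PI)))) * (z2 - z1) =
      8 * B' * (z2 - z1) / m N) by (field; lra).
    assert (E2 : 2 * PI * (B * (2 / (m N * PI))) = 4 * B / m N) by (field; lra).
    rewrite E1 in Hmv. rewrite E2 in *.
    apply Rle_trans with (8 * B' * (z2 - z1) / m N + (4 * B / m N + 4 * B / m N)). lra.
    replace (8 * B' * (z2 - z1) / m N + (4 * B / m N + 4 * B / m N)) with
      ((8 * B' * (z2 - z1) + 8 * B) / m N) by (field; lra).
    apply Rmult_le_compat_r. left; now apply Rinv_0_lt_compat.
    unfold K. pose proof (Rle_abs B). pose proof (Rle_abs B').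
    assert (B' * (z2 - z1) <= Rabs B' * (z2 - z1)) by (apply Rmult_le_compat_r; lra). lra. }
  apply clim_seq_spec. intros eps He.
  assert (HK : 0 <= K).
  { unfold K. pose proof (Rabs_pos B). pose proof (Rabs_pos B').
    assert (0 <= Rabs B' * (z2 - z1)) by (apply Rmult_le_pos; lra). lra. }
  destruct (nfloor_ex (K / eps)) as [N [_ HN]]. apply Rdiv_le_0_compat; lra.
  exists N. intros n Hn.
  replace (p n z2 - p n z1 - 0)%C with (p n z2 - p n z1)%C by ring.
  apply Rle_lt_trans with (1 := Hfin n). specialize (Hm n).
  apply Rmult_lt_reg_r with (m n). exact Hm.
  unfold Rdiv. rewrite Rmult_assoc, Rinv_l, Rmult_1_r by lra.
  apply Rmult_lt_compat_r with (r := eps) in HN. 2: lra.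
  unfold Rdiv in HN. rewrite Rmult_assoc, Rinv_l in HN by lra.
  unfold m. apply le_INR in Hn. pose proof (pos_INR n). nra.
Qed.

(** The Fourier series of i pi (2 x - 1); by [fpair_0] it is also the case c = 0 of [fpair]. *)
Definition sawterm (x : C) (n : nat) : C :=
  (- (Hx (2 * INR (S n)) x - Hx (- (2 * INR (S n))) x) / RtoC (INR (S n)))%C.

(** The partial sum minus 2 pi i x has derivative -2 pi i times the Dirichlet kernel, so by
    [riemann_lebesgue] with c = 0 its variation between z and 1/2 tends to 0. At 1/2 every term of
    the sum vanishes. *)
Lemma sawtooth_series (z : R) : 0 < z < 1 ->
  filterlim (csum (sawterm z)) eventually (locally (Ci * RtoC (PI * (2 * z - 1)))%C).
Proof.
  intros Hz.
  set (p N x := (csum (sawterm x) N - RtoC (2 * PI) * Ci * x)%C).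
  assert (Hp : forall N t, Cderiv (p N) (RtoC t)
    (- (RtoC (2 * PI) * Ci) * cexp (- (RtoC (2 * PI) * Ci * 0) * RtoC t) * dirichlet N t)%C).
  { intros N t. eapply cderiv_eq.
    - apply cderiv_minus. 2: apply cderiv_scal, cderiv_id.
      apply (cderiv_csum (fun n x => sawterm x n) (fun n => - (RtoC (2 * PI) * Ci) *
        (Hx (2 * INR (S n)) t + Hx (- (2 * INR (S n))) t))%C).
      intros n _. unfold sawterm. eapply cderiv_eq.
      + apply (cderiv_mult (fun x => - (Hx (2 * INR (S n)) x - Hx (- (2 * INR (S n))) x))%C
          (fun _ => / RtoC (INR (S n)))%C).
        apply cderiv_opp. apply cderiv_minus; apply Hx_deriv. apply cderiv_const.
      + cbv beta. replace (- (2 * INR (S n)) * PI) with (- (2 * PI * INR (S n))) by ring.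
        replace (2 * INR (S n) * PI) with (2 * PI * INR (S n)) by ring.
        rewrite RtoC_opp, (RtoC_mult (2 * PI)). field. apply RtoC_INR_S.
    - rewrite csum_scal. unfold dirichlet.
      replace (- (RtoC (2 * PI) * Ci * 0) * RtoC t)%C with (RtoC 0) by ring.
      rewrite cexp_0. ring. }
  assert (Hhalf : forall N, csum (sawterm (/ 2)%R) N = 0).
  { intros N. induction N as [|N IH]. reflexivity.
    rewrite csum_S, IH. unfold sawterm. rewrite !Hx_real.
    replace (- (2 * INR (S N)) * PI * / 2) with (- (INR (S N) * PI)) by field.
    replace (2 * INR (S N) * PI * / 2) with (INR (S N) * PI) by field.
    rewrite cos_neg, sin_neg.
    assert (Hs : sin (INR (S N) * PI) = 0).
    { apply sin_eq_0_1. exists (Z.of_nat (S N)). now rewrite <- INR_IZR_INZ. }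
    rewrite Hs, Ropp_0. field. apply RtoC_INR_S. }
  assert (E : forall N, csum (sawterm z) N = (p N z - p N (RtoC (/ 2)) +
    RtoC (2 * PI) * Ci * (RtoC z - RtoC (/ 2)))%C).
  { intros N. unfold p. rewrite Hhalf. ring. }
  apply (clim_ext (F := eventually)) with (1 := fun N => eq_sym (E N)).
  assert (HL : filterlim (fun N => p N z - p N (RtoC (/ 2)))%C eventually (locally (RtoC 0))).
  { destruct (Rle_lt_dec (/ 2) z) as [H|H].
    - apply (riemann_lebesgue 0); try lra. auto.
    - apply clim_ext with (fun N => - (p N (RtoC (/ 2)) - p N z))%C. intros; ring.
      apply clim_eq with (- 0)%C. 2: ring.
      apply clim_opp. apply (riemann_lebesgue 0); try lra. auto. }
  eapply clim_eq. apply clim_plus. exact HL. apply clim_const.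
  rewrite <- (RtoC_minus z).
  replace (PI * (2 * z - 1)) with (2 * PI * (z - / 2)) by field.
  rewrite (RtoC_mult (2 * PI)). ring.
Qed.

Lemma sawtooth_series_1 : filterlim (csum (sawterm 1)) eventually (locally (RtoC 0)).
Proof.
  apply clim_ext with (fun _ => RtoC 0). 2: apply clim_const.
  intros N. induction N as [|N IH]. reflexivity.
  rewrite csum_S, <- IH. unfold sawterm.
  destruct (Hx_int (S N)) as [H1 H2]. rewrite H1, H2. field. apply RtoC_INR_S.
Qed.

(** Linear growth far out plus positivity gives a linear lower bound everywhere: only finitely many
    antidiagonals n + r = const are exceptional, and the induction on N0 absorbs one of them at a
    time. *)
Lemma pos_family (N0 : nat) : forall (g : nat -> nat -> R) (a : R), 0 < a ->
  (forall n r, 0 < g n r) ->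
  (forall n r, (N0 <= n + r)%nat -> a * (INR n + INR r + 1) <= g n r) ->
  exists d, 0 < d /\ forall n r, d * (INR n + INR r + 1) <= g n r.
Proof.
  induction N0 as [|N0 IH]; intros g a Ha Hg H.
  - exists a. split. exact Ha. intros; apply H; lia.
  - assert (Hfin : forall k, exists a', 0 < a' /\
      forall n, (n < k)%nat -> a' * (INR N0 + 1) <= g n (N0 - n)%nat).
    { induction k as [|k [a' [Ha' IHk]]].
      - exists 1. split. lra. intros; lia.
      - assert (HN : 0 < INR N0 + 1) by (pose proof (pos_INR N0); lra).
        exists (Rmin a' (g k (N0 - k)%nat / (INR N0 + 1))). split.
        apply Rmin_glb_lt. exact Ha'. now apply Rdiv_lt_0_compat.
        intros n Hn. destruct (Nat.eq_dec n k) as [->|Hnk].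
        + apply Rle_trans with (g k (N0 - k)%nat / (INR N0 + 1) * (INR N0 + 1)).
          apply Rmult_le_compat_r. lra. apply Rmin_r. right; field; lra.
        + apply Rle_trans with (a' * (INR N0 + 1)).
          apply Rmult_le_compat_r. lra. apply Rmin_l. apply IHk. lia. }
    destruct (Hfin (S N0)) as [a' [Ha' H']].
    apply (IH g (Rmin a a')). now apply Rmin_glb_lt. exact Hg.
    intros n r Hnr. pose proof (pos_INR n). pose proof (pos_INR r).
    destruct (Nat.eq_dec (n + r) N0) as [E|E].
    + specialize (H' n ltac:(lia)). replace (N0 - n)%nat with r in H' by lia.
      rewrite <- E, plus_INR in H'.
      apply Rle_trans with (2 := H'). apply Rmult_le_compat_r. lra. apply Rmin_r.
    + apply Rle_trans with (a * (INR n + INR r + 1)).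
      apply Rmult_le_compat_r. lra. apply Rmin_l. apply H. lia.
Qed.

Lemma nonint_lower_bound (c : C) : nonint c -> exists d, 0 < d /\ forall n,
  d * INR (S n) <= Cmod (c - RtoC (INR (S n))) /\
  d * INR (S n) <= Cmod (c + RtoC (INR (S n))).
Proof.
  intros Hc.
  (* The summand r is a dummy that gives [pos_family] its second index; at the end r = 0 is
     taken. *)
  set (g (n r : nat) := Rmin (Cmod (c - RtoC (INR (S n)))) (Cmod (c + RtoC (INR (S n)))) + INR r).
  destruct (nfloor_ex (2 * Cmod c)) as [N [_ HN]].
  { pose proof (Cmod_ge_0 c). lra. }
  destruct (pos_family (S N) g (1 / 4)) as [d [Hd H]].
  - lra.
  - intros n r. unfold g. pose proof (pos_INR r).
    assert (0 < Rmin (Cmod (c - RtoC (INR (S n)))) (Cmod (c + RtoC (INR (S n))))); [|lra].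
    apply Rmin_glb_lt; apply Cmod_gt_0; apply Hc.
  - intros n r Hnr. unfold g.
    assert (H1 : INR (S n) - Cmod c <= Rmin (Cmod (c - RtoC (INR (S n)))) (Cmod (c + RtoC (INR (S n))))).
    { pose proof (Cmod_triangle_rev (RtoC (INR (S n))) c) as T1.
      pose proof (Cmod_triangle_rev (RtoC (INR (S n))) (- c)%C) as T2.
      rewrite Cmod_opp in T2. rewrite Cmod_minus_sym in T1.
      replace (RtoC (INR (S n)) - - c)%C with (c + RtoC (INR (S n)))%C in T2 by ring.
      rewrite Cmod_R, Rabs_pos_eq in T1, T2 by (left; apply INR_S_pos).
      now apply Rmin_glb. }
    assert (H0 : 0 <= Rmin (Cmod (c - RtoC (INR (S n)))) (Cmod (c + RtoC (INR (S n))))).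
    { apply Rmin_glb; apply Cmod_ge_0. }
    apply le_INR in Hnr. rewrite plus_INR, S_INR in Hnr. rewrite S_INR in *.
    pose proof (pos_INR n). pose proof (pos_INR r). lra.
  - exists d. split. exact Hd. intros n. specialize (H n O).
    unfold g in H. simpl INR in H at 1. rewrite !Rplus_0_r in H.
    rewrite <- S_INR in H. split; apply Rle_trans with (1 := H). apply Rmin_l. apply Rmin_r.
Qed.

(** What remains of [fpair] after subtracting the sawtooth, by 1 / (c - n) + 1 / n = c / (n (c -
    n)). It is O(1/n^2) uniformly in real x, so the conditional convergence sits in the sawtooth
    alone. *)
Definition aterm (c x : C) (n : nat) : C :=
  (c / RtoC (INR (S n)) * (Hx (2 * INR (S n)) x / (c - RtoC (INR (S n)))
   - Hx (- (2 * INR (S n))) x / (c + RtoC (INR (S n)))))%C.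

Lemma fpair_split (c x : C) (n : nat) : nonint c ->
  fpair x c n = (aterm c x n + sawterm x n)%C.
Proof.
  intros Hc. destruct (Hc (S n)). unfold fpair, aterm, sawterm. field.
  repeat split; trivial. apply RtoC_INR_S.
Qed.

Lemma inv_square_summable : summable (fun n => / (INR (S n)) ^ 2).
Proof.
  apply summable_telescope with (fun n => / INR n) 1%nat.
  - intros n. left. apply Rinv_0_lt_compat. apply pow_lt, INR_S_pos.
  - intros [|n]. simpl. rewrite Rinv_0. lra. left. apply Rinv_0_lt_compat, INR_S_pos.
  - intros n Hn. apply (le_INR 1) in Hn. simpl in Hn. rewrite S_INR.
    replace (/ INR n - / (INR n + 1)) with (/ (INR n * (INR n + 1))) by (field; lra).
    apply Rinv_le_contravar; nra.
Qed.

Lemma aterm_dominated (c : C) : nonint c -> exists M, summable M /\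
  forall (t : R) n, Cmod (aterm c t n) <= M n.
Proof.
  intros Hc. destruct (nonint_lower_bound c Hc) as [d [Hd H]].
  exists (fun n => 2 * Cmod c / d * / (INR (S n)) ^ 2). split.
  - apply summable_scal. apply Rdiv_le_0_compat. pose proof (Cmod_ge_0 c); lra. exact Hd.
    apply inv_square_summable.
  - intros t n. pose proof (INR_S_pos n) as Hn. destruct (H n) as [H1 H2].
    destruct (Hc (S n)) as [N1 N2].
    assert (Hdn : 0 < d * INR (S n)) by now apply Rmult_lt_0_compat.
    unfold aterm. rewrite Cmod_mult, Cmod_div, Cmod_R, Rabs_pos_eq by (try apply RtoC_INR_S; lra).
    replace (2 * Cmod c / d * / INR (S n) ^ 2) with
      (Cmod c / INR (S n) * (/ (d * INR (S n)) + / (d * INR (S n)))) by (field; lra).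
    apply Rmult_le_compat_l. apply Rdiv_le_0_compat. apply Cmod_ge_0. exact Hn.
    apply Rle_trans with (1 := Cmod_minus_triangle _ _).
    rewrite !Cmod_div, !Cmod_Hx by assumption. unfold Rdiv. rewrite !Rmult_1_l.
    apply Rplus_le_compat; apply Rinv_le_contravar; assumption.
Qed.

(** * The value of the Fourier series *)

Section FourierValue.
Variable c : C.
Hypothesis Hc : nonint c.

Let c_neq_0 : c <> 0.
Proof. intros E. apply (proj1 (Hc O)). rewrite E. simpl. ring. Qed.

Let A (t : R) : C := (/ c + CS (aterm c t))%C.

Let S_N (N : nat) (x : C) : C := (/ c + csum (fpair x c) N)%C.

Lemma partial_sum_lim (t : R) (l : C) :
  filterlim (csum (sawterm t)) eventually (locally l) ->
  filterlim (fun N => S_N N t) eventually (locally (A t + l)%C).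
Proof.
  intros Hl. destruct (aterm_dominated c Hc) as [M [HM Hb]].
  apply clim_ext with (fun N => / c + csum (aterm c t) N + csum (sawterm t) N)%C.
  - intros N. unfold S_N. rewrite <- Cplus_assoc, <- csum_plus. f_equal.
    apply csum_ext. intros n _. symmetry. now apply fpair_split.
  - apply clim_plus; trivial. apply clim_plus. apply clim_const.
    now apply CS_lim with M.
Qed.

(** The factor e^(-2 pi i c x) is chosen so that differentiating e^(2 pi i (n - c) x) / (c - n)
    cancels the denominator; all terms together give the Dirichlet kernel, in the shape that
    [riemann_lebesgue] expects. *)
Lemma S_N_deriv (N : nat) (t : R) :
  Cderiv (fun x => cexp (- (RtoC (2 * PI) * Ci * c) * x) * S_N N x)%C (RtoC t)
   (- (RtoC (2 * PI) * Ci) * cexp (- (RtoC (2 * PI) * Ci * c) * RtoC t) * dirichlet N t)%C.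
Proof.
  set (k := (RtoC (2 * PI) * Ci)%C).
  set (ds n := (k * RtoC (INR (S n)) * (Hx (2 * INR (S n)) t / (c - RtoC (INR (S n)))
     - Hx (- (2 * INR (S n))) t / (c + RtoC (INR (S n)))))%C).
  eapply cderiv_eq.
  - apply cderiv_mult.
    + apply (cderiv_cexp_comp (fun x => - (k * c) * x)%C). apply cderiv_scal, cderiv_id.
    + unfold S_N. apply cderiv_plus. apply cderiv_const.
      apply (cderiv_csum (fun n x => fpair x c n) ds).
      intros n _. destruct (Hc (S n)) as [N1 N2]. unfold fpair. eapply cderiv_eq.
      * apply cderiv_plus.
        apply (cderiv_mult (Hx (2 * INR (S n))) (fun _ => / (c - RtoC (INR (S n))))%C).
        apply Hx_deriv. apply cderiv_const.
        apply (cderiv_mult (Hx (- (2 * INR (S n)))) (fun _ => / (c + RtoC (INR (S n))))%C).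
        apply Hx_deriv. apply cderiv_const.
      * cbv beta. unfold ds, k.
        replace (- (2 * INR (S n)) * PI) with (- (2 * PI * INR (S n))) by ring.
        replace (2 * INR (S n) * PI) with (2 * PI * INR (S n)) by ring.
        rewrite RtoC_opp, (RtoC_mult (2 * PI)). field. now split.
  - cbv beta. unfold S_N, dirichlet. 
    assert (E : csum ds N = (k * (c * csum (fpair t c) N -
      csum (fun n => Hx (2 * INR (S n)) t + Hx (- (2 * INR (S n))) t) N))%C).
    { clear - Hc. induction N as [|N IH]. simpl. ring. rewrite !csum_S, IH.
      destruct (Hc (S N)) as [N1 N2]. unfold ds, fpair. field. now split. }
    rewrite E. field. exact c_neq_0.
Qed.

(** The limit of e^(-2 pi i c t) times the partial sums for 0 < t < 1, with the sawtooth replaced by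
    its closed form. Unlike the series, which jumps at the ends, this is continuous up to t = 0 and
    t = 1. *)
Let Phi (t : R) : C :=
  (cexp (- (RtoC (2 * PI) * Ci * c) * RtoC t) * (A t + Ci * RtoC (PI * (2 * t - 1))))%C.

Lemma Phi_constant (t1 t2 : R) : 0 < t1 -> t1 <= t2 -> t2 < 1 -> Phi t1 = Phi t2.
Proof.
  intros H1 H12 H2.
  assert (HP : forall t, 0 < t < 1 -> filterlim
    (fun N => cexp (- (RtoC (2 * PI) * Ci * c) * RtoC t) * S_N N t)%C
    eventually (locally (Phi t))).
  { intros t Ht. apply clim_mult. apply clim_const. apply partial_sum_lim.
    now apply sawtooth_series. }
  assert (H := riemann_lebesgue c
    (fun N x => cexp (- (RtoC (2 * PI) * Ci * c) * x) * S_N N x)%C t1 t2 H1 H12 H2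
    (fun N t _ => S_N_deriv N t)).
  assert (H' := clim_minus (F := eventually) _ _ _ _ (HP t2 ltac:(lra)) (HP t1 ltac:(lra))).
  assert (E := clim_unique (F := eventually) _ _ _ H' H).
  symmetry. now apply Ceq_minus.
Qed.

Lemma A_seq_lim (u : nat -> R) (t : R) : is_lim_seq u t ->
  filterlim (fun n => A (u n)) eventually (locally (A t)).
Proof.
  intros Hu. destruct (aterm_dominated c Hc) as [M [HM Hb]].
  apply clim_plus. apply clim_const.
  apply (CS_dominated _ _ M HM).
  - exists O. intros n _. apply Hb.
  - intros n.
    assert (Hcont : Ccont (fun x => aterm c x n) t).
    { unfold aterm. destruct (Hc (S n)) as [N1 N2].
      apply clim_mult. apply clim_const.
      apply clim_minus; apply clim_mult; try apply clim_const;
        eapply cderiv_continuous; apply Hx_deriv. }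
    apply (filterlim_comp _ _ _ u (fun x : R => aterm c x n) eventually (locally t)).
    exact Hu. apply (Rcont_RtoC (fun x => aterm c x n)). exact Hcont.
Qed.

Lemma cexp_RtoC_seq_lim (k : C) (u : nat -> R) (t : R) : is_lim_seq u t ->
  filterlim (fun n => cexp (k * RtoC (u n)))%C eventually (locally (cexp (k * RtoC t))).
Proof.
  intros Hu.
  apply (filterlim_comp _ _ _ u (fun x : R => cexp (k * x)) eventually (locally t)).
  exact Hu. apply (Rcont_RtoC (fun x => cexp (k * x))).
  eapply cderiv_continuous. apply (cderiv_cexp_comp (fun x => k * x)%C).
  apply cderiv_scal, cderiv_id.
Qed.

Lemma RtoC_seq_lim (u : nat -> R) (t : R) : is_lim_seq u t ->
  filterlim (fun n => RtoC (u n)) eventually (locally (RtoC t)).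
Proof.
  intros Hu. apply clim_components. exact Hu. apply is_lim_seq_const.
Qed.

Lemma Phi_seq_lim (u : nat -> R) (t : R) : is_lim_seq u t ->
  filterlim (fun n => Phi (u n)) eventually (locally (Phi t)).
Proof.
  intros Hu. apply clim_mult. now apply cexp_RtoC_seq_lim.
  apply clim_plus. now apply A_seq_lim. apply clim_mult. apply clim_const.
  apply RtoC_seq_lim.
  apply (is_lim_seq_scal_l (fun n => 2 * u n - 1) PI (2 * t - 1)).
  apply is_lim_seq_minus'. apply (is_lim_seq_scal_l u 2 t). exact Hu.
  apply is_lim_seq_const.
Qed.

Lemma small_seq_lim : is_lim_seq (fun n => / (INR n + 2)) 0.
Proof.
  apply is_lim_seq_spec. intros eps.
  destruct (nfloor_ex (/ eps)) as [N [_ HN]].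
  { left. apply Rinv_0_lt_compat, cond_pos. }
  exists N. intros n Hn. rewrite Rminus_0_r. apply le_INR in Hn.
  pose proof (pos_INR n). pose proof (cond_pos eps).
  rewrite Rabs_pos_eq by (left; apply Rinv_0_lt_compat; lra).
  rewrite <- (Rinv_inv eps). apply Rinv_lt_contravar. 2: lra.
  apply Rmult_lt_0_compat. now apply Rinv_0_lt_compat. lra.
Qed.

Lemma Phi_ends : Phi 0 = Phi 1 /\ forall t, 0 < t < 1 -> Phi t = Phi 1.
Proof.
  assert (Hb : forall n, 0 < / (INR n + 2) <= / 2).
  { intros n. pose proof (pos_INR n). split. apply Rinv_0_lt_compat; lra.
    apply Rinv_le_contravar; lra. }
  assert (Hc1 : forall t, 0 < t < 1 -> Phi t = Phi (/ 2)).
  { intros t Ht. destruct (Rle_lt_dec t (/ 2)).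
    apply Phi_constant; lra. symmetry. apply Phi_constant; lra. }
  assert (H0 : Phi 0 = Phi (/ 2)).
  { apply (clim_unique (F := eventually) (fun n => Phi (/ (INR n + 2)))).
    - apply Phi_seq_lim, small_seq_lim.
    - apply clim_ext with (fun _ => Phi (/ 2)). 2: apply clim_const.
      intros n. symmetry. apply Hc1. specialize (Hb n). lra. }
  assert (H1 : Phi 1 = Phi (/ 2)).
  { apply (clim_unique (F := eventually) (fun n => Phi (1 - / (INR n + 2)))).
    - apply Phi_seq_lim. replace (Finite 1) with (Finite (1 - 0)) by (f_equal; ring).
      apply is_lim_seq_minus'. apply is_lim_seq_const. apply small_seq_lim.
    - apply clim_ext with (fun _ => Phi (/ 2)). 2: apply clim_const.
      intros n. symmetry. apply Hc1. specialize (Hb n). lra. }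
  split. now rewrite H0, H1. intros t Ht. now rewrite H1, Hc1.
Qed.

(** The part A has period 1, so Phi 0 = A 1 - pi i while e^(2 pi i c) Phi 1 = A 1 + pi i. As Phi
    takes the same value at both ends, subtraction eliminates A 1 and determines it. *)
Lemma Phi_value : (Phi 1 * (cexp (RtoC (2 * PI) * Ci * c) - 1))%C = (RtoC (2 * PI) * Ci)%C.
Proof.
  destruct Phi_ends as [H _].
  assert (EA : A 0 = A 1).
  { unfold A. f_equal. apply CS_ext. intros n. unfold aterm.
    destruct (Hx_int (S n)) as [H1 H2]. rewrite H1, H2.
    unfold Hx. rewrite !Cmult_0_r, cexp_0. reflexivity. }
  assert (E0 : Phi 0 = (A 1 - Ci * RtoC PI)%C).
  { unfold Phi. rewrite EA, Cmult_0_r, cexp_0.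
    replace (PI * (2 * 0 - 1)) with (- PI) by ring. rewrite RtoC_opp. ring. }
  assert (E1 : (cexp (RtoC (2 * PI) * Ci * c) * Phi 1)%C = (A 1 + Ci * RtoC PI)%C).
  { unfold Phi. rewrite Cmult_1_r, cexp_opp.
    replace (PI * (2 * 1 - 1)) with PI by ring. field. apply cexp_neq_0. }
  replace (Phi 1 * (cexp (RtoC (2 * PI) * Ci * c) - 1))%C with
    (cexp (RtoC (2 * PI) * Ci * c) * Phi 1 - Phi 1)%C by ring.
  rewrite E1, <- H, E0, RtoC_mult. ring.
Qed.

Lemma cexp_2pi_neq_1 : (cexp (RtoC (2 * PI) * Ci * c) - 1)%C <> 0.
Proof.
  intros E. pose proof Phi_value as H. rewrite E, Cmult_0_r in H.
  apply (f_equal Im) in H. unfold Im in H; simpl in H. pose proof PI_RGT_0. lra.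
Qed.

Lemma fourier_value (t : R) : 0 < t < 1 ->
  filterlim (fun N => / c + csum (fpair t c) N)%C eventually (locally
    (RtoC (2 * PI) * Ci * cexp (RtoC (2 * PI) * Ci * c * RtoC t) /
     (cexp (RtoC (2 * PI) * Ci * c) - 1))%C).
Proof.
  intros Ht. eapply clim_eq. apply partial_sum_lim. now apply sawtooth_series.
  pose proof (proj2 Phi_ends t Ht) as H. pose proof Phi_value as HV.
  rewrite <- H in HV. unfold Phi in HV.
  pose proof cexp_2pi_neq_1. pose proof (cexp_neq_0 (RtoC (2 * PI) * Ci * c * RtoC t)).
  replace (- (RtoC (2 * PI) * Ci * c) * RtoC t)%C with
    (- (RtoC (2 * PI) * Ci * c * RtoC t))%C in HV by ring.
  rewrite cexp_opp in HV.
  set (e := cexp (RtoC (2 * PI) * Ci * c)) in *.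
  set (et := cexp (RtoC (2 * PI) * Ci * c * RtoC t)) in *.
  rewrite <- HV. field. now split.
Qed.

Lemma fourier_value_1 :
  filterlim (fun N => / c + csum (fpair 1 c) N)%C eventually (locally
    (RtoC (2 * PI) * Ci * cexp (RtoC (2 * PI) * Ci * c) /
     (cexp (RtoC (2 * PI) * Ci * c) - 1) - RtoC PI * Ci)%C).
Proof.
  eapply clim_eq. apply partial_sum_lim. apply sawtooth_series_1.
  pose proof Phi_value as HV. unfold Phi in HV.
  pose proof cexp_2pi_neq_1 as H. pose proof (cexp_neq_0 (RtoC (2 * PI) * Ci * c)) as H0.
  rewrite Cmult_1_r, cexp_opp in HV.
  replace (PI * (2 * 1 - 1)) with PI in HV by ring.
  set (e := cexp (RtoC (2 * PI) * Ci * c)) in *. rewrite <- HV. field. now split.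
Qed.

End FourierValue.

(** The constant [kap] is 0 inside the interval and -pi i at z = 1, where the symmetric sum
    converges to the mean of the one-sided limits. It is chosen before c: later it becomes a factor
    of sum_r b_r. *)
Lemma fourier_limit (z : R) : 0 < z <= 1 -> exists kap : C, forall c, nonint c ->
  filterlim (csum (fpair z c)) eventually (locally
    (RtoC (2 * PI) * Ci * cexp (RtoC (2 * PI) * Ci * c * RtoC z) /
     (cexp (RtoC (2 * PI) * Ci * c) - 1) - / c + kap)%C) /\
  (cexp (RtoC (2 * PI) * Ci * c) - 1)%C <> 0 /\ (z < 1 -> kap = 0).
Proof.
  intros Hz. destruct (Rle_lt_or_eq_dec z 1 (proj2 Hz)) as [H| ->].
  - exists (RtoC 0). intros c Hc. split; [|split; [now apply cexp_2pi_neq_1|trivial]].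
    apply clim_ext with (fun N => / c + csum (fpair z c) N - / c)%C. intros; ring.
    eapply clim_eq. apply clim_minus. apply fourier_value; trivial. lra.
    apply clim_const. ring.
  - exists (- (RtoC PI * Ci))%C. intros c Hc.
    split; [|split; [now apply cexp_2pi_neq_1|lra]].
    apply clim_ext with (fun N => / c + csum (fpair 1 c) N - / c)%C. intros; ring.
    eapply clim_eq. apply clim_minus. apply fourier_value_1; trivial.
    apply clim_const. rewrite Cmult_1_r. ring.
Qed.

Lemma fpair_0 (z : R) (n : nat) : fpair z 0 n = sawterm z n.
Proof. unfold fpair, sawterm. field. apply RtoC_INR_S. Qed.

(** The case c = 0 occurs when s + r = 0, that is, at the removable singularities. *)
Lemma fpair_converges (z : R) (c : C) : 0 < z <= 1 -> c = 0 \/ nonint c ->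
  filterlim (csum (fpair z c)) eventually (locally (CS (fpair z c))).
Proof.
  intros Hz Hc.
  assert (H : exists l : C, filterlim (csum (fpair z c)) eventually (locally l)).
  { destruct Hc as [-> |Hc].
    - assert (E : forall N, csum (sawterm z) N = csum (fpair z 0) N).
      { intros N. apply csum_ext. intros. symmetry. apply fpair_0. }
      destruct (Rle_lt_or_eq_dec z 1 (proj2 Hz)) as [H| ->].
      + eexists. apply (clim_ext (F := eventually) _ _ _ E). apply sawtooth_series. lra.
      + eexists. apply (clim_ext (F := eventually) _ _ _ E). apply sawtooth_series_1.
    - destruct (fourier_limit z Hz) as [kap H]. eexists. now apply H. }
  destruct H as [l Hl]. now rewrite (CS_unique _ l Hl).
Qed.

(** At 1/2 the closed form is 2 pi i e / (e^2 - 1) with e = e^(pi i c), which is pi / sin(pi c).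
    This is the source of the reflection formula below. *)
Lemma fpair_half_limit (c : C) : nonint c ->
  filterlim (csum (fpair (/ 2)%R c)) eventually
    (locally (RtoC PI / csin (RtoC PI * c) - / c)%C).
Proof.
  intros Hc. destruct (fourier_limit (/ 2) ltac:(lra)) as [kap H].
  destruct (H c Hc) as [H1 [H2 H3]]. eapply clim_eq. exact H1.
  rewrite H3, Cplus_0_r by lra. f_equal.
  unfold csin. set (e := cexp (Ci * (RtoC PI * c))).
  assert (He : e <> 0) by apply cexp_neq_0.
  replace (cexp (- (Ci * (RtoC PI * c)))) with (/ e)%C by (unfold e; now rewrite cexp_opp).
  assert (E1 : cexp (RtoC (2 * PI) * Ci * c * RtoC (/ 2)) = e).
  { unfold e. f_equal. rewrite RtoC_mult, RtoC_inv by lra. field. }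
  assert (E2 : cexp (RtoC (2 * PI) * Ci * c) = (e * e)%C).
  { unfold e. rewrite <- cexp_plus. f_equal. rewrite RtoC_mult. ring. }
  rewrite E1. rewrite E2 in *.
  assert (H4 : (e - / e)%C <> 0).
  { intros E. apply H2. replace (e * e - 1)%C with ((e - / e) * e)%C by (field; exact He).
    rewrite E. ring. }
  rewrite RtoC_mult. field. repeat split; trivial.
  - apply Ci_nz.
Qed.

(** * Bounds of the Fourier sums that are uniform in the parameter *)

Lemma abel_summation (om : C) (a : nat -> C) (N : nat) :
  ((1 - om) * csum (fun k => om ^ S k * a k) N)%C =
  (om * a O - om ^ S N * a N + csum (fun k => om ^ S (S k) * (a (S k) - a k)) N)%C.
Proof.
  induction N as [|N IH].
  - simpl. ring.
  - rewrite !csum_S, Cmult_plus_distr_l, IH. simpl. ring.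
Qed.

Lemma rsum_telescope_bound (M T : nat -> R) (N : nat) :
  (forall n, M n <= T n - T (S n)) -> (forall n, 0 <= T n) -> rsum M N <= T O.
Proof.
  intros H HT. assert (rsum M N <= T O - T N).
  { induction N as [|N IH]; simpl. lra. specialize (H N). lra. }
  specialize (HT N). lra.
Qed.

(** Summation by parts leaves differences of a, each bounded by a product of two consecutive terms;
    1 / ((x)(x + 1)) telescopes, and the result depends neither on eta nor on N. *)
Lemma abel_bound (om : C) (a : nat -> C) (d eta : R) (N : nat) :
  Cmod om = 1 -> 0 < d -> 1 <= eta ->
  (forall n, Cmod (a n) <= / (d * (INR (S n) + eta))) ->
  (forall n, Cmod (a (S n) - a n) <= Cmod (a n) * Cmod (a (S n))) ->
  Cmod ((1 - om) * csum (fun k => om ^ S k * a k)%C N) <= 2 / d + / (d * d).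
Proof.
  intros Hom Hd Heta Ha Hdiff.
  assert (Hpos : forall n, 0 < INR (S n) + eta) by (intros n; pose proof (INR_S_pos n); lra).
  assert (Hpow : forall n, Cmod (om ^ n) = 1).
  { intros n. rewrite Cmod_pow, Hom. apply pow1. }
  assert (Hle : forall n, / (d * (INR (S n) + eta)) <= / d).
  { intros n. apply Rinv_le_contravar. exact Hd. specialize (Hpos n).
    pose proof (INR_S_pos n). nra. }
  rewrite abel_summation.
  apply Rle_trans with (1 := Cmod_triangle _ _).
  apply Rplus_le_compat.
  - apply Rle_trans with (1 := Cmod_minus_triangle _ _).
    rewrite !Cmod_mult, Hom, Hpow, !Rmult_1_l.
    pose proof (Ha O). pose proof (Ha N). pose proof (Hle O). pose proof (Hle N).
    unfold Rdiv. lra.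
  - set (M n := / (d * (INR (S n) + eta)) * / (d * (INR (S (S n)) + eta))).
    apply Rle_trans with (rsum M N).
    + apply csum_bound. intros k _. rewrite Cmod_mult, Hpow, Rmult_1_l.
      apply Rle_trans with (1 := Hdiff k).
      apply Rmult_le_compat; try apply Cmod_ge_0; apply Ha.
    + apply Rle_trans with (/ (d * d * (INR 1 + eta))).
      * apply (rsum_telescope_bound M (fun n => / (d * d * (INR (S n) + eta)))).
        -- intros n. unfold M. right. rewrite (S_INR (S n)). field.
           specialize (Hpos n). lra.
        -- intros n. left. apply Rinv_0_lt_compat. specialize (Hpos n).
           apply Rmult_lt_0_compat; nra.
      * apply Rinv_le_contravar. nra. simpl. nra.
Qed.

Lemma Hx_pow (a x : R) (n : nat) : Hx (a * INR n) x = (Hx a x ^ n)%C.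
Proof.
  unfold Hx. rewrite cexp_pow. f_equal. rewrite !RtoC_mult. ring.
Qed.

(** Used with eta = r + 1, so that K is the same for all r. For z < 1 the two phases differ from 1
    and Abel summation applies to each. At z = 1 all phases are 1, and a pair is 2 c / (c^2 -
    (n+1)^2), whose sum stays bounded because |c| is at most of order eta. *)
Lemma fpair_uniform_bound (z d B : R) : 0 < z <= 1 -> 0 < d -> 0 <= B ->
  exists K, forall c eta, 1 <= eta -> Cmod c <= B * eta ->
  (forall n, d * (INR (S n) + eta) <= Cmod (c - RtoC (INR (S n))) /\
             d * (INR (S n) + eta) <= Cmod (c + RtoC (INR (S n)))) ->
  forall N, Cmod (csum (fpair z c) N) <= K.
Proof.
  intros Hz Hd HB.
  destruct (Rle_lt_or_eq_dec z 1 (proj2 Hz)) as [Hz1|Hz1].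
  - set (om := Hx 2 z). set (om' := Hx (-2) z).
    assert (Hom : Cmod om = 1) by apply Cmod_Hx.
    assert (Hom' : Cmod om' = 1) by apply Cmod_Hx.
    assert (Hne : (1 - om)%C <> 0).
    { unfold om. replace 2 with (1 + 1) by ring. rewrite <- Hx_plus.
      intros E. apply (Hx_den_neq_0 z). lra.
      replace (Hx 1 z - Hx (-1) z)%C with (- (Hx (-1) z * (1 - Hx 1 z * Hx 1 z)))%C.
      rewrite E. ring.
      assert (H1 : (Hx (-1) z * Hx 1 z)%C = 1).
      { rewrite Hx_plus. replace (-1 + 1) with 0 by ring. apply Hx_0. }
      replace (- (Hx (-1) z * (1 - Hx 1 z * Hx 1 z)))%C with
        ((Hx (-1) z * Hx 1 z) * Hx 1 z - Hx (-1) z)%C by ring.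
      rewrite H1. ring. }
    assert (Hne' : (1 - om')%C <> 0).
    { intros E. apply Hne. assert (H1 : (om * om')%C = 1).
      { unfold om, om'. rewrite Hx_plus. replace (2 + -2) with 0 by ring. apply Hx_0. }
      apply (proj2 (Ceq_minus 1 om')) in E. rewrite <- E, Cmult_1_r in H1.
      rewrite H1. ring. }
    apply Cmod_gt_0 in Hne. apply Cmod_gt_0 in Hne'.
    exists ((2 / d + / (d * d)) / Cmod (1 - om) + (2 / d + / (d * d)) / Cmod (1 - om')).
    intros c eta Heta Hc Hlow N.
    assert (Hpos : forall n, 0 < INR (S n) + eta) by (intros n; pose proof (INR_S_pos n); lra).
    assert (Hnz : forall n, (c - RtoC (INR (S n)))%C <> 0 /\ (c + RtoC (INR (S n)))%C <> 0).
    { intros n. destruct (Hlow n). specialize (Hpos n).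
      split; apply Cmod_gt_0; nra. }
    set (a n := (/ (c - RtoC (INR (S n))))%C). set (b n := (/ (c + RtoC (INR (S n))))%C).
    assert (E : csum (fpair z c) N =
      (csum (fun k => om ^ S k * a k) N + csum (fun k => om' ^ S k * b k) N)%C).
    { rewrite <- csum_plus. apply csum_ext. intros k _. unfold fpair, a, b, om, om'.
      rewrite <- !Hx_pow. replace (- (2 * INR (S k))) with (-2 * INR (S k)) by ring.
      reflexivity. }
    rewrite E. apply Rle_trans with (1 := Cmod_triangle _ _).
    assert (Hdiv : forall x y u, 0 < Cmod x -> Cmod (x * y) <= u -> Cmod y <= u / Cmod x).
    { intros x y u Hx H. rewrite Cmod_mult in H. apply Rmult_le_reg_r with (Cmod x).
      exact Hx. unfold Rdiv. rewrite Rmult_assoc, Rinv_l, Rmult_1_r by lra. lra. }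
    apply Rplus_le_compat; apply Hdiv; trivial; apply abel_bound with eta; trivial.
    + intros n. unfold a. rewrite Cmod_inv by apply Hnz. apply Rinv_le_contravar.
      specialize (Hpos n). nra. apply Hlow.
    + intros n. rewrite <- Cmod_mult. right. f_equal. unfold a.
      rewrite (S_INR (S n)), RtoC_plus. pose proof (proj1 (Hnz n)) as N1.
      pose proof (proj1 (Hnz (S n))) as N2. rewrite (S_INR (S n)), RtoC_plus in N2.
      field. now split.
    + intros n. unfold b. rewrite Cmod_inv by apply Hnz. apply Rinv_le_contravar.
      specialize (Hpos n). nra. apply Hlow.
    + intros n. rewrite <- Cmod_mult, <- Cmod_opp. right. f_equal. unfold b.
      rewrite (S_INR (S n)), RtoC_plus. pose proof (proj2 (Hnz n)) as N1.
      pose proof (proj2 (Hnz (S n))) as N2. rewrite (S_INR (S n)), RtoC_plus in N2.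
      field. now split.
  - subst z. exists (2 * B / (d * d)). intros c eta Heta Hc Hlow N.
    assert (Hpos : forall n, 0 <= INR n) by apply pos_INR.
    (* The decrements of eta / (n + eta) dominate the pairs, and T 0 = 2 B / d^2 no longer contains
       eta. *)
    set (T n := 2 * B / (d * d) * (eta / (INR n + eta))).
    apply Rle_trans with (T O).
    2:{ unfold T. simpl. rewrite Rplus_0_l. right. field. lra. }
    set (M n := T n - T (S n)).
    apply Rle_trans with (rsum M N).
    + apply csum_bound. intros k _. destruct (Hlow k) as [L1 L2].
      assert (P1 : 0 < d * (INR (S k) + eta)) by (pose proof (INR_S_pos k); nra).
      unfold fpair. destruct (Hx_int (S k)) as [H1 H2]. rewrite H1, H2.
      replace (1 / (c - RtoC (INR (S k))) + 1 / (c + RtoC (INR (S k))))%C with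
        (2 * c * (/ (c - RtoC (INR (S k))) * / (c + RtoC (INR (S k)))))%C.
      2:{ field. split; apply Cmod_gt_0; lra. }
      rewrite !Cmod_mult, !Cmod_inv by (apply Cmod_gt_0; lra).
      rewrite Cmod_R, Rabs_pos_eq by lra.
      apply Rle_trans with (2 * (B * eta) *
        (/ (d * (INR (S k) + eta)) * / (d * (INR (S k) + eta)))).
      { apply Rmult_le_compat.
        - pose proof (Cmod_ge_0 c). lra.
        - apply Rmult_le_pos; left; apply Rinv_0_lt_compat; lra.
        - lra.
        - apply Rmult_le_compat; try (left; apply Rinv_0_lt_compat; lra);
            apply Rinv_le_contravar; lra. }
      unfold M, T. rewrite S_INR. specialize (Hpos k).
      replace (2 * B / (d * d) * (eta / (INR k + eta)) -
        2 * B / (d * d) * (eta / (INR k + 1 + eta))) with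
        (2 * (B * eta) / (d * d) * / ((INR k + eta) * (INR k + 1 + eta))) by (field; lra).
      replace (2 * (B * eta) * (/ (d * (INR k + 1 + eta)) * / (d * (INR k + 1 + eta)))) with
        (2 * (B * eta) / (d * d) * / ((INR k + 1 + eta) * (INR k + 1 + eta))) by (field; lra).
      apply Rmult_le_compat_l.
      apply Rdiv_le_0_compat; nra.
      apply Rinv_le_contravar; nra.
    + apply rsum_telescope_bound. intros; unfold M; lra.
      intros n. unfold T. specialize (Hpos n).
      apply Rmult_le_pos. apply Rdiv_le_0_compat; nra. apply Rdiv_le_0_compat; lra.
Qed.

(** Differences in c gain a factor: 1 / (c - n) - 1 / (c' - n) is of size |c - c'| / n^2, so here
    absolute convergence suffices. *)
Lemma fpair_lipschitz (z d : R) : 0 < d -> exists K, 0 <= K /\ forall c c',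
  (forall n, d * INR (S n) <= Cmod (c - RtoC (INR (S n))) /\
             d * INR (S n) <= Cmod (c + RtoC (INR (S n)))) ->
  (forall n, d * INR (S n) <= Cmod (c' - RtoC (INR (S n))) /\
             d * INR (S n) <= Cmod (c' + RtoC (INR (S n)))) ->
  forall N, Cmod (csum (fpair z c) N - csum (fpair z c') N) <= K * Cmod (c - c').
Proof.
  intros Hd. destruct (proj2 inv_square_summable) as [B HB].
  assert (HB0 : 0 <= B) by (specialize (HB O); simpl in HB; lra).
  exists (2 * B / (d * d)). split. apply Rdiv_le_0_compat; nra.
  intros c c' H H' N.
  replace (csum (fpair z c) N - csum (fpair z c') N)%C with
    (csum (fun n => fpair z c n + - (1) * fpair z c' n) N)%C
    by (rewrite csum_plus, csum_scal; ring).
  apply Rle_trans with (rsum (fun n => 2 * Cmod (c - c') / (d * d) * / INR (S n) ^ 2) N).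
  - apply csum_bound. intros n _.
    pose proof (INR_S_pos n) as Hn. assert (Hdn : 0 < d * INR (S n)) by nra.
    destruct (H n) as [A1 A2], (H' n) as [A3 A4].
    assert (N1 : (c - RtoC (INR (S n)))%C <> 0) by (apply Cmod_gt_0; lra).
    assert (N2 : (c + RtoC (INR (S n)))%C <> 0) by (apply Cmod_gt_0; lra).
    assert (N3 : (c' - RtoC (INR (S n)))%C <> 0) by (apply Cmod_gt_0; lra).
    assert (N4 : (c' + RtoC (INR (S n)))%C <> 0) by (apply Cmod_gt_0; lra).
    unfold fpair.
    set (e := Hx (2 * INR (S n)) z). set (e' := Hx (- (2 * INR (S n))) z).
    replace (e / (c - RtoC (INR (S n))) + e' / (c + RtoC (INR (S n))) +
      - (1) * (e / (c' - RtoC (INR (S n))) + e' / (c' + RtoC (INR (S n)))))%C with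
      (- (e * (c - c') * (/ (c - RtoC (INR (S n))) * / (c' - RtoC (INR (S n))))) -
       e' * (c - c') * (/ (c + RtoC (INR (S n))) * / (c' + RtoC (INR (S n)))))%C
      by (field; auto).
    apply Rle_trans with (1 := Cmod_minus_triangle _ _).
    rewrite Cmod_opp, !Cmod_mult, !Cmod_inv by assumption.
    unfold e, e'. rewrite !Cmod_Hx, !Rmult_1_l.
    pose proof (Cmod_ge_0 (c - c')).
    assert (G : forall x y, d * INR (S n) <= x -> d * INR (S n) <= y ->
      Cmod (c - c') * (/ x * / y) <= Cmod (c - c') / (d * d) * / INR (S n) ^ 2).
    { intros x y Hx Hy.
      replace (Cmod (c - c') / (d * d) * / INR (S n) ^ 2) with
        (Cmod (c - c') * (/ (d * INR (S n)) * / (d * INR (S n)))) by (field; lra).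
      apply Rmult_le_compat_l. assumption.
      apply Rmult_le_compat; try (left; apply Rinv_0_lt_compat; lra);
        apply Rinv_le_contravar; lra. }
    pose proof (G _ _ A1 A3). pose proof (G _ _ A2 A4).
    replace (2 * Cmod (c - c') / (d * d) * / INR (S n) ^ 2) with
      (Cmod (c - c') / (d * d) * / INR (S n) ^ 2 + Cmod (c - c') / (d * d) * / INR (S n) ^ 2)
      by (field; lra).
    lra.
  - rewrite rsum_scal. specialize (HB N).
    replace (2 * B / (d * d) * Cmod (c - c')) with (2 * Cmod (c - c') / (d * d) * B)
      by (field; lra).
    apply Rmult_le_compat_l. apply Rdiv_le_0_compat. pose proof (Cmod_ge_0 (c - c')); lra.
    nra. exact HB.
Qed.

(** * The Gamma function *)

Lemma lim_C_unique (u : nat -> C) (l : C) : filterlim u eventually (locally l) ->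
  @lim C_CompleteNormedModule (filtermap u eventually) = l.
Proof.
  intros H.
  assert (HP : ProperFilter (filtermap u eventually)).
  { apply filtermap_proper_filter. apply eventually_filter. }
  assert (Hc : @cauchy C_CompleteNormedModule (filtermap u eventually)).
  { intros eps. exists l. apply H. now exists eps. }
  assert (H1 := complete_cauchy (T := C_CompleteNormedModule) _ HP Hc).
  apply (clim_unique (F := eventually) u); trivial.
  intros P [eps HP']. destruct (H1 eps) as [N HN]. exists N.
  intros n Hn. now apply HP', HN.
Qed.

(** Summable relative increments first bound u by exp of the partial sums of e, since 1 + e n <= exp
    (e n); then the absolute increments are summable as well. *)
Lemma ratio_converges (u : nat -> C) (e : nat -> R) (J : nat) : summable e ->
  (forall n, (J <= n)%nat -> Cmod (u (S n) - u n) <= e n * Cmod (u n)) ->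
  exists l : C, filterlim u eventually (locally l).
Proof.
  intros He H. assert (He0 := proj1 He).
  destruct (rsum_lim e He) as [L [HL1 HL2]].
  assert (HB : forall n, (J <= n)%nat ->
    Cmod (u n) <= Cmod (u J) * exp (rsum e n - rsum e J)).
  { intros n Hn. induction Hn as [|n Hn IH].
    - rewrite Rminus_diag, exp_0. lra.
    - specialize (H n Hn).
      replace (rsum e (S n) - rsum e J) with ((rsum e n - rsum e J) + e n) by (simpl; ring).
      rewrite exp_plus, <- Rmult_assoc.
      apply Rle_trans with (Cmod (u n) * (1 + e n)).
      + replace (u (S n)) with ((u (S n) - u n) + u n)%C by ring.
        apply Rle_trans with (1 := Cmod_triangle _ _). lra.
      + apply Rmult_le_compat. apply Cmod_ge_0. specialize (He0 n); lra. exact IH.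
        apply exp_ineq1_le. }
  set (K := Cmod (u J) * exp (L - rsum e J)).
  assert (HK : forall n, (J <= n)%nat -> Cmod (u n) <= K).
  { intros n Hn. apply Rle_trans with (1 := HB n Hn). unfold K.
    apply Rmult_le_compat_l. apply Cmod_ge_0. specialize (HL1 n).
    destruct (Rle_lt_or_eq_dec (rsum e n - rsum e J) (L - rsum e J)) as [H1|E]. lra.
    left; now apply exp_increasing. rewrite E; lra. }
  assert (HK0 : 0 <= K) by (apply Rle_trans with (2 := HK J (le_n _)); apply Cmod_ge_0).
  assert (Hd : forall n m, (J <= n)%nat -> (n <= m)%nat ->
    Cmod (u m - u n) <= K * (rsum e m - rsum e n)).
  { intros n m Hn Hm. induction Hm as [|m Hm IH].
    - replace (u n - u n)%C with (RtoC 0) by ring. rewrite Cmod_0. lra.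
    - replace (u (S m) - u n)%C with ((u (S m) - u m) + (u m - u n))%C by ring.
      apply Rle_trans with (1 := Cmod_triangle _ _).
      specialize (H m ltac:(lia)). specialize (HK m ltac:(lia)). specialize (He0 m).
      simpl. nra. }
  apply cauchy_converges. intros eps Heps.
  destruct (HL2 (eps / (K + 1))) as [N HN]. apply Rdiv_lt_0_compat; lra.
  assert (G : forall n m, (max J N <= n)%nat -> (n <= m)%nat -> Cmod (u m - u n) < eps).
  { intros n m Hn Hm. apply Rle_lt_trans with (1 := Hd n m ltac:(lia) Hm).
    specialize (HN n ltac:(lia)). specialize (HL1 m).
    pose proof (rsum_mono e n m Hm He0).
    apply Rle_lt_trans with ((K + 1) * (rsum e m - rsum e n)). nra.
    apply Rlt_le_trans with ((K + 1) * (eps / (K + 1))).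
    apply Rmult_lt_compat_l; lra. right; field; lra. }
  exists (max J N). intros n m Hn Hm. destruct (Nat.le_ge_cases n m).
  rewrite Cmod_minus_sym. now apply G. now apply G.
Qed.

(** The reciprocals satisfy the same kind of estimate, hence converge too, and so the limit of u
    cannot be 0. *)
Lemma product_converges (u : nat -> C) (K : R) (J : nat) : 0 <= K ->
  (forall n, u n <> 0) ->
  (forall n, (J <= n)%nat -> Cmod (u (S n) / u n - 1) <= K / (INR (S n)) ^ 2) ->
  exists l : C, l <> 0 /\ filterlim u eventually (locally l).
Proof.
  intros HK Hu H.
  assert (Hs : summable (fun n => K * / INR (S n) ^ 2)).
  { apply summable_scal. exact HK. apply inv_square_summable. }
  destruct (ratio_converges u _ J Hs) as [l Hl].
  { intros n Hn. replace (u (S n) - u n)%C with ((u (S n) / u n - 1) * u n)%C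
      by (field; apply Hu).
    rewrite Cmod_mult. apply Rmult_le_compat_r. apply Cmod_ge_0. now apply H. }
  (* From here on the ratios have modulus at least 1/2, and passing to reciprocals only doubles
     K. *)
  destruct (nfloor_ex (2 * K)) as [N [_ HN]]. lra.
  assert (Hs2 : summable (fun n => 2 * K * / INR (S n) ^ 2)).
  { apply summable_scal. lra. apply inv_square_summable. }
  destruct (ratio_converges (fun n => / u n)%C _ (max J N) Hs2) as [l' Hl'].
  { intros n Hn. set (rho := (u (S n) / u n)%C).
    assert (Hr := H n ltac:(lia)). fold rho in Hr.
    assert (Hr2 : K / INR (S n) ^ 2 <= 1 / 2).
    { assert (INR N <= INR n) by (apply le_INR; lia). rewrite S_INR.
      pose proof (pos_INR n). pose proof (pos_INR N).
      apply Rmult_le_reg_r with ((INR n + 1) ^ 2). apply pow_lt; lra.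
      unfold Rdiv. rewrite Rmult_assoc, Rinv_l by (apply pow_nonzero; lra).
      nra. }
    assert (Hr3 : 1 / 2 <= Cmod rho).
    { pose proof (Cmod_triangle_rev 1 (1 - rho)) as T.
      replace (1 - (1 - rho))%C with rho in T by ring.
      rewrite Cmod_1, (Cmod_minus_sym 1) in T. lra. }
    assert (Hr0 : rho <> 0) by (apply Cmod_gt_0; lra).
    replace (/ u (S n) - / u n)%C with (- (rho - 1) * / rho * / u n)%C.
    2:{ unfold rho. field. split; apply Hu. }
    rewrite !Cmod_mult, Cmod_opp, (Cmod_inv rho) by assumption.
    apply Rmult_le_compat_r. apply Cmod_ge_0.
    apply Rle_trans with (K / INR (S n) ^ 2 * 2).
    - apply Rmult_le_compat; trivial. apply Cmod_ge_0.
      left; apply Rinv_0_lt_compat; lra.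
      rewrite <- (Rinv_inv 2). apply Rinv_le_contravar; lra.
    - unfold Rdiv. lra. }
  exists l. split; trivial. intros E.
  assert (E1 : (l * l')%C = 1).
  { apply (clim_unique (F := eventually) (fun n => u n * / u n)%C).
    now apply clim_mult.
    apply clim_ext with (fun _ => RtoC 1). intros n. field. apply Hu. apply clim_const. }
  rewrite E, Cmult_0_l in E1. symmetry in E1. now apply C1_nz.
Qed.

Lemma poch_S (s : C) (m : nat) : poch s (S m) = (poch s m * (s + RtoC (INR (S m))))%C.
Proof. reflexivity. Qed.

Lemma poch_neq_0 (s : C) (n : nat) : (forall k, (k <= n)%nat -> (s + RtoC (INR k))%C <> 0) ->
  poch s n <> 0.
Proof.
  induction n as [|n IH]; intros H.
  - simpl. specialize (H O (le_n _)). simpl in H. now rewrite Cplus_0_r in H.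
  - rewrite poch_S. apply Cmult_neq_0. apply IH. intros; apply H; lia. now apply H.
Qed.

Lemma ln_ratio_bounds (x : R) : 0 < x -> / (x + 1) <= ln (x + 1) - ln x <= / x.
Proof.
  intros Hx.
  assert (H : forall a b, 0 < a -> 0 < b -> ln a - ln b <= a / b - 1).
  { intros a b Ha Hb. pose proof (exp_ineq1_le (ln a - ln b)) as T.
    unfold Rminus in T. rewrite exp_plus, exp_Ropp, !exp_ln in T by assumption.
    unfold Rdiv. lra. }
  split.
  - pose proof (H x (x + 1) Hx ltac:(lra)).
    replace (x / (x + 1) - 1) with (- / (x + 1)) in H0 by (field; lra). lra.
  - pose proof (H (x + 1) x ltac:(lra) Hx).
    replace ((x + 1) / x - 1) with (/ x) in H0 by (field; lra). lra.
Qed.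

(** Consecutive terms have ratio e^(s lam) (x + 1) / (s + x + 1) with x = n and lam = ln (1 + 1/x).
    Expanding the exponential to first order, the leading parts cancel and the ratio is 1 +
    O(1/x^2). *)
Lemma gauss_seq_converges (s : C) : (forall n, (s + RtoC (INR n))%C <> 0) ->
  exists l : C, l <> 0 /\ filterlim (gauss_seq s) eventually (locally l).
Proof.
  intros Hs.
  assert (Hp : forall n, poch s n <> 0) by (intros; now apply poch_neq_0).
  assert (Hg : forall n, gauss_seq s n <> 0).
  { intros n. unfold gauss_seq. apply Cmult_neq_0. apply Cmult_neq_0.
    apply cexp_neq_0. apply RtoC_neq. apply INR_fact_neq_0.
    intros E. apply C1_nz. rewrite <- (Cinv_l (poch s n)) by apply Hp. rewrite E. ring. }
  set (m := Cmod s). assert (Hm : 0 <= m) by apply Cmod_ge_0.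
  destruct (nfloor_ex (2 * m + 1)) as [J [_ HJ]]. lra.
  (* The numerator is at most (16 m^2 + m) / x and the denominator at least (x + 1) / 2, which gives
     32 m^2 + 2 m; the factor 4 replaces 1 / (x (x + 1)) by 4 / (x + 1)^2. *)
  apply (product_converges (gauss_seq s) (4 * (32 * m ^ 2 + 2 * m)) (S J)); trivial.
  { nra. }
  intros n Hn.
  assert (Hx : 2 * m + 1 < INR n).
  { apply Rlt_le_trans with (1 := HJ). rewrite <- S_INR. now apply le_INR. }
  set (x := INR n) in *.
  set (lam := ln (x + 1) - ln x).
  assert (Hlam := ln_ratio_bounds x ltac:(lra)). fold lam in Hlam.
  assert (Hix : 0 < / x <= 1).
  { split. apply Rinv_0_lt_compat; lra. rewrite <- Rinv_1. apply Rinv_le_contravar; lra. }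
  assert (Hix1 : 0 < / (x + 1)) by (apply Rinv_0_lt_compat; lra).
  set (y := (s * RtoC lam)%C).
  set (D := (s + RtoC (x + 1))%C).
  assert (HD0 : D <> 0).
  { unfold D, x. rewrite <- S_INR. apply Hs. }
  assert (Hx1 : RtoC (x + 1) <> 0) by (apply RtoC_neq; lra).
  assert (E : (gauss_seq s (S n) / gauss_seq s n)%C = (cexp y * RtoC (x + 1) / D)%C).
  { assert (Ey : cexp y = (cpowR (INR (S n)) s / cpowR (INR n) s)%C).
    { unfold cpowR, y, lam, x. rewrite <- cexp_minus. f_equal.
      rewrite S_INR, RtoC_minus. ring. }
    rewrite Ey. unfold D, x. rewrite <- S_INR. unfold gauss_seq.
    rewrite poch_S, fact_simpl, mult_INR, RtoC_mult. field.
    repeat split; trivial; try apply cexp_neq_0.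
    apply RtoC_neq. apply INR_fact_neq_0. }
  rewrite E.
  replace (cexp y * RtoC (x + 1) / D - 1)%C with
    (((cexp y - 1 - y) * RtoC (x + 1) + s * RtoC (lam * (x + 1) - 1)) / D)%C.
  2:{ unfold y. rewrite RtoC_minus, RtoC_mult. unfold D. field. exact HD0. }
  rewrite Cmod_div by assumption.
  assert (HD : (x + 1) / 2 <= Cmod D).
  { unfold D. pose proof (Cmod_triangle_rev (RtoC (x + 1)) (- s)) as T.
    rewrite Cmod_opp, Cmod_R, Rabs_pos_eq in T by lra. fold m in T.
    replace (RtoC (x + 1) - - s)%C with (s + RtoC (x + 1))%C in T by ring. lra. }
  assert (Hy : Cmod y <= m * / x).
  { unfold y. rewrite Cmod_mult, Cmod_R, Rabs_pos_eq by lra. fold m.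
    apply Rmult_le_compat_l; lra. }
  assert (Hmx : m * / x <= 1 / 2).
  { apply Rmult_le_reg_r with x. lra. rewrite Rmult_assoc, Rinv_l by lra. lra. }
  pose proof (cexp_second_order y ltac:(lra)) as He.
  pose proof (Cmod_ge_0 y) as Hy0.
  assert (He2 : Cmod (cexp y - 1 - y) <= 8 * (m * / x) ^ 2).
  { apply Rle_trans with (1 := He). apply Rmult_le_compat_l. lra.
    apply pow_incr. lra. }
  assert (Hl1 : 0 <= lam * (x + 1) - 1 <= / x).
  { split.
    - assert (/ (x + 1) * (x + 1) <= lam * (x + 1)) by (apply Rmult_le_compat_r; lra).
      rewrite Rinv_l in H by lra. lra.
    - assert (lam * (x + 1) <= / x * (x + 1)) by (apply Rmult_le_compat_r; lra).
      replace (/ x * (x + 1)) with (1 + / x) in H by (field; lra). lra. }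
  assert (Hnum : Cmod ((cexp y - 1 - y) * RtoC (x + 1) + s * RtoC (lam * (x + 1) - 1))
    <= (16 * m ^ 2 + m) * / x).
  { apply Rle_trans with (1 := Cmod_triangle _ _).
    rewrite !Cmod_mult, !Cmod_R, !Rabs_pos_eq by lra. fold m.
    assert (A1 : Cmod (cexp y - 1 - y) * (x + 1) <= 8 * (m * / x) ^ 2 * (x + 1)).
    { apply Rmult_le_compat_r; lra. }
    assert (A2 : m * (lam * (x + 1) - 1) <= m * / x) by (apply Rmult_le_compat_l; lra).
    assert (A3 : 8 * (m * / x) ^ 2 * (x + 1) <= 16 * m ^ 2 * / x).
    { replace (8 * (m * / x) ^ 2 * (x + 1)) with (8 * m ^ 2 * / x * (1 + / x)) by (field; lra).
      replace (16 * m ^ 2 * / x) with (8 * m ^ 2 * / x * 2) by ring.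
      apply Rmult_le_compat_l. pose proof (pow2_ge_0 m).
      apply Rmult_le_pos; lra. lra. }
    lra. }
  rewrite S_INR. fold x.
  apply Rle_trans with ((16 * m ^ 2 + m) * / x * / ((x + 1) / 2)).
  - apply Rmult_le_compat; trivial. apply Cmod_ge_0.
    left; apply Rinv_0_lt_compat; lra. apply Rinv_le_contravar; lra.
  - replace ((16 * m ^ 2 + m) * / x * / ((x + 1) / 2)) with
      ((32 * m ^ 2 + 2 * m) * (/ x * / (x + 1))) by (field; lra).
    replace (4 * (32 * m ^ 2 + 2 * m) / (x + 1) ^ 2) with
      ((32 * m ^ 2 + 2 * m) * (4 / (x + 1) * / (x + 1))) by (field; lra).
    apply Rmult_le_compat_l. nra. apply Rmult_le_compat_r. lra.
    apply Rmult_le_reg_r with (x * (x + 1)). nra.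
    replace (/ x * (x * (x + 1))) with (x + 1) by (field; lra).
    replace (4 / (x + 1) * (x * (x + 1))) with (4 * x) by (field; lra). lra.
Qed.

Lemma CGamma_spec (s : C) : (forall n, (s + RtoC (INR n))%C <> 0) ->
  CGamma s <> 0 /\ filterlim (gauss_seq s) eventually (locally (CGamma s)).
Proof.
  intros Hs. destruct (gauss_seq_converges s Hs) as [l [Hl0 Hl]].
  assert (E : CGamma s = l) by now apply lim_C_unique.
  rewrite E. now split.
Qed.

(** * The beta integral as a series *)

(** This is n! / ((y + 1) ... (y + n)). *)
Fixpoint pratio (y : C) (n : nat) : C :=
  match n with
  | O => 1
  | S m => (pratio y m * (RtoC (INR (S m)) / (y + RtoC (INR (S m)))))%C
  end.

(** The quotient of Gauss approximants for Gamma(u) Gamma(y) / Gamma(u + y), in which the powers of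
    n cancel. *)
Definition beta_ratio (u y : C) (n : nat) : C :=
  (RtoC (INR (fact n)) * poch (u + y) n / (poch u n * poch y n))%C.

Lemma pratio_S (y : C) (m : nat) : pratio y (S m) =
  (pratio y m * (RtoC (INR (S m)) / (y + RtoC (INR (S m)))))%C.
Proof. reflexivity. Qed.

Lemma Cplus_INR_neq_0 (y : C) (n : nat) : 0 < Re y -> (y + RtoC (INR n))%C <> 0.
Proof.
  intros Hy E. apply (f_equal Re) in E. rewrite Re_plus, !re_RtoC in E.
  pose proof (pos_INR n). lra.
Qed.

Lemma pratio_neq_0 (y : C) (n : nat) : 0 < Re y -> pratio y n <> 0.
Proof.
  intros Hy. induction n as [|n IH]. apply C1_nz.
  rewrite pratio_S. apply Cmult_neq_0. exact IH.
  apply Cmult_neq_0. apply RtoC_INR_S.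
  intros E. apply C1_nz. rewrite <- (Cinv_l (y + RtoC (INR (S n)))).
  rewrite E; ring. now apply Cplus_INR_neq_0.
Qed.

Lemma pratio_step_bound (y : C) (n : nat) : 0 < Re y ->
  Cmod (RtoC (INR (S n)) / (y + RtoC (INR (S n)))) <= INR (S n) / (Re y + INR (S n)).
Proof.
  intros Hy. pose proof (INR_S_pos n) as Hn.
  rewrite Cmod_div, Cmod_R, Rabs_pos_eq by (try lra; now apply Cplus_INR_neq_0).
  apply Rmult_le_compat_l. lra. apply Rinv_le_contravar. lra.
  pose proof (re_le_Cmod (y + RtoC (INR (S n)))) as H. rewrite Re_plus, re_RtoC in H.
  rewrite Rabs_pos_eq in H; lra.
Qed.

Lemma pratio_quotient_bound (y : C) (n r : nat) : 0 < Re y ->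
  Cmod (pratio y n / pratio y (n - r)) <= 1.
Proof.
  intros Hy. assert (H : forall k m, Cmod (pratio y (k + m) / pratio y m) <= 1).
  { intros k m. induction k as [|k IH].
    - simpl. replace (pratio y m / pratio y m)%C with (RtoC 1).
      rewrite Cmod_1; lra. field. now apply pratio_neq_0.
    - change (S k + m)%nat with (S (k + m)). rewrite pratio_S.
      replace (pratio y (k + m) * (RtoC (INR (S (k + m))) / (y + RtoC (INR (S (k + m))))) / pratio y m)%C
        with ((pratio y (k + m) / pratio y m) *
          (RtoC (INR (S (k + m))) / (y + RtoC (INR (S (k + m))))))%C by (unfold Cdiv; ring).
      rewrite Cmod_mult. rewrite <- (Rmult_1_r 1).
      apply Rmult_le_compat; try apply Cmod_ge_0; trivial.
      apply Rle_trans with (1 := pratio_step_bound y (k + m) Hy).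
      pose proof (INR_S_pos (k + m)).
      apply Rmult_le_reg_r with (Re y + INR (S (k + m))). lra.
      unfold Rdiv. rewrite Rmult_assoc, Rinv_l; lra. }
  destruct (Nat.le_gt_cases r n).
  - replace n with (r + (n - r))%nat at 1 by lia. apply H.
  - replace (n - r)%nat with O by lia. rewrite <- (Nat.add_0_r n). apply H.
Qed.

Lemma clim_INR_ratio (y : C) :
  filterlim (fun n => RtoC (INR (S n)) / (y + RtoC (INR (S n))))%C eventually (locally (RtoC 1)).
Proof.
  assert (H : filterlim (fun n => 1 + y * RtoC (/ INR (S n)))%C eventually (locally (RtoC 1))).
  { eapply clim_eq. apply clim_plus. apply clim_const. apply clim_mult. apply clim_const.
    - apply (RtoC_seq_lim (fun n => / INR (S n)) 0).
      apply (is_lim_seq_incr_1 (fun n => / INR n)).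
      replace (Finite 0) with (Rbar_inv p_infty) by reflexivity.
      apply is_lim_seq_inv. apply is_lim_seq_INR. discriminate.
    - ring. }
  apply clim_ext_loc with (fun n => / (1 + y * RtoC (/ INR (S n))))%C.
  - assert (Hne := proj1 (clim_spec (F := eventually) _ _) H 1 ltac:(lra)).
    revert Hne. apply filter_imp. intros n Hn.
    assert (Hz : (1 + y * RtoC (/ INR (S n)))%C <> 0).
    { intros E. rewrite E in Hn. replace (0 - 1)%C with (- (1))%C in Hn by ring.
      rewrite Cmod_opp, Cmod_1 in Hn. lra. }
    pose proof (INR_S_pos n). rewrite RtoC_inv in * by lra.
    assert (Hy : (y + RtoC (INR (S n)))%C <> 0).
    { intros E. apply Hz. replace (1 + y * / RtoC (INR (S n)))%C with
        ((y + RtoC (INR (S n))) * / RtoC (INR (S n)))%C by (field; apply RtoC_INR_S).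
      rewrite E. ring. }
    field. split. exact Hy. apply RtoC_INR_S.
  - eapply clim_eq. apply clim_inv. 2: exact H. apply C1_nz. field.
Qed.

Lemma clim_sub_index (u : nat -> C) (l : C) (k : nat) :
  filterlim u eventually (locally l) ->
  filterlim (fun n => u (n - k)%nat) eventually (locally l).
Proof.
  rewrite !clim_seq_spec. intros H eps He. destruct (H eps He) as [N HN].
  exists (N + k)%nat. intros n Hn. apply HN. lia.
Qed.

Lemma pratio_quotient_lim (y : C) (r : nat) : 0 < Re y ->
  filterlim (fun n => pratio y n / pratio y (n - r))%C eventually (locally (RtoC 1)).
Proof.
  intros Hy. induction r as [|r IH].
  - apply clim_ext with (fun _ => RtoC 1). 2: apply clim_const.
    intros n. rewrite Nat.sub_0_r. field. now apply pratio_neq_0.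
  - apply clim_ext_loc with (fun n => pratio y n / pratio y (n - r) *
      (RtoC (INR (S (n - S r))) / (y + RtoC (INR (S (n - S r))))))%C.
    + exists (S r). intros n Hn. replace (n - r)%nat with (S (n - S r)) by lia.
      rewrite pratio_S. field. repeat split.
      * now apply pratio_neq_0.
      * now apply Cplus_INR_neq_0.
      * apply RtoC_INR_S.
    + eapply clim_eq. apply clim_mult. exact IH.
      apply (clim_sub_index (fun n => RtoC (INR (S n)) / (y + RtoC (INR (S n))))%C).
      apply clim_INR_ratio. ring.
Qed.

Lemma poch_head (w : C) (n : nat) : poch w (S n) = (w * poch (w + 1) n)%C.
Proof.
  induction n as [|n IH].
  - simpl. ring.
  - rewrite poch_S, IH, poch_S, (S_INR (S n)), RtoC_plus. ring.
Qed.

(** The n+1 factors y-1, ..., y-n-1, with signs reversed, form the rising factorial of 1 - y, and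
    [poch (- RtoC (INR (S n))) n] is (-1)^(n+1) (n+1)!. It serves to evaluate [beta_ratio] at u =
    -(n+1). *)
Lemma poch_reflect (y : C) (n : nat) :
  poch (y - RtoC (INR (S n))) n = (bcoef (1 - y) (S n) * poch (- RtoC (INR (S n))) n)%C.
Proof.
  induction n as [|n IH].
  - simpl. field.
  - rewrite !poch_head.
    replace (y - RtoC (INR (S (S n))) + 1)%C with (y - RtoC (INR (S n)))%C
      by (rewrite (S_INR (S n)), RtoC_plus; ring).
    replace (- RtoC (INR (S (S n))) + 1)%C with (- RtoC (INR (S n)))%C
      by (rewrite (S_INR (S n)), RtoC_plus; ring).
    rewrite IH, (bcoef_S _ (S n)). pose proof (RtoC_INR_S (S n)) as H.
    rewrite (S_INR (S n)), RtoC_plus in *. field. exact H.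
Qed.

Lemma INR_minus_neq_0 (n r : nat) : (r <= n)%nat ->
  (- RtoC (INR (S n)) + RtoC (INR r))%C <> 0.
Proof.
  intros Hr E. apply (f_equal Re) in E. rewrite Re_plus, Re_opp, !re_RtoC in E.
  apply le_INR in Hr. rewrite S_INR in E. lra.
Qed.

(* The partial fraction expansion of beta_ratio in the variable u. In the
   induction step the coefficient of the new pole -(n+1) is obtained from the
   induction hypothesis evaluated at u = -(n+1). *)
Lemma beta_partial_fractions (y : C) (n : nat) : 0 < Re y -> forall u : C,
  (forall k, (k <= n)%nat -> (u + RtoC (INR k))%C <> 0) ->
  beta_ratio u y n = (pratio y n / y +
    csum (fun r => bcoef (1 - y) r * (pratio y n / pratio y (n - r)) * / (u + RtoC (INR r))) (S n))%C.
Proof.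
  intros Hy.
  assert (Hy0 : y <> 0).
  { intros E. rewrite E, re_RtoC in Hy. lra. }
  induction n as [|n IH]; intros u Hu.
  - unfold beta_ratio. specialize (Hu O (le_n _)). simpl in *.
    rewrite Cplus_0_r in *. field. now split.
  - assert (HS : (y + RtoC (INR (S n)))%C <> 0) by now apply Cplus_INR_neq_0.
    assert (HuS : (u + RtoC (INR (S n)))%C <> 0) by now apply Hu.
    assert (Hpu : poch u n <> 0) by (apply poch_neq_0; intros; apply Hu; lia).
    assert (Hpy : poch y n <> 0).
    { apply poch_neq_0. intros. now apply Cplus_INR_neq_0. }
    assert (HN := RtoC_INR_S n). set (N := RtoC (INR (S n))) in *.
    assert (Hp : forall k, pratio y k <> 0) by (intros; now apply pratio_neq_0).
    set (b := bcoef (1 - y)).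
    set (A r := (b r * (pratio y n / pratio y (n - r)))%C).
    assert (Estep : beta_ratio u y (S n) =
      (beta_ratio u y n * (N * (u + y + N) / ((u + N) * (y + N))))%C).
    { unfold beta_ratio. rewrite fact_simpl, mult_INR, RtoC_mult, !poch_S. fold N.
      field. repeat split; trivial. }
    assert (E1 := IH u ltac:(intros; apply Hu; lia)).
    assert (E2 := IH (- N)%C ltac:(intros; now apply INR_minus_neq_0)).
    assert (E3 : beta_ratio (- N) y n = (RtoC (INR (fact n)) * b (S n) / poch y n)%C).
    { unfold beta_ratio. replace (- N + y)%C with (y - N)%C by ring.
      unfold N. rewrite poch_reflect. fold N. fold b. field. split; trivial.
      apply poch_neq_0. intros k Hk. now apply INR_minus_neq_0. }
    assert (E4 : pratio y n = (RtoC (INR (fact n)) * y / poch y n)%C).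
    { clear - Hy Hy0. induction n as [|n IH]. simpl. field. exact Hy0.
      rewrite pratio_S, IH, fact_simpl, mult_INR, RtoC_mult, poch_S. field.
      split. now apply Cplus_INR_neq_0. apply poch_neq_0. intros.
      now apply Cplus_INR_neq_0. }
    fold b in E1, E2.
    rewrite (csum_ext _ (fun r => A r * / (u + RtoC (INR r)))%C) in E1 by reflexivity.
    rewrite (csum_ext _ (fun r => A r * / (- N + RtoC (INR r)))%C) in E2 by reflexivity.
    rewrite csum_S, Nat.sub_diag.
    rewrite (csum_ext _ (fun r => N * (u + y + N) / ((u + N) * (y + N)) * (A r * / (u + RtoC (INR r)))
      + - (N * y / ((y + N) * (u + N))) * (A r * / (- N + RtoC (INR r))))%C (S n)).
    2:{ intros r Hr. unfold A. fold b.
        replace (S n - r)%nat with (S (n - r)) by lia. rewrite !pratio_S. fold N.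
        pose proof (Hu r ltac:(lia)) as U1.
        pose proof (INR_minus_neq_0 n r ltac:(lia)) as U2. fold N in U2.
        assert (U3 : RtoC (INR (S (n - r))) = (N - RtoC (INR r))%C).
        { unfold N. rewrite <- RtoC_minus. f_equal. rewrite <- minus_INR by lia.
          f_equal. lia. }
        rewrite U3.
        assert (U4 : (y + (N - RtoC (INR r)))%C <> 0).
        { rewrite <- U3. now apply Cplus_INR_neq_0. }
        assert (U5 : (N - RtoC (INR r))%C <> 0).
        { rewrite <- U3. apply RtoC_INR_S. }
        field. repeat split; trivial. }
    rewrite csum_plus, !csum_scal.
    assert (E5 : csum (fun k => A k * / (- N + RtoC (INR k)))%C (S n) =
      (beta_ratio (- N) y n - pratio y n / y)%C) by (rewrite E2; ring).
    assert (E6 : csum (fun k => A k * / (u + RtoC (INR k)))%C (S n) =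
      (beta_ratio u y n - pratio y n / y)%C) by (rewrite E1; ring).
    rewrite E5, E6, E3, Estep, pratio_S. fold N. fold b. rewrite E4.
    change (pratio y 0) with (RtoC 1). field. repeat split; trivial.
Qed.

Lemma CS_finite (a : nat -> C) (n : nat) :
  (forall k, (n <= k)%nat -> a k = 0) -> CS a = csum a n.
Proof.
  intros H. apply CS_unique. apply clim_ext_loc with (fun _ => csum a n).
  2: apply clim_const.
  exists n. intros m Hm. induction Hm as [|m Hm IH]. reflexivity.
  rewrite csum_S, <- IH, H by assumption. ring.
Qed.

Lemma pratio_lim_0 (y : C) : 1 <= Re y ->
  filterlim (pratio y) eventually (locally (RtoC 0)).
Proof.
  intros Hy.
  assert (H : forall n, Cmod (pratio y n) <= / INR (S n)).
  { induction n as [|n IH]. simpl. rewrite Cmod_1, Rinv_1. lra.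
    rewrite pratio_S, Cmod_mult.
    pose proof (pratio_step_bound y n ltac:(lra)) as H1.
    pose proof (INR_S_pos n). rewrite (S_INR (S n)).
    apply Rle_trans with (/ INR (S n) * (INR (S n) / (Re y + INR (S n)))).
    apply Rmult_le_compat; try apply Cmod_ge_0; trivial.
    replace (/ INR (S n) * (INR (S n) / (Re y + INR (S n)))) with (/ (Re y + INR (S n)))
      by (field; lra).
    apply Rinv_le_contravar; lra. }
  apply clim_seq_spec. intros eps He.
  destruct (nfloor_ex (/ eps)) as [N [_ HN]]. left; now apply Rinv_0_lt_compat.
  exists N. intros n Hn. replace (pratio y n - 0)%C with (pratio y n) by ring.
  apply Rle_lt_trans with (1 := H n).
  apply le_INR in Hn. rewrite <- (Rinv_inv eps). rewrite S_INR.
  pose proof (Rinv_0_lt_compat eps He). apply Rinv_lt_contravar. nra. lra.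
Qed.

Lemma shift_lower_bound (u : C) : (forall n, (u + RtoC (INR n))%C <> 0) ->
  exists d, 0 < d /\ forall n, d <= Cmod (u + RtoC (INR n)).
Proof.
  intros Hu. destruct (nfloor_ex (2 * Cmod u + 1)) as [N [_ HN]].
  { pose proof (Cmod_ge_0 u). lra. }
  destruct (pos_family (S N) (fun n r => Cmod (u + RtoC (INR n)) + INR r) (1 / 4))
    as [d [Hd H]].
  - lra.
  - intros n r. pose proof (pos_INR r).
    pose proof (proj1 (Cmod_gt_0 _) (Hu n)). lra.
  - intros n r Hnr. pose proof (Cmod_triangle_rev (RtoC (INR n)) (- u)) as T.
    replace (RtoC (INR n) - - u)%C with (u + RtoC (INR n))%C in T by ring.
    rewrite Cmod_opp, Cmod_R, Rabs_pos_eq in T by apply pos_INR.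
    apply le_INR in Hnr. rewrite plus_INR, S_INR in Hnr.
    pose proof (pos_INR n). pose proof (pos_INR r). lra.
  - exists d. split. exact Hd. intros n. specialize (H n O). simpl INR in H at 2.
    pose proof (pos_INR n). simpl in H. nra.
Qed.

(** Limit of the partial fractions: the coefficient of each pole tends to b_r(1 - y), the quotients
    of [pratio] being bounded by 1, and the constant term tends to 0. Terms with r > n are set to 0
    to have one index set. *)
Lemma beta_series_lim (y u : C) (M : nat -> R) : 1 <= Re y -> summable M ->
  (forall r, Cmod (bcoef (1 - y) r) <= M r) ->
  (forall n, (u + RtoC (INR n))%C <> 0) ->
  filterlim (beta_ratio u y) eventually
    (locally (CS (fun r => bcoef (1 - y) r * / (u + RtoC (INR r)))%C)).
Proof.
  intros Hy HM Hb Hu. assert (Hy0 : 0 < Re y) by lra.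
  destruct (shift_lower_bound u Hu) as [d [Hd Hlow]].
  set (f n r := if le_dec r n
    then (bcoef (1 - y) r * (pratio y n / pratio y (n - r)) * / (u + RtoC (INR r)))%C
    else RtoC 0).
  apply clim_ext with (fun n => pratio y n * / y + CS (f n))%C.
  - intros n. rewrite beta_partial_fractions; auto. f_equal.
    rewrite (CS_finite (f n) (S n)).
    + apply csum_ext. intros k Hk. unfold f. destruct (le_dec k n); [reflexivity|lia].
    + intros k Hk. unfold f. destruct (le_dec k n); [lia|reflexivity].
  - eapply clim_eq.
    + apply clim_plus. apply clim_mult. now apply pratio_lim_0. apply clim_const.
      apply (CS_dominated (F := eventually) f
        (fun r => bcoef (1 - y) r * / (u + RtoC (INR r)))%C (fun r => / d * M r)).
      * apply summable_scal. left; now apply Rinv_0_lt_compat. exact HM.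
      * exists O. intros n _ r. unfold f. assert (HM0 := proj1 HM r).
        assert (0 < / d) by now apply Rinv_0_lt_compat.
        destruct (le_dec r n).
        -- rewrite !Cmod_mult, (Rmult_comm (/ d)). apply Rmult_le_compat.
           apply Rmult_le_pos; apply Cmod_ge_0. apply Cmod_ge_0.
           rewrite <- (Rmult_1_r (M r)). apply Rmult_le_compat; try apply Cmod_ge_0; trivial.
           now apply pratio_quotient_bound.
           rewrite Cmod_inv by apply Hu. apply Rinv_le_contravar; trivial.
        -- rewrite Cmod_0. nra.
      * intros r. apply clim_ext_loc with
          (fun n => bcoef (1 - y) r * (pratio y n / pratio y (n - r)) * / (u + RtoC (INR r)))%C.
        -- exists r. intros n Hn. unfold f. destruct (le_dec r n); [reflexivity|lia].
        -- eapply clim_eq. apply clim_mult. apply clim_mult. apply clim_const.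
           now apply pratio_quotient_lim. apply clim_const. ring.
    + ring.
Qed.

Lemma cpowR_plus (a : R) (s t : C) : cpowR a (s + t) = (cpowR a s * cpowR a t)%C.
Proof. unfold cpowR. rewrite <- cexp_plus. f_equal. ring. Qed.

Lemma beta_series (y x : C) (M : nat -> R) : 1 <= Re y -> summable M ->
  (forall r, Cmod (bcoef (1 - y) r) <= M r) ->
  (forall n, (x + RtoC (INR n))%C <> 0) ->
  (forall n, (x + 1 - y + RtoC (INR n))%C <> 0) ->
  CS (fun r => bcoef (1 - y) r * / (x + 1 - y + RtoC (INR r)))%C =
    (CGamma (x + 1 - y) * CGamma y / (x * CGamma x))%C.
Proof.
  intros Hy HM Hb Hx Hu.
  destruct (CGamma_spec x Hx) as [Gx0 Gx].
  destruct (CGamma_spec (x + 1 - y) Hu) as [_ Gu].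
  assert (Hyn : forall n, (y + RtoC (INR n))%C <> 0).
  { intros. apply Cplus_INR_neq_0. lra. }
  destruct (CGamma_spec y Hyn) as [_ Gy].
  assert (Hx0 : x <> 0).
  { intros E. apply (Hx O). rewrite E. simpl. ring. }
  apply (clim_unique (F := eventually) (beta_ratio (x + 1 - y) y)).
  - now apply beta_series_lim with M.
  (* Against the Gauss products for x + 1 - y, y and x a factor (x + n + 1) / n is left over, from
     [poch (x + 1) n] and from n^(x+1) = n n^x. It is split at n + 1 into two factors tending to
     1. *)
  - apply clim_ext_loc with (fun n => gauss_seq (x + 1 - y) n * gauss_seq y n /
      (x * gauss_seq x n) * / (RtoC (INR (S n)) / (x + RtoC (INR (S n))))
      * (RtoC (INR (S n)) / (0 + RtoC (INR n))))%C.
    + exists 1%nat. intros n Hn. unfold beta_ratio, gauss_seq.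
      replace (x + 1 - y + y)%C with (x + 1)%C by ring.
      assert (E : (x * poch (x + 1) n)%C = (poch x n * (x + RtoC (INR (S n))))%C).
      { rewrite <- poch_head. apply poch_S. }
      assert (Hn0 : RtoC (INR n) <> 0).
      { apply RtoC_neq. apply not_0_INR. lia. }
      assert (Hc1 : cpowR (INR n) 1 = RtoC (INR n)).
      { unfold cpowR. rewrite Cmult_1_l, cexp_RtoC, exp_ln. reflexivity.
        apply lt_0_INR. lia. }
      assert (Hc : (cpowR (INR n) (x + 1 - y) * cpowR (INR n) y)%C =
        (cpowR (INR n) x * RtoC (INR n))%C).
      { rewrite <- Hc1, <- !cpowR_plus. f_equal. ring. }
      assert (Hcx : cpowR (INR n) x <> 0) by apply cexp_neq_0.
      assert (Hp1 : poch x n <> 0) by (apply poch_neq_0; auto).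
      assert (Hp2 : poch (x + 1 - y) n <> 0) by (apply poch_neq_0; auto).
      assert (Hp3 : poch y n <> 0) by (apply poch_neq_0; auto).
      assert (Hf : RtoC (INR (fact n)) <> 0).
      { apply RtoC_neq. apply INR_fact_neq_0. }
      pose proof (RtoC_INR_S n) as HS. pose proof (Hx (S n)) as HxS.
      replace (poch (x + 1) n) with (poch x n * (x + RtoC (INR (S n))) / x)%C.
      2:{ rewrite <- E. field. exact Hx0. }
      replace (cpowR (INR n) (x + 1 - y) * RtoC (INR (fact n)) / poch (x + 1 - y) n *
        (cpowR (INR n) y * RtoC (INR (fact n)) / poch y n))%C with
        ((cpowR (INR n) (x + 1 - y) * cpowR (INR n) y) * (RtoC (INR (fact n)) * RtoC (INR (fact n)))
         / (poch (x + 1 - y) n * poch y n))%C by (field; now split).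
      rewrite Hc. rewrite Cplus_0_l. field. repeat split; trivial.
    + eapply clim_eq. apply clim_mult. apply clim_mult. apply clim_div.
      * apply Cmult_neq_0. exact Hx0. exact Gx0.
      * apply clim_mult. exact Gu. exact Gy.
      * apply clim_mult. apply clim_const. exact Gx.
      * apply clim_inv. 2: apply clim_INR_ratio. apply C1_nz.
      (* Writing n as -1 + (n + 1) reduces (n + 1) / n to [clim_INR_ratio] at -1. *)
      * apply clim_ext_loc with (fun n => / ((RtoC (INR (S n)) / (RtoC (-1) + RtoC (INR (S n))))
          ) * ((RtoC (INR (S n)) / (RtoC (-1) + RtoC (INR (S n)))) *
          (RtoC (INR (S n)) / (RtoC (-1) + RtoC (INR (S n))))))%C.
        -- exists 1%nat. intros n Hn.
           assert (E : (RtoC (-1) + RtoC (INR (S n)))%C = RtoC (INR n)).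
           { rewrite <- RtoC_plus, S_INR. f_equal. ring. }
           rewrite E, Cplus_0_l. pose proof (RtoC_INR_S n).
           assert (RtoC (INR n) <> 0).
           { apply RtoC_neq. apply not_0_INR. lia. }
           field. now split.
        -- apply clim_mult. apply clim_inv. apply C1_nz. apply clim_INR_ratio.
           apply clim_mult; apply clim_INR_ratio.
      * field. split; trivial.
Qed.

(* Raabe's test, uniformly in a neighbourhood of s0. *)
Lemma bcoef_majorant (s0 : C) : Re s0 < 0 -> exists eps M, 0 < eps /\ summable M /\
  forall w, Cmod (w - s0) < eps -> forall r, Cmod (bcoef w r) <= M r.
Proof.
  intros Hs. set (sg := - Re s0). assert (Hsg : 0 < sg) by (unfold sg; lra).
  set (k := Cmod s0 + 1). assert (Hk : 1 <= k) by (unfold k; pose proof (Cmod_ge_0 s0); lra).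
  (* Near s0 one has Re w <= -3/4 sg; beyond this threshold the spare sg / 4 also absorbs (Im w)^2
     <= k^2, so |w + j| <= j - sg / 2. *)
  destruct (nfloor_ex (k ^ 2 / sg + 2 * sg)) as [J0 [_ HJ0]].
  { pose proof (pow2_ge_0 k). apply Rplus_le_le_0_compat. apply Rdiv_le_0_compat; lra. lra. }
  set (J := (2 * S J0)%nat).
  assert (HJ : forall j, (J <= j)%nat -> 2 * (k ^ 2 / sg + 2 * sg) < INR j).
  { intros j Hj. apply le_INR in Hj. unfold J in Hj. rewrite mult_INR, (S_INR J0) in Hj.
    simpl in Hj. lra. }
  set (phi j := if le_dec J j then INR j - sg / 2 else k + INR j).
  assert (Hphi : forall j, 0 <= phi j).
  { intros j. unfold phi. pose proof (pos_INR j). destruct (le_dec J j) as [H1|H1]; [|lra].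
    specialize (HJ j H1). assert (0 <= k ^ 2 / sg).
    { apply Rdiv_le_0_compat. apply pow2_ge_0. lra. } lra. }
  set (M := fix M (r : nat) : R := match r with O => 1
    | S j => M j * phi j / INR (S j) end).
  assert (HM0 : forall r, 0 <= M r).
  { induction r as [|r IH]. simpl; lra.
    change (M (S r)) with (M r * phi r / INR (S r)).
    apply Rdiv_le_0_compat. apply Rmult_le_pos; auto. apply INR_S_pos. }
  exists (Rmin 1 (sg / 4)), M.
  split. apply Rmin_glb_lt; lra. split.
  (* For j >= J, (j + 1) M (j + 1) = (j - sg / 2) M j, so M j is 2 / sg times the decrement of j M
     j. *)
  - apply summable_telescope with (fun j => 2 / sg * (INR j * M j)) J; trivial.
    + intros j. apply Rmult_le_pos. apply Rdiv_le_0_compat; lra.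
      apply Rmult_le_pos. apply pos_INR. apply HM0.
    + intros j Hj. change (M (S j)) with (M j * phi j / INR (S j)).
      unfold phi. destruct (le_dec J j); [|lia]. pose proof (INR_S_pos j).
      right. field. lra.
  - intros w Hw.
    assert (Hw1 := Rlt_le_trans _ _ _ Hw (Rmin_l _ _)).
    assert (Hw2 := Rlt_le_trans _ _ _ Hw (Rmin_r _ _)).
    assert (Hwk : Cmod w <= k).
    { replace w with ((w - s0) + s0)%C by ring.
      apply Rle_trans with (1 := Cmod_triangle _ _). unfold k; lra. }
    assert (Hre : - (5 / 4) * sg <= Re w <= - (3 / 4) * sg).
    { pose proof (re_le_Cmod (w - s0)) as H. rewrite Re_minus in H.
      assert (- (sg / 4) <= Re w - Re s0 <= sg / 4).
      { apply Rabs_le_between. lra. }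
      unfold sg in *. lra. }
    assert (Hfac : forall j, Cmod (w + RtoC (INR j)) <= phi j).
    { intros j. unfold phi. destruct (le_dec J j) as [H|H].
      - specialize (HJ j H). specialize (Hphi j). unfold phi in Hphi.
        destruct (le_dec J j); [|lia].
        assert (Hsq : Cmod (w + RtoC (INR j)) ^ 2 <= (INR j - sg / 2) ^ 2).
        { rewrite Cmod2_alt, Re_plus, Im_plus, re_RtoC, im_RtoC, Rplus_0_r.
          pose proof (im_le_Cmod w) as Hi.
          assert (Hi2 : Im w ^ 2 <= k ^ 2).
          { rewrite <- pow2_abs. apply pow_incr. split. apply Rabs_pos. lra. }
          assert (Hj2 : k ^ 2 + sg * sg <= sg / 2 * INR j).
          { apply Rle_trans with (sg / 2 * (2 * (k ^ 2 / sg + 2 * sg))).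
            - replace (sg / 2 * (2 * (k ^ 2 / sg + 2 * sg))) with (k ^ 2 + 2 * (sg * sg))
                by (field; lra). nra.
            - apply Rmult_le_compat_l; lra. }
          assert (Hsum : (Re w + INR j) ^ 2 <= (INR j - 3 / 4 * sg) ^ 2).
          { assert (0 <= k ^ 2 / sg) by (apply Rdiv_le_0_compat; [apply pow2_ge_0|lra]).
            apply pow_incr. lra. }
          nra. }
        pose proof (Cmod_ge_0 (w + RtoC (INR j))). nra.
      - apply Rle_trans with (1 := Cmod_triangle _ _).
        rewrite Cmod_R, Rabs_pos_eq by apply pos_INR. lra. }
    induction r as [|r IH].
    + simpl. rewrite Cmod_1. lra.
    + rewrite bcoef_S. change (M (S r)) with (M r * phi r / INR (S r)).
      rewrite Cmod_div, Cmod_mult, Cmod_R, Rabs_pos_eq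
        by (try apply RtoC_INR_S; left; apply INR_S_pos).
      apply Rmult_le_compat_r. left; apply Rinv_0_lt_compat, INR_S_pos.
      apply Rmult_le_compat; try apply Cmod_ge_0; auto.
Qed.

(* Abel's limit theorem for the binomial series: (1-x)^(-s) -> 0 as x -> 1. *)
Lemma bcoef_sum_0 (s : C) (M : nat -> R) : Re s < 0 -> summable M ->
  (forall r, Cmod (bcoef s r) <= M r) -> CS (bcoef s) = 0.
Proof.
  intros Hs HM Hb.
  set (x n := 1 - / (INR n + 2)).
  assert (Hx : forall n, 0 <= x n < 1).
  { intros n. unfold x. pose proof (pos_INR n).
    assert (0 < / (INR n + 2) <= / 2).
    { split. apply Rinv_0_lt_compat; lra. apply Rinv_le_contravar; lra. }
    lra. }
  assert (Hxl : is_lim_seq x 1).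
  { unfold x. replace (Finite 1) with (Finite (1 - 0)) by (f_equal; ring).
    apply is_lim_seq_minus'. apply is_lim_seq_const. apply small_seq_lim. }
  apply (clim_unique (F := eventually) (fun n => CS (fun r => bcoef s r * RtoC (x n ^ r))%C)).
  - apply (CS_dominated (F := eventually) (fun n r => bcoef s r * RtoC (x n ^ r))%C _ M HM).
    + exists O. intros n _ r. rewrite Cmod_mult, Cmod_R.
      rewrite <- (Rmult_1_r (M r)). apply Rmult_le_compat; trivial.
      apply Cmod_ge_0. apply Rabs_pos.
      rewrite Rabs_pos_eq by (apply pow_le; apply Hx).
      rewrite <- (pow1 r). apply pow_incr. specialize (Hx n). lra.
    + intros r. eapply clim_eq. apply clim_mult. apply clim_const.
      apply RtoC_seq_lim.
      * assert (H : forall k, is_lim_seq (fun n => x n ^ k) 1).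
        { induction k as [|k IH]. apply is_lim_seq_const.
          simpl. replace (Finite 1) with (Finite (1 * 1)) by (f_equal; ring).
          now apply is_lim_seq_mult'. }
        apply H.
      * ring.
  - apply clim_ext with (fun n => cpowR (1 - x n) (- s)).
    + intros n. symmetry. now apply binomial_series.
    + apply clim_seq_spec. intros eps He.
      destruct (nfloor_ex (exp (ln eps / Re s))) as [N [_ HN]]. left; apply exp_pos.
      exists N. intros n Hn. apply le_INR in Hn. pose proof (pos_INR n).
      replace (cpowR (1 - x n) (- s) - 0)%C with (cpowR (1 - x n) (- s)) by ring.
      unfold cpowR, x. rewrite Cmod_cexp, re_scal_r, Re_opp.
      replace (1 - (1 - / (INR n + 2))) with (/ (INR n + 2)) by ring.
      rewrite ln_Rinv by lra. rewrite <- (exp_ln eps He).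
      apply exp_increasing.
      assert (H1 : ln eps / Re s < ln (INR n + 2)).
      { apply exp_lt_inv. rewrite exp_ln by lra. lra. }
      apply Rmult_lt_compat_r with (r := - Re s) in H1. 2: lra.
      replace (ln eps / Re s * - Re s) with (- ln eps) in H1 by (field; lra). lra.
Qed.

(** * The reflection formula *)

(** The quotient binom(2n, n-k) / binom(2n, n). Up to sign it is the residue at k and at -k of the
    n-th partial product for pi / sin(pi w). *)
Fixpoint cbr (n : nat) (k : nat) : R :=
  match k with
  | O => 1
  | S j => cbr n j * ((INR n - INR j) / (INR n + INR j + 1))
  end.

Lemma cbr_S (n j : nat) : cbr n (S j) = cbr n j * ((INR n - INR j) / (INR n + INR j + 1)).
Proof. reflexivity. Qed.

Lemma cbr_recurrence (n k : nat) :
  cbr (S n) k * ((INR (S n) - INR k) * (INR (S n) + INR k)) = cbr n k * INR (S n) ^ 2.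
Proof.
  pose proof (pos_INR n) as Hn.
  induction k as [|k IH].
  - simpl cbr. simpl (INR 0). ring.
  - rewrite !cbr_S. pose proof (pos_INR k) as Hk. rewrite !S_INR in *.
    replace (cbr n k * ((INR n - INR k) / (INR n + INR k + 1)) * (INR n + 1) ^ 2) with
      (cbr n k * (INR n + 1) ^ 2 * ((INR n - INR k) / (INR n + INR k + 1))) by ring.
    rewrite <- IH. field. lra.
Qed.

Lemma cbr_vanish (n k : nat) : (n < k)%nat -> cbr n k = 0.
Proof.
  intros H. induction H as [|k H IH]; rewrite cbr_S.
  - rewrite Rminus_diag. unfold Rdiv. ring.
  - rewrite IH. ring.
Qed.

Lemma cbr_bound (n k : nat) : Rabs (cbr n k) <= 1.
Proof.
  destruct (Nat.le_gt_cases k n) as [H|H].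
  - assert (0 <= cbr n k <= 1).
    { induction k as [|k IH]. simpl; lra.
      rewrite cbr_S. specialize (IH ltac:(lia)). apply le_INR in H. rewrite S_INR in H.
      pose proof (pos_INR k).
      assert (0 <= (INR n - INR k) / (INR n + INR k + 1) <= 1).
      { split. apply Rdiv_le_0_compat; lra. apply Rmult_le_reg_r with (INR n + INR k + 1).
        lra. unfold Rdiv. rewrite Rmult_assoc, Rinv_l; lra. }
      set (f := (INR n - INR k) / (INR n + INR k + 1)) in *.
      split. apply Rmult_le_pos; lra. rewrite <- (Rmult_1_r 1). apply Rmult_le_compat; lra. }
    rewrite Rabs_pos_eq; lra.
  - rewrite cbr_vanish by assumption. rewrite Rabs_R0. lra.
Qed.

(** The alternating sum of a row of Pascal's triangle is 0; divided by the central entry and folded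
    by symmetry this reads 1 + 2 sum = 0. The sequence t is its explicit telescoping. *)
Lemma cbr_sum (n : nat) :
  rsum (fun k => (-1) ^ S k * cbr (S n) (S k)) (S n) = - (1 / 2).
Proof.
  set (N := S n). assert (HN : 0 < INR N) by apply INR_S_pos.
  clearbody N. set (t k := (-1) ^ k * (INR N + INR k) * cbr N k / (2 * INR N)).
  assert (H : forall m, rsum (fun k => (-1) ^ S k * cbr N (S k)) m = t 1%nat - t (S m)).
  { induction m as [|m IH]. simpl rsum. ring.
    change (rsum (fun k => (-1) ^ S k * cbr N (S k)) (S m)) with
      (rsum (fun k => (-1) ^ S k * cbr N (S k)) m + (-1) ^ S m * cbr N (S m)).
    rewrite IH. unfold t. rewrite (cbr_S N (S m)). pose proof (pos_INR m).
    rewrite (S_INR (S m)), (S_INR m). simpl pow. field. split; lra. }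
  rewrite H. unfold t. rewrite (cbr_vanish N (S N)) by lia.
  rewrite cbr_S. simpl. field. lra.
Qed.

(** Partial products of Euler's product for pi / sin(pi w). *)
Fixpoint sineprod (w : C) (n : nat) : C :=
  match n with
  | O => / w
  | S m => (sineprod w m * (RtoC (INR (S m)) * RtoC (INR (S m)) /
      ((RtoC (INR (S m)) - w) * (RtoC (INR (S m)) + w))))%C
  end.

Definition sterm (w : C) (k : nat) : C :=
  (2 * w / ((w - RtoC (INR (S k))) * (w + RtoC (INR (S k)))))%C.

Lemma csum_RtoC (a : nat -> R) (n : nat) : csum (fun k => RtoC (a k)) n = RtoC (rsum a n).
Proof.
  induction n as [|n IH]. reflexivity. rewrite csum_S, IH, <- RtoC_plus. reflexivity.
Qed.

(** The new factor rescales the old residues according to [cbr_recurrence]; what it creates at the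
    new poles n+1 and -(n+1) is a sum over all old poles, evaluated by [cbr_sum]. *)
Lemma sineprod_partial_fractions (w : C) (n : nat) : nonint w ->
  sineprod w n = (/ w + csum (fun k => RtoC ((-1) ^ S k * cbr n (S k)) * sterm w k) n)%C.
Proof.
  intros Hw.
  assert (Hw0 : w <> 0).
  { intros E. apply (proj1 (Hw O)). rewrite E. simpl. ring. }
  induction n as [|n IH].
  - simpl. ring.
  - change (sineprod w (S n)) with (sineprod w n * (RtoC (INR (S n)) * RtoC (INR (S n)) /
      ((RtoC (INR (S n)) - w) * (RtoC (INR (S n)) + w))))%C.
    rewrite IH, csum_S.
    assert (HN := RtoC_INR_S n). set (N := RtoC (INR (S n))) in *.
    destruct (Hw (S n)) as [W1 W2]. fold N in W1, W2.
    assert (W3 : (N - w)%C <> 0).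
    { intros E. apply W1. rewrite <- Copp_0, <- E. ring. }
    assert (W4 : (N + w)%C <> 0) by now rewrite Cplus_comm.
    set (X := (N * N / ((N - w) * (N + w)))%C).
    assert (E1 : (csum (fun k => RtoC ((-1) ^ S k * cbr n (S k)) * sterm w k) n * X)%C =
      csum (fun k => RtoC ((-1) ^ S k * cbr (S n) (S k)) * sterm w k +
        - sterm w n * RtoC ((-1) ^ S k * cbr (S n) (S k)))%C n).
    { rewrite Cmult_comm, <- csum_scal. apply csum_ext. intros k Hk.
      pose proof (cbr_recurrence n (S k)) as Hr.
      destruct (Hw (S k)) as [V1 V2].
      assert (Hlt : INR (S k) < INR (S n)) by (apply lt_INR; lia).
      pose proof (INR_S_pos k) as Hkp.
      set (g := cbr (S n) (S k)) in *.
      assert (E : cbr n (S k) = g * ((INR (S n) - INR (S k)) * (INR (S n) + INR (S k))) / INR (S n) ^ 2).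
      { rewrite Hr. field. lra. }
      rewrite E. set (sgn := (-1) ^ S k).
      assert (E' : RtoC (sgn * (g * ((INR (S n) - INR (S k)) * (INR (S n) + INR (S k))) / INR (S n) ^ 2))
        = (RtoC (sgn * g) * ((N - RtoC (INR (S k))) * (N + RtoC (INR (S k)))) / (N * N))%C).
      { unfold N. rewrite <- !RtoC_minus, <- !RtoC_plus, <- !RtoC_mult, <- RtoC_div by nra.
        f_equal. field. lra. }
      rewrite E'. unfold X, sterm. fold N. field. repeat split; trivial. }
    rewrite Cmult_plus_distr_r, E1, csum_plus, csum_scal, csum_RtoC.
    pose proof (cbr_sum n) as Hs.
    change (rsum (fun k => (-1) ^ S k * cbr (S n) (S k)) (S n)) with
      (rsum (fun k => (-1) ^ S k * cbr (S n) (S k)) n + (-1) ^ S n * cbr (S n) (S n)) in Hs.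
    replace ((-1) ^ S n * cbr (S n) (S n)) with
      (- (1 / 2) - rsum (fun k => (-1) ^ S k * cbr (S n) (S k)) n) by lra.
    rewrite RtoC_minus, RtoC_opp, RtoC_div by lra.
    unfold X, sterm. fold N. field. repeat split; trivial.
Qed.

Lemma cbr_lim (k : nat) : is_lim_seq (fun n => cbr n k) 1.
Proof.
  induction k as [|k IH].
  - apply is_lim_seq_const.
  - apply is_lim_seq_ext with (fun n => cbr n k * ((INR n - INR k) / (INR n + INR k + 1))).
    { intros n. reflexivity. }
    replace (Finite 1) with (Finite (1 * (1 - 0))) by (f_equal; ring).
    apply is_lim_seq_mult'. exact IH.
    apply is_lim_seq_ext with (fun n => 1 - (2 * INR k + 1) * / (INR n + (INR k + 1))).
    { intros n. pose proof (pos_INR n). pose proof (pos_INR k). field. lra. }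
    apply is_lim_seq_minus'. apply is_lim_seq_const.
    replace (Finite 0) with (Rbar_mult (2 * INR k + 1) 0) by (simpl; f_equal; ring).
    apply is_lim_seq_scal_l.
    replace (Finite 0) with (Rbar_inv p_infty) by reflexivity.
    apply is_lim_seq_inv. 2: discriminate.
    eapply is_lim_seq_plus. apply is_lim_seq_INR. apply is_lim_seq_const. reflexivity.
Qed.

Lemma Hx_half (k : nat) :
  Hx (2 * INR k) (/ 2)%R = RtoC ((-1) ^ k) /\ Hx (- (2 * INR k)) (/ 2)%R = RtoC ((-1) ^ k).
Proof.
  assert (H : cos (INR k * PI) = (-1) ^ k /\ sin (INR k * PI) = 0).
  { induction k as [|k [H1 H2]].
    - simpl. rewrite Rmult_0_l, cos_0, sin_0. split; reflexivity.
    - rewrite S_INR, Rmult_plus_distr_r, Rmult_1_l, cos_plus, sin_plus, H1, H2,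
        cos_PI, sin_PI. simpl. split; ring. }
  destruct H as [H1 H2]. rewrite !Hx_real.
  replace (- (2 * INR k) * PI * / 2) with (- (INR k * PI)) by field.
  replace (2 * INR k * PI * / 2) with (INR k * PI) by field.
  rewrite cos_neg, sin_neg, H1, H2.
  split; apply C_ext; unfold Re, Im; simpl; ring.
Qed.

(** As [cbr] tends to 1 and is bounded by 1, the partial fractions converge to the Fourier series at
    1/2, whose characters are the signs (-1)^k. Euler's product is thus read off from
    [fpair_half_limit]. *)
Lemma sineprod_lim (w : C) : nonint w ->
  filterlim (sineprod w) eventually (locally (RtoC PI / csin (RtoC PI * w))%C).
Proof.
  intros Hw. destruct (nonint_lower_bound w Hw) as [d [Hd Hlow]].
  set (M k := 2 * Cmod w / (d * d) * / INR (S k) ^ 2).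
  assert (HM : summable M).
  { apply summable_scal. apply Rdiv_le_0_compat. pose proof (Cmod_ge_0 w); lra. nra.
    apply inv_square_summable. }
  assert (Hst : forall k, Cmod (sterm w k) <= M k).
  { intros k. unfold sterm, M. destruct (Hlow k) as [L1 L2]. destruct (Hw (S k)) as [W1 W2].
    pose proof (INR_S_pos k).
    assert (0 < d * INR (S k)) by nra.
    rewrite Cmod_div, !Cmod_mult, Cmod_R, Rabs_pos_eq by (try apply Cmult_neq_0; trivial; lra).
    replace (2 * Cmod w / (d * d) * / INR (S k) ^ 2) with
      (2 * Cmod w * / (d * INR (S k) * (d * INR (S k)))) by (field; lra).
    apply Rmult_le_compat_l. pose proof (Cmod_ge_0 w); lra.
    apply Rinv_le_contravar. nra. apply Rmult_le_compat; lra. }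
  set (c n k := (RtoC ((-1) ^ S k * cbr n (S k)) * sterm w k)%C).
  assert (Hc : forall n k, Cmod (c n k) <= M k).
  { intros n k. unfold c. rewrite Cmod_mult, Cmod_R, Rabs_mult, pow_1_abs.
    rewrite <- (Rmult_1_l (M k)). apply Rmult_le_compat; trivial; try apply Cmod_ge_0.
    - rewrite Rmult_1_l. apply Rabs_pos.
    - rewrite Rmult_1_l. apply cbr_bound. }
  apply clim_ext with (fun n => / w + CS (c n))%C.
  - intros n. rewrite sineprod_partial_fractions by assumption. f_equal.
    apply CS_finite. intros k Hk. unfold c. rewrite cbr_vanish by lia.
    rewrite Rmult_0_r. ring.
  - eapply clim_eq. apply clim_plus. apply clim_const.
    apply (CS_dominated (F := eventually) c (fpair (/ 2)%R w) M HM).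
    + exists O. intros n _. apply Hc.
    + intros k. eapply clim_eq. apply clim_mult. 2: apply clim_const.
      apply (RtoC_seq_lim (fun n => (-1) ^ S k * cbr n (S k)) ((-1) ^ S k * 1)).
      apply (is_lim_seq_scal_l (fun n => cbr n (S k)) ((-1) ^ S k) 1). apply cbr_lim.
      unfold fpair, sterm. destruct (Hx_half (S k)) as [H1 H2]. rewrite H1, H2, Rmult_1_r.
      destruct (Hw (S k)). field. now split.
    + rewrite (CS_unique _ _ (fpair_half_limit w Hw)). ring.
Qed.

Lemma nonint_of_Re_neg (w : C) : Re w < 0 -> (forall n, (w + RtoC (INR n))%C <> 0) -> nonint w.
Proof.
  intros Hw H n. split; [|apply H]. intros E. apply (f_equal Re) in E.
  rewrite Re_minus, !re_RtoC in E. pose proof (pos_INR n). lra.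
Qed.

(** The beta series with u = w and y = 1 - w, where u + y = 1: [beta_ratio] is then n! (n+1)! over
    two rising factorials, that is, [sineprod w n] up to a factor tending to 1. *)
Lemma reflection_series (w : C) (M : nat -> R) : Re w < 0 ->
  (forall n, (w + RtoC (INR n))%C <> 0) -> summable M ->
  (forall r, Cmod (bcoef w r) <= M r) ->
  CS (fun r => bcoef w r * / (w + RtoC (INR r)))%C = (RtoC PI / csin (RtoC PI * w))%C.
Proof.
  intros Hw Hn HM Hb. assert (Hni := nonint_of_Re_neg w Hw Hn).
  assert (E : (1 - (1 - w))%C = w) by ring.
  assert (Hy : 1 <= Re (1 - w)) by (rewrite Re_minus, re_RtoC; lra).
  apply (clim_unique (F := eventually) (beta_ratio w (1 - w))).
  - assert (H := beta_series_lim (1 - w) w M Hy HM). rewrite E in H. now apply H.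
  - apply clim_ext with (fun n => sineprod w n *
      (RtoC (INR (S n)) / (- w + RtoC (INR (S n)))))%C.
    + intros n.
      assert (Hd : forall k, (1 - w + RtoC (INR k))%C <> 0).
      { intros k. apply Cplus_INR_neq_0. lra. }
      assert (Hpw : forall k, poch w k <> 0) by (intros; apply poch_neq_0; auto).
      assert (Hpd : forall k, poch (1 - w) k <> 0) by (intros; apply poch_neq_0; auto).
      assert (Hw0 : w <> 0).
      { intros Ew. apply (Hn O). rewrite Ew. simpl. ring. }
      unfold beta_ratio. replace (w + (1 - w))%C with (RtoC 1) by ring.
      assert (Hd' : forall k, (- w + RtoC (INR (S k)))%C <> 0).
      { intros k Ek. apply (Hd k). rewrite S_INR, RtoC_plus in Ek. rewrite <- Ek. ring. }
      induction n as [|n IH].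
      * specialize (Hd' O). specialize (Hd O). simpl in *.
        assert (D2 : (1 - w)%C <> 0) by (intros Ek; apply Hd'; rewrite <- Ek; ring).
        field. repeat split; trivial.
      * change (sineprod w (S n)) with (sineprod w n * (RtoC (INR (S n)) * RtoC (INR (S n)) /
          ((RtoC (INR (S n)) - w) * (RtoC (INR (S n)) + w))))%C.
        rewrite fact_simpl, mult_INR, RtoC_mult, !poch_S.
        pose proof (Hd' n) as D1. pose proof (Hd' (S n)) as D2.
        pose proof (Hn (S n)) as D3. pose proof (RtoC_INR_S n) as D4.
        replace (RtoC (INR (S (S n)))) with (RtoC (INR (S n)) + 1)%C in *
          by (rewrite (S_INR (S n)), RtoC_plus; reflexivity).
        set (N := RtoC (INR (S n))) in *.
        assert (D5 : (N - w)%C <> 0) by (intros Ek; apply D1; rewrite <- Ek; ring).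
        assert (D6 : (N + w)%C <> 0) by (intros Ek; apply D3; rewrite <- Ek; ring).
        assert (D7 : (1 - w + N)%C <> 0) by (intros Ek; apply D2; rewrite <- Ek; ring).
        replace (sineprod w n * (N * N / ((N - w) * (N + w))) * ((N + 1) / (- w + (N + 1))))%C
          with ((sineprod w n * (N / (- w + N))) * (N * (N + 1) / ((N + w) * (1 - w + N))))%C
          by (field; repeat split; trivial).
        rewrite IH. field. repeat split; trivial.
    + eapply clim_eq. apply clim_mult. now apply sineprod_lim. apply clim_INR_ratio.
      ring.
Qed.

(** * The functional equation *)

(** Scaled so that e^(2 pi i c z) = q^(z (w + r)) and 1 / (w + r - delta n) = 1 / (delta (c - n)),
    with c this value. *)
Definition qarg (q : R) (w : C) (r : nat) : C := ((w + RtoC (INR r)) / qdelta q)%C.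

(** The double sum over r and n with n = 0 left out, so that nothing becomes singular at w = -r. *)
Definition qtotal (q z : R) (w : C) : C :=
  CS (fun r => bcoef w r * CS (fpair z (qarg q w r)))%C.

(** * Distance of the scaled arguments from the integers *)

Section Delta.
Variable q : R.
Hypotheses (hq0 : 0 < q) (hq1 : q < 1).

Lemma qdelta_imaginary : qdelta q = (Ci * RtoC (2 * PI / ln q))%C.
Proof.
  pose proof (ln_q_neg q hq0 hq1). unfold qdelta.
  rewrite RtoC_div, RtoC_mult by lra. field. C_nz.
Qed.

Lemma qdelta_neq_0 : qdelta q <> 0.
Proof.
  rewrite qdelta_imaginary. apply Cmult_neq_0. apply Ci_nz. apply RtoC_neq.
  pose proof (ln_q_neg q hq0 hq1). pose proof PI_RGT_0.
  apply Rmult_integral_contrapositive_currified. lra. apply Rinv_neq_0_compat. lra.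
Qed.

Lemma Re_qdelta_mult (x : R) : Re (qdelta q * RtoC x) = 0.
Proof. rewrite qdelta_imaginary. unfold Re; simpl; ring. Qed.

Lemma qarg_two_pi (w : C) (r : nat) :
  (RtoC (2 * PI) * Ci * qarg q w r)%C = ((w + RtoC (INR r)) * RtoC (ln q))%C.
Proof.
  pose proof (ln_q_neg q hq0 hq1). pose proof PI_RGT_0.
  unfold qarg, qdelta. rewrite RtoC_mult. field.
  repeat split; try apply Ci_nz; C_nz.
Qed.

Lemma Cmod_inv_qdelta : Cmod (/ qdelta q) = - ln q / (2 * PI).
Proof.
  pose proof (ln_q_neg q hq0 hq1). pose proof PI_RGT_0.
  rewrite Cmod_inv by apply qdelta_neq_0.
  rewrite qdelta_imaginary, Cmod_mult, Cmod_Ci, Cmod_R, Rmult_1_l.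
  unfold Rdiv. rewrite Rabs_mult, Rabs_inv, (Rabs_left (ln q)), Rabs_pos_eq by lra.
  field. lra.
Qed.

Lemma qarg_components (w : C) (r : nat) :
  Re (qarg q w r) = ln q / (2 * PI) * Im w /\
  Im (qarg q w r) = - ln q / (2 * PI) * (Re w + INR r).
Proof.
  pose proof (ln_q_neg q hq0 hq1). pose proof PI_RGT_0.
  assert (E : qarg q w r = ((w + RtoC (INR r)) * (- Ci * RtoC (ln q / (2 * PI))))%C).
  { unfold qarg. rewrite qdelta_imaginary. unfold Cdiv. f_equal.
    replace (- Ci)%C with (/ Ci)%C by apply Ci_inv.
    rewrite !RtoC_div by lra. field. repeat split; try apply Ci_nz; C_nz. }
  rewrite E. destruct w as [a b]. unfold Re, Im; simpl. split; field; lra.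
Qed.

(** As delta is imaginary, the real part of c is the same for all r and its imaginary part grows
    linearly in r: the first keeps c away from large n, the second takes care of large r. The
    finitely many other pairs are left to [pos_family]. *)
Lemma qarg_lower_bound (s : C) :
  (forall (r n : nat), (qarg q s r - RtoC (INR (S n)))%C <> 0 /\
     (qarg q s r + RtoC (INR (S n)))%C <> 0) ->
  exists d, 0 < d /\ forall r n,
    d * (INR (S n) + INR (S r)) <= Cmod (qarg q s r - RtoC (INR (S n))) /\
    d * (INR (S n) + INR (S r)) <= Cmod (qarg q s r + RtoC (INR (S n))).
Proof.
  intros Hs. pose proof (ln_q_neg q hq0 hq1) as Hl. pose proof PI_RGT_0 as Hpi.
  set (k := - ln q / (2 * PI)).
  assert (Hk : 0 < k) by (unfold k; apply Rdiv_lt_0_compat; lra).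
  set (mu := Rmin 1 k). assert (Hmu : 0 < mu) by (apply Rmin_glb_lt; lra).
  assert (Hmu1 : mu <= 1) by apply Rmin_l. assert (Hmu2 : mu <= k) by apply Rmin_r.
  set (m := Rabs (Im s) + Rabs (Re s)).
  assert (Hm : 0 <= m) by (unfold m; pose proof (Rabs_pos (Im s)); pose proof (Rabs_pos (Re s)); lra).
  set (g (n r : nat) := Rmin (Cmod (qarg q s r - RtoC (INR (S n))))
    (Cmod (qarg q s r + RtoC (INR (S n))))).
  destruct (nfloor_ex (2 * k * m / mu)) as [N [_ HN]].
  { apply Rdiv_le_0_compat; nra. }
  destruct (pos_family (S N) g (mu / 4)) as [d [Hd H]].
  - lra.
  - intros n r. unfold g. apply Rmin_glb_lt; apply Cmod_gt_0; apply Hs.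
  - intros n r Hnr. unfold g. apply le_INR in Hnr. rewrite plus_INR, S_INR in Hnr.
    pose proof (pos_INR n) as Hn. pose proof (pos_INR r) as Hr.
    assert (HN2 : 2 * k * m < mu * (INR n + INR r + 1)).
    { apply Rmult_lt_compat_l with (r := mu) in HN. 2: exact Hmu.
      replace (mu * (2 * k * m / mu)) with (2 * k * m) in HN by (field; lra).
      nra. }
    destruct (qarg_components s r) as [E1 E2]. fold k in E2.
    replace (ln q / (2 * PI)) with (- k) in E1 by (unfold k; field; lra).
    assert (Hlow : forall e : R, Rabs e = INR (S n) ->
      mu / 4 * (INR n + INR r + 1) <= Cmod (qarg q s r + RtoC e)).
    { intros e He.
      pose proof (re_le_Cmod (qarg q s r + RtoC e)) as H1.
      pose proof (im_le_Cmod (qarg q s r + RtoC e)) as H2.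
      rewrite Re_plus, re_RtoC, E1 in H1. rewrite Im_plus, im_RtoC, E2, Rplus_0_r in H2.
      pose proof (Rabs_triang_inv e (k * Im s)) as H3.
      replace (e - k * Im s) with (- k * Im s + e) in H3 by ring.
      rewrite He, Rabs_mult, (Rabs_pos_eq k), S_INR in H3 by lra.
      pose proof (Rle_abs (k * (Re s + INR r))) as H4.
      pose proof (Rle_abs (- Re s)) as H5. rewrite Rabs_Ropp in H5.
      assert (H6 : k * Rabs (Im s) + k * Rabs (Re s) = k * m) by (unfold m; ring).
      assert (k * - Re s <= k * Rabs (Re s)) by (apply Rmult_le_compat_l; lra).
      assert (mu * INR r <= k * INR r) by (apply Rmult_le_compat_r; lra).
      assert (mu * (INR n + 1) <= 1 * (INR n + 1)) by (apply Rmult_le_compat_r; lra).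
      lra. }
    pose proof (INR_S_pos n) as HS.
    apply Rmin_glb.
    + replace (qarg q s r - RtoC (INR (S n)))%C with (qarg q s r + RtoC (- INR (S n)))%C
        by (rewrite RtoC_opp; ring).
      apply Hlow. rewrite Rabs_Ropp. apply Rabs_pos_eq. lra.
    + apply Hlow. apply Rabs_pos_eq. lra.
  - exists (d / 2). split. lra. intros r n. specialize (H n r). unfold g in H.
    rewrite !S_INR in *. pose proof (pos_INR n). pose proof (pos_INR r).
    assert (E : d / 2 * (INR n + 1 + (INR r + 1)) <= d * (INR n + INR r + 1)) by nra.
    split; (apply Rle_trans with (1 := E); apply Rle_trans with (1 := H)).
    apply Rmin_l. apply Rmin_r.
Qed.

Lemma qarg_diff (v w : C) (r : nat) :
  Cmod (qarg q v r - qarg q w r) = Cmod (/ qdelta q) * Cmod (v - w).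
Proof.
  rewrite <- Cmod_mult. f_equal. unfold qarg. field. apply qdelta_neq_0.
Qed.

End Delta.

(** * The functional equation near s *)

Section Functional.
Variables (q z : R) (s : C).
Hypotheses (hq0 : 0 < q) (hq1 : q < 1) (hz : 0 < z <= 1) (hs : Re s < 0).
Hypothesis hsr : forall (r : nat) (l : Z), (0 < r)%nat -> l <> 0%Z ->
  s <> (- RtoC (INR r) + qdelta q * RtoC (IZR l))%C.

(** For r > 0 this is [hsr] at -l; for r = 0 it follows from Re s < 0, since delta l is
    imaginary. *)
Lemma s_not_pole (r : nat) (l : Z) : l <> 0%Z ->
  (s + RtoC (INR r) + qdelta q * RtoC (IZR l))%C <> 0.
Proof.
  intros Hl E. destruct r as [|r].
  - apply (f_equal Re) in E. rewrite !Re_plus, Re_qdelta_mult, !re_RtoC in E by assumption.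
    simpl in E. lra.
  - apply (hsr (S r) (- l)). lia. lia. rewrite opp_IZR, RtoC_opp.
    apply Ceq_minus. rewrite <- E. ring.
Qed.

Lemma qarg_s_neq (r n : nat) : (qarg q s r - RtoC (INR (S n)))%C <> 0 /\
  (qarg q s r + RtoC (INR (S n)))%C <> 0.
Proof.
  pose proof (qdelta_neq_0 q hq0 hq1) as Hd. unfold qarg. split; intros E.
  - apply (s_not_pole r (- Z.of_nat (S n))). lia.
    rewrite opp_IZR, <- INR_IZR_INZ, RtoC_opp.
    replace (s + RtoC (INR r) + qdelta q * - RtoC (INR (S n)))%C with
      (((s + RtoC (INR r)) / qdelta q - RtoC (INR (S n))) * qdelta q)%C by (field; exact Hd).
    rewrite E. ring.
  - apply (s_not_pole r (Z.of_nat (S n))). lia. rewrite <- INR_IZR_INZ.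
    replace (s + RtoC (INR r) + qdelta q * RtoC (INR (S n)))%C with
      (((s + RtoC (INR r)) / qdelta q + RtoC (INR (S n))) * qdelta q)%C by (field; exact Hd).
    rewrite E. ring.
Qed.

(** Collects on one disc about s every bound used for exchanging sums and for continuity, uniform in
    w, in r and in the cut-off N. *)
Lemma local_estimates : exists eps d K M, 0 < eps /\ 0 < d /\ 0 <= K /\ summable M /\
  forall w, Cmod (w - s) < eps ->
    Re w < 0 /\ (forall r, Cmod (bcoef w r) <= M r) /\
    forall r, (forall n, d * INR (S n) <= Cmod (qarg q w r - RtoC (INR (S n))) /\
                         d * INR (S n) <= Cmod (qarg q w r + RtoC (INR (S n)))) /\
      (forall N, Cmod (csum (fpair z (qarg q w r)) N) <= K) /\
      filterlim (csum (fpair z (qarg q w r))) eventually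
        (locally (CS (fpair z (qarg q w r)))).
Proof.
  destruct (qarg_lower_bound q hq0 hq1 s qarg_s_neq) as [d [Hd Hlow]].
  destruct (bcoef_majorant s hs) as [e0 [M [He0 [HM Hb]]]].
  set (k := Cmod (/ qdelta q)).
  assert (Hk : 0 < k).
  { unfold k. rewrite Cmod_inv_qdelta by assumption. pose proof (ln_q_neg q hq0 hq1).
    pose proof PI_RGT_0. apply Rdiv_lt_0_compat; lra. }
  set (B := k * (Cmod s + 1)).
  assert (HB : 0 <= B) by (unfold B; pose proof (Cmod_ge_0 s); nra).
  destruct (fpair_uniform_bound z (d / 2) B hz ltac:(lra) HB) as [K HK].
  (* In turn: the majorant of b_r applies, |w| <= |s| + 1, Re w < 0, and the scaled argument moves
     by at most d, which is at most half of the distance d (n + r + 2) available at s. *)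
  set (eps := Rmin (Rmin e0 1) (Rmin (- Re s) (d / k))).
  assert (Heps : 0 < eps).
  { unfold eps. repeat apply Rmin_glb_lt; try lra. now apply Rdiv_lt_0_compat. }
  exists eps, (d / 2), (Rmax K 0), M. split. exact Heps. split. lra.
  split. apply Rmax_r. split. exact HM.
  intros w Hw.
  assert (Hw1 := Rlt_le_trans _ _ _ Hw (Rmin_l _ _)).
  assert (Hw2 := Rlt_le_trans _ _ _ Hw (Rmin_r _ _)).
  assert (Hwe0 := Rlt_le_trans _ _ _ Hw1 (Rmin_l _ _)).
  assert (Hw01 := Rlt_le_trans _ _ _ Hw1 (Rmin_r _ _)).
  assert (HwR := Rlt_le_trans _ _ _ Hw2 (Rmin_l _ _)).
  assert (Hwd := Rlt_le_trans _ _ _ Hw2 (Rmin_r _ _)).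
  split.
  { pose proof (re_le_Cmod (w - s)) as H. rewrite Re_minus in H.
    pose proof (Rle_abs (Re w - Re s)). lra. }
  split. now apply Hb.
  intros r.
  assert (Hlw : forall n, d / 2 * (INR (S n) + INR (S r)) <= Cmod (qarg q w r - RtoC (INR (S n))) /\
    d / 2 * (INR (S n) + INR (S r)) <= Cmod (qarg q w r + RtoC (INR (S n)))).
  { intros n. destruct (Hlow r n) as [L1 L2].
    pose proof (qarg_diff q hq0 hq1 s w r) as HD. fold k in HD.
    rewrite (Cmod_minus_sym s w) in HD.
    assert (HD2 : k * Cmod (w - s) <= d).
    { apply Rle_trans with (k * (d / k)). apply Rmult_le_compat_l; lra. right; field; lra. }
    assert (HS : 2 <= INR (S n) + INR (S r)).
    { rewrite !S_INR. pose proof (pos_INR n). pose proof (pos_INR r). lra. }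
    assert (HS2 : d <= d / 2 * (INR (S n) + INR (S r))) by nra.
    split.
    - pose proof (Cmod_triangle_rev (qarg q s r - RtoC (INR (S n))) (qarg q s r - qarg q w r)) as T.
      replace (qarg q s r - RtoC (INR (S n)) - (qarg q s r - qarg q w r))%C with
        (qarg q w r - RtoC (INR (S n)))%C in T by ring. lra.
    - pose proof (Cmod_triangle_rev (qarg q s r + RtoC (INR (S n))) (qarg q s r - qarg q w r)) as T.
      replace (qarg q s r + RtoC (INR (S n)) - (qarg q s r - qarg q w r))%C with
        (qarg q w r + RtoC (INR (S n)))%C in T by ring. lra. }
  assert (Hlw2 : forall n, d / 2 * INR (S n) <= Cmod (qarg q w r - RtoC (INR (S n))) /\
    d / 2 * INR (S n) <= Cmod (qarg q w r + RtoC (INR (S n)))).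
  { intros n. destruct (Hlw n). pose proof (INR_S_pos r). nra. }
  split. exact Hlw2. split.
  - intros N. apply Rle_trans with (2 := Rmax_l _ _). apply HK with (INR (S r)).
    + rewrite S_INR. pose proof (pos_INR r). lra.
    + unfold qarg, Cdiv. rewrite Cmod_mult. fold k.
      pose proof (Cmod_triangle w (RtoC (INR r))) as T.
      rewrite Cmod_R, Rabs_pos_eq in T by apply pos_INR.
      assert (Hwm : Cmod w <= Cmod s + 1).
      { replace w with ((w - s) + s)%C by ring.
        apply Rle_trans with (1 := Cmod_triangle _ _). lra. }
      pose proof (Cmod_ge_0 s). pose proof (pos_INR r).
      unfold B. rewrite S_INR. rewrite Rmult_comm, Rmult_assoc.
      apply Rmult_le_compat_l. lra. nra.
    + exact Hlw.
  - apply fpair_converges. exact hz.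
    destruct (classic (qarg q w r = 0)) as [E|E]; [now left|right].
    intros [|n].
    + simpl. replace (qarg q w r - 0)%C with (qarg q w r) by ring.
      rewrite Cplus_0_r. now split.
    + destruct (Hlw2 n). pose proof (INR_S_pos n).
      split; apply Cmod_gt_0; nra.
Qed.

Lemma clim_Cmod_le_limit (u : nat -> C) (l : C) (K : R) :
  filterlim u eventually (locally l) -> (forall n, Cmod (u n) <= K) -> Cmod l <= K.
Proof.
  intros H HK. apply (clim_le (F := eventually) u); trivial. now exists O.
Qed.

(** This carries the identity across the removable singularities. Each term is continuous by
    [fpair_lipschitz], and K M r dominates the terms on the whole disc. *)
Lemma qtotal_continuous : filterlim (qtotal q z) (locally s) (locally (qtotal q z s)).
Proof.
  destruct local_estimates as [eps [d [K [M [He [Hd [HK [HM H]]]]]]]].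
  assert (Hnear : locally s (fun w => Cmod (w - s) < eps)).
  { apply locally_C_spec. now exists eps. }
  assert (Hs0 : Cmod (s - s) < eps).
  { replace (s - s)%C with (RtoC 0) by ring. now rewrite Cmod_0. }
  destruct (fpair_lipschitz z d Hd) as [L [HL0 HL]].
  apply (CS_dominated (F := locally s)
    (fun w r => bcoef w r * CS (fpair z (qarg q w r)))%C _ (fun r => K * M r)).
  - now apply summable_scal.
  - revert Hnear. apply filter_imp. intros w Hw r.
    destruct (H w Hw) as [_ [Hb Hr]]. destruct (Hr r) as [_ [HN Hl]].
    rewrite Cmod_mult, Rmult_comm. apply Rmult_le_compat; try apply Cmod_ge_0; trivial.
    now apply clim_Cmod_le_limit with (1 := Hl).
  - intros r. apply clim_mult.
    + destruct (bcoef_quad s r) as [_ [_ Hq]].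
      eapply (cderiv_continuous (fun v => bcoef v r)).
      apply cderiv_second_order with (2 := Hq). lra.
    + apply clim_spec. intros e Hee.
      set (k := Cmod (/ qdelta q)). assert (Hk : 0 <= k) by apply Cmod_ge_0.
      set (e' := e / (L * k + 1)).
      assert (He' : 0 < e') by (apply Rdiv_lt_0_compat; nra).
      apply locally_C_spec. exists (Rmin eps e'). split. now apply Rmin_glb_lt.
      intros w Hw.
      assert (Hw1 := Rlt_le_trans _ _ _ Hw (Rmin_l _ _)).
      assert (Hw2 := Rlt_le_trans _ _ _ Hw (Rmin_r _ _)).
      destruct (proj2 (proj2 (H w Hw1)) r) as [B1 [_ L1]].
      destruct (proj2 (proj2 (H s Hs0)) r) as [B2 [_ L2]].
      apply Rle_lt_trans with (L * (k * Cmod (w - s))).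
      * apply clim_Cmod_le_limit with (1 := clim_minus (F := eventually) _ _ _ _ L1 L2).
        intros N. unfold k. rewrite <- qarg_diff with (r := r) by assumption.
        now apply HL.
      * pose proof (Cmod_ge_0 (w - s)).
        apply Rle_lt_trans with ((L * k + 1) * Cmod (w - s)). nra.
        apply Rlt_le_trans with ((L * k + 1) * e').
        apply Rmult_lt_compat_l; nra. right. unfold e'. field. nra.
Qed.

(** The beta series at x = delta l. Its x Gamma(x) in the denominator supplies both Gamma(delta l)
    and, after cancelling delta against the scaling of [qarg], the factor 1 / l. *)
Lemma summand_eq (l : Z) (M : nat -> R) : summable M ->
  (forall r, Cmod (bcoef s r) <= M r) -> l <> 0%Z ->
  (CGamma (1 - s) * qzeta_summand q z s l)%C =
  CS (fun r => bcoef s r * (Hx (- (2 * IZR l)) z / (qarg q s r + RtoC (IZR l))))%C.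
Proof.
  intros HM Hb Hl. pose proof (qdelta_neq_0 q hq0 hq1) as Hd.
  set (x := (qdelta q * RtoC (IZR l))%C).
  assert (Hl0 : RtoC (IZR l) <> 0).
  { apply RtoC_neq. now apply not_0_IZR. }
  assert (Hxn : forall n, (x + RtoC (INR n))%C <> 0).
  { intros n E. destruct n as [|n].
    - revert E. simpl. rewrite Cplus_0_r. now apply Cmult_neq_0.
    - apply (f_equal Re) in E. unfold x in E.
      rewrite Re_plus, Re_qdelta_mult, !re_RtoC in E by assumption.
      pose proof (INR_S_pos n). lra. }
  assert (E1 : (1 - (1 - s))%C = s) by ring.
  assert (E2 : (x + 1 - (1 - s))%C = (s + x)%C) by ring.
  assert (Hsx : forall n, (s + x + RtoC (INR n))%C <> 0).
  { intros n. replace (s + x + RtoC (INR n))%C with (s + RtoC (INR n) + x)%C by ring.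
    now apply s_not_pole. }
  assert (HB := beta_series (1 - s) x M). rewrite E1, E2 in HB.
  specialize (HB ltac:(rewrite Re_minus, re_RtoC; lra) HM Hb Hxn Hsx).
  destruct (CGamma_spec x Hxn) as [HG _].
  set (e := Hx (- (2 * IZR l)) z).
  assert (Ee : cexp (- (2 * RtoC PI * Ci * RtoC (IZR l) * RtoC z)) = e).
  { unfold e, Hx. f_equal. rewrite !RtoC_mult, RtoC_opp, RtoC_mult. ring. }
  unfold qzeta_summand. fold x. rewrite Ee.
  destruct (shift_lower_bound (s + x) Hsx) as [d0 [Hd0 Hlow]].
  rewrite (CS_ext _ (fun r => (e * qdelta q) * (bcoef s r * / (s + x + RtoC (INR r))))%C).
  - rewrite (CS_scal _ _ (fun r => / d0 * M r)).
    + rewrite HB. unfold x. field. repeat split; trivial.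
    + apply summable_scal. left; now apply Rinv_0_lt_compat. exact HM.
    + intros r. rewrite Cmod_mult, Rmult_comm, Cmod_inv by apply Hsx.
      apply Rmult_le_compat; trivial.
      left. apply Rinv_0_lt_compat. specialize (Hlow r). lra. apply Cmod_ge_0.
      apply Rinv_le_contravar; trivial.
  - intros r. unfold qarg. specialize (Hsx r). unfold x in *.
    assert (H1 : ((s + RtoC (INR r)) + qdelta q * RtoC (IZR l))%C <> 0).
    { intros E. apply Hsx. rewrite <- E. ring. }
    field. repeat split; trivial.
Qed.

(** A finite sum over n passes inside the sum over r, as each single n is dominated by 2 M r / d.
    The limit N -> oo is then taken under the sum over r with the uniform bound K of the Fourier
    partial sums. *)
Lemma pairs_converge : filterlim (csum (qzeta_pairs q z s)) eventually
  (locally (qtotal q z s / CGamma (1 - s))%C).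
Proof.
  destruct local_estimates as [eps [d [K [M [He [Hd [HK [HM H]]]]]]]].
  destruct (H s) as [_ [Hb Hr]].
  { replace (s - s)%C with (RtoC 0) by ring. now rewrite Cmod_0. }
  assert (HG : CGamma (1 - s) <> 0).
  { apply CGamma_spec. intros n. apply Cplus_INR_neq_0. rewrite Re_minus, re_RtoC. lra. }
  assert (Hterm : forall n r, Cmod (bcoef s r * fpair z (qarg q s r) n) <= 2 / d * M r).
  { intros n r. rewrite Cmod_mult, Rmult_comm.
    apply Rmult_le_compat; try apply Cmod_ge_0; trivial.
    destruct (proj1 (Hr r) n) as [L1 L2]. pose proof (INR_S_pos n).
    assert (Hn1 : 1 <= INR (S n)) by (rewrite S_INR; pose proof (pos_INR n); lra).
    assert (d <= d * INR (S n)) by nra.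
    unfold fpair. apply Rle_trans with (1 := Cmod_triangle _ _).
    rewrite !Cmod_div, !Cmod_Hx by (apply Cmod_gt_0; lra).
    assert (G : forall y, d <= y -> 1 / y <= / d).
    { intros y Hy. unfold Rdiv. rewrite Rmult_1_l. apply Rinv_le_contravar; lra. }
    replace (2 / d) with (/ d + / d) by (field; lra).
    apply Rplus_le_compat; apply G; lra. }
  assert (HM2 : summable (fun r => 2 / d * M r)).
  { apply summable_scal. apply Rdiv_le_0_compat; lra. exact HM. }
  apply clim_ext with (fun N => CS (fun r => bcoef s r * csum (fpair z (qarg q s r)) N) *
    / CGamma (1 - s))%C.
  - intros N.
    rewrite (csum_ext (qzeta_pairs q z s) (fun n => / CGamma (1 - s) *
      CS (fun r => bcoef s r * fpair z (qarg q s r) n))%C).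
    + rewrite csum_scal, (CS_csum _ _ N HM2 Hterm), Cmult_comm. f_equal.
      apply CS_ext. intros r. symmetry. apply csum_scal.
    + intros n _.
      assert (E : (CGamma (1 - s) * qzeta_pairs q z s n)%C =
        CS (fun r => bcoef s r * fpair z (qarg q s r) n)%C).
      { unfold qzeta_pairs. rewrite Cmult_plus_distr_l.
        rewrite !(summand_eq _ M) by (trivial; lia).
        rewrite opp_IZR, <- INR_IZR_INZ.
        assert (G : forall (l : R) r, l = INR (S n) \/ l = - INR (S n) ->
          Cmod (bcoef s r * (Hx (- (2 * l)) z / (qarg q s r + RtoC l))) <= / d * M r).
        { intros l r Hl. rewrite Cmod_mult, Rmult_comm.
          apply Rmult_le_compat; try apply Cmod_ge_0; trivial.
          destruct (proj1 (Hr r) n) as [L1 L2]. pose proof (INR_S_pos n).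
          assert (Hn1 : 1 <= INR (S n)) by (rewrite S_INR; pose proof (pos_INR n); lra).
          assert (Hdn : d <= d * INR (S n)) by nra.
          assert (Hlb : d <= Cmod (qarg q s r + RtoC l)).
          { destruct Hl as [-> | ->]. lra.
            replace (qarg q s r + RtoC (- INR (S n)))%C with (qarg q s r - RtoC (INR (S n)))%C
              by (rewrite RtoC_opp; ring). lra. }
          rewrite Cmod_div, Cmod_Hx by (apply Cmod_gt_0; lra).
          unfold Rdiv. rewrite Rmult_1_l. apply Rinv_le_contravar; lra. }
        assert (HM3 : summable (fun r => / d * M r)).
        { apply summable_scal. left; now apply Rinv_0_lt_compat. exact HM. }
        rewrite <- (CS_plus _ _ _ _ HM3 HM3).
        - apply CS_ext. intros r. unfold fpair.
          replace (- (2 * - INR (S n))) with (2 * INR (S n)) by ring.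
          rewrite RtoC_opp. unfold Cminus. ring.
        - intros r. apply G. now left.
        - intros r. apply G. now right. }
      rewrite <- E. field. exact HG.
  - apply clim_mult. 2: apply clim_const.
    apply (CS_dominated (F := eventually)
      (fun N r => bcoef s r * csum (fpair z (qarg q s r)) N)%C _ (fun r => K * M r)).
    + now apply summable_scal.
    + exists O. intros N _ r. rewrite Cmod_mult, Rmult_comm.
      apply Rmult_le_compat; try apply Cmod_ge_0; trivial. apply Hr.
    + intros r. apply clim_mult. apply clim_const. apply Hr.
Qed.

Definition prefactor (w : C) : C :=
  (- (/ (2 * RtoC PI * Ci)) * cpowR (q - q ^ 2) w * cpowR q (- (RtoC z * w)))%C.

(** Inserting the Fourier value splits [qtotal] into three sums over r: the one of [qzG]; the
    subtracted n = 0 terms, which give -delta pi / sin(pi w) and match the correction; and [kap]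
    times sum_r b_r(w) = 0. *)
Lemma qzeta_star_eq (F : C -> C) : is_qzeta_continuation q z F ->
  exists eps, 0 < eps /\ forall w, Cmod (w - s) < eps ->
    (forall n, (w + RtoC (INR n))%C <> 0) ->
    (F w + qzeta_corr q z w)%C = (prefactor w * qtotal q z w)%C.
Proof.
  intros hF.
  destruct local_estimates as [eps [d [K [M [He [Hd [HK [HM H]]]]]]]].
  exists eps. split. exact He. intros w Hw Hn.
  destruct (H w Hw) as [Hre [Hb Hr]].
  pose proof (qdelta_neq_0 q hq0 hq1) as Hde. pose proof (ln_q_neg q hq0 hq1) as Hl.
  pose proof PI_RGT_0 as Hpi.
  assert (Hl0 : RtoC (ln q) <> 0) by C_nz. assert (Hpi0 : RtoC PI <> 0) by C_nz.
  assert (H20 : RtoC 2 <> 0) by C_nz. pose proof Ci_nz as HCi.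
  assert (Hni : forall r, nonint (qarg q w r)).
  { intros r [|n].
    - simpl. replace (qarg q w r - 0)%C with (qarg q w r) by ring. rewrite Cplus_0_r.
      assert (qarg q w r <> 0); [|now split]. unfold qarg. intros E. apply (Hn r).
      replace (w + RtoC (INR r))%C with ((w + RtoC (INR r)) / qdelta q * qdelta q)%C
        by (field; exact Hde).
      rewrite E. ring.
    - destruct (proj1 (Hr r) n). pose proof (INR_S_pos n). split; apply Cmod_gt_0; nra. }
  destruct (fourier_limit z hz) as [kap Hf].
  (* [fourier_limit] also yields e^(2 pi i c) <> 1, which here reads q^(w+r) <> 1. *)
  assert (Hpd : forall r, pden q r w <> 0).
  { intros r E. destruct (Hf _ (Hni r)) as [_ [H1 _]]. apply H1.
    rewrite qarg_two_pi by assumption. unfold pden in E.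
    replace (cexp ((w + RtoC (INR r)) * RtoC (ln q)) - 1)%C with
      (- (1 - cexp ((w + RtoC (INR r)) * RtoC (ln q))))%C by ring.
    rewrite E. ring. }
  rewrite (continuation_eq q z hq0 hq1 ltac:(lra) F hF w Hpd).
  set (X := exp (z * ln q)).
  assert (HX := qz_ratio q z hq0 hq1 ltac:(lra)). fold X in HX.
  set (ew := cexp (w * RtoC (z * ln q))).
  assert (Hew : ew <> 0) by apply cexp_neq_0.
  assert (HV : forall r, CS (fpair z (qarg q w r)) =
    (- (2 * RtoC PI * Ci) * ew * (RtoC (X ^ r) * / pden q r w) +
      - qdelta q * / (w + RtoC (INR r)) + kap)%C).
  { intros r. destruct (Hf _ (Hni r)) as [H1 [H2 _]]. rewrite (CS_unique _ _ H1).
    rewrite qarg_two_pi in * by assumption.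
    assert (E1 : cexp ((w + RtoC (INR r)) * RtoC (ln q) * RtoC z) = (ew * RtoC (X ^ r))%C).
    { unfold ew, X. rewrite exp_pow_INR, <- cexp_RtoC, <- cexp_plus. f_equal.
      rewrite !RtoC_mult. ring. }
    rewrite E1. specialize (Hpd r). unfold pden in *.
    set (y := cexp ((w + RtoC (INR r)) * RtoC (ln q))) in *.
    unfold qarg. specialize (Hn r). rewrite RtoC_mult. field.
    repeat split; trivial. }
  destruct (pden_lower_bound q hq0 hq1 w Hpd) as [e1 [d1 [He1 [Hd1 Hlow1]]]].
  destruct (shift_lower_bound w Hn) as [d2 [Hd2 Hlow2]].
  assert (Hww : Cmod (w - w) < e1).
  { replace (w - w)%C with (RtoC 0) by ring. rewrite Cmod_0. lra. }
  assert (B1 : forall r, Cmod (bcoef w r * RtoC (X ^ r) * / pden q r w) <= / d1 * M r).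
  { intros r. rewrite !Cmod_mult, Cmod_R, Rabs_pos_eq, Rmult_comm by (apply pow_le; lra).
    apply Rmult_le_compat. apply Cmod_ge_0.
    apply Rmult_le_pos. apply Cmod_ge_0. apply pow_le; lra.
    rewrite Cmod_inv by apply Hpd. apply Rinv_le_contravar. exact Hd1. now apply Hlow1.
    rewrite <- (Rmult_1_r (M r)). apply Rmult_le_compat; trivial. apply Cmod_ge_0.
    apply pow_le; lra. rewrite <- (pow1 r). apply pow_incr. lra. }
  assert (B2 : forall r, Cmod (bcoef w r * / (w + RtoC (INR r))) <= / d2 * M r).
  { intros r. rewrite Cmod_mult, Rmult_comm. apply Rmult_le_compat; try apply Cmod_ge_0; trivial.
    rewrite Cmod_inv by apply Hn. apply Rinv_le_contravar; trivial. }
  assert (S1 : summable (fun r => / d1 * M r)).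
  { apply summable_scal. left; now apply Rinv_0_lt_compat. exact HM. }
  assert (S2 : summable (fun r => / d2 * M r)).
  { apply summable_scal. left; now apply Rinv_0_lt_compat. exact HM. }
  assert (B3 : forall c : C, forall a M', (forall r, Cmod (a r) <= M' r) ->
    forall r : nat, Cmod (c * a r) <= Cmod c * M' r).
  { intros c a M' Ha r. rewrite Cmod_mult. apply Rmult_le_compat_l; trivial. apply Cmod_ge_0. }
  assert (S3 : forall (c : C) M', summable M' -> summable (fun r => Cmod c * M' r)).
  { intros c M' HM'. apply summable_scal; trivial. apply Cmod_ge_0. }
  assert (ET : qtotal q z w = (- (2 * RtoC PI * Ci) * ew *
      CS (fun r => bcoef w r * RtoC (X ^ r) * / pden q r w) +
      - qdelta q * (RtoC PI / csin (RtoC PI * w)))%C).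
  { unfold qtotal.
    rewrite (CS_ext _ (fun r =>
      ((- (2 * RtoC PI * Ci) * ew) * (bcoef w r * RtoC (X ^ r) * / pden q r w)) +
      ((- qdelta q) * (bcoef w r * / (w + RtoC (INR r))) + kap * bcoef w r))%C)
      by (intros r; rewrite HV; ring).
    rewrite (CS_plus _ _ _ (fun r => Cmod (- qdelta q) * (/ d2 * M r) + Cmod kap * M r)
      (S3 (- (2 * RtoC PI * Ci) * ew)%C _ S1)).
    - rewrite (CS_plus _ _ _ _ (S3 (- qdelta q)%C _ S2) (S3 kap _ HM)) by (apply B3; trivial).
      rewrite (CS_scal _ _ _ S1 B1), (CS_scal _ _ _ S2 B2), (CS_scal _ _ _ HM Hb).
      rewrite (bcoef_sum_0 w M Hre HM Hb), (reflection_series w M Hre Hn HM Hb). ring.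
    - pose proof (S3 (- qdelta q)%C _ S2) as T1. pose proof (S3 kap _ HM) as T2.
      destruct T1 as [P1 [b1 Q1]], T2 as [P2 [b2 Q2]]. split.
      + intros n. specialize (P1 n). specialize (P2 n). lra.
      + exists (b1 + b2). intros n. specialize (Q1 n). specialize (Q2 n).
        assert (E : forall a b k, rsum (fun r => a r + b r) k = rsum a k + rsum b k).
        { intros a b k. induction k as [|k IH]; simpl. ring. rewrite IH. ring. }
        rewrite E. lra.
    - now apply B3.
    - intros r. apply Rle_trans with (1 := Cmod_triangle _ _).
      apply Rplus_le_compat. now apply (B3 _ _ _ B2). now apply (B3 _ _ _ Hb). }
  rewrite ET. unfold qzG, prefactor, qzeta_corr. fold X.
  assert (Eq : cpowR q (- (RtoC z * w)) = (/ ew)%C).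
  { unfold cpowR, ew. rewrite <- cexp_opp. f_equal. rewrite RtoC_mult. ring. }
  rewrite Eq. unfold qdelta.
  set (T := (RtoC PI / csin (RtoC PI * w))%C).
  field. repeat split; trivial.
Qed.

Lemma clim_prefactor : filterlim prefactor (locally s) (locally (prefactor s)).
Proof.
  apply clim_mult. apply clim_mult. apply clim_const.
  - apply (cderiv_continuous (fun w => cpowR (q - q ^ 2) w)) with
      (1 * RtoC (ln (q - q ^ 2)) * cpowR (q - q ^ 2) s)%C.
    unfold cpowR. eapply cderiv_eq.
    apply (cderiv_cexp_comp (fun v => v * RtoC (ln (q - q ^ 2)))%C).
    apply cderiv_mult. apply cderiv_id. apply cderiv_const. cbv beta. ring.
  - apply (cderiv_continuous (fun w => cpowR q (- (RtoC z * w)))) with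
      (- RtoC z * RtoC (ln q) * cpowR q (- (RtoC z * s)))%C.
    unfold cpowR. eapply cderiv_eq.
    apply (cderiv_cexp_comp (fun v => - (RtoC z * v) * RtoC (ln q))%C).
    apply cderiv_mult. apply cderiv_opp, cderiv_scal, cderiv_id. apply cderiv_const.
    cbv beta. ring.
Qed.

End Functional.

Theorem theorem3 (q z : R) (s : C) (F : C -> C)
  (hq0 : (0 < q)%R) (hq1 : (q < 1)%R)
  (hz0 : (0 < z)%R) (hz1 : (z <= 1)%R)
  (hs : (Re s < 0)%R)
  (hsr : forall (r : nat) (l : Z), (0 < r)%nat -> l <> 0%Z ->
           s <> (- RtoC (INR r) + qdelta q * RtoC (IZR l))%C)
  (hF : is_qzeta_continuation q z F) :
  exists Ssum : C,
    is_series (qzeta_pairs q z s) Ssum /\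
    let RHS := (- (/ (2 * RtoC PI * Ci)) * cpowR (q - q ^ 2) s
                 * cpowR q (- (RtoC z * s)) * CGamma (RtoC 1 - s) * Ssum)%C in
    (* zeta^*(s) = RHS, where zeta^* is continued by continuity at the
       removable singularities s = -1, -2, ... *)
    filterlim (fun w => (F w + qzeta_corr q z w)%C)
      (within (fun w => w <> s) (locally s)) (locally RHS) /\
    ((forall n : nat, s <> RtoC (- INR (S n))) ->
       (F s + qzeta_corr q z s)%C = RHS).
Proof.
  assert (hz : 0 < z <= 1) by lra.
  assert (HG : CGamma (1 - s) <> 0).
  { apply CGamma_spec. intros n. apply Cplus_INR_neq_0. rewrite Re_minus, re_RtoC. lra. }
  exists (qtotal q z s / CGamma (1 - s))%C.
  split. { apply is_series_csum. now apply pairs_converge. }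
  intros RHS.
  assert (E : RHS = (prefactor q z s * qtotal q z s)%C).
  { unfold RHS, prefactor. field. repeat split; trivial.
    apply Ci_nz. pose proof PI_RGT_0. C_nz. }
  rewrite E.
  destruct (qzeta_star_eq q z s hq0 hq1 hz hs hsr F hF) as [eps [He Heq]].
  split.
  - apply filterlim_ext_loc with (fun w => prefactor q z w * qtotal q z w)%C.
    (* If w + n = 0 then [pden q n w] is 1 - q^0 = 0, so a punctured disc free of zeros of the
       denominators also avoids the points -n. *)
    + destruct (pden_isolated q hq0 hq1 s) as [e' [He' Hp]].
      apply locally_C_spec. exists (Rmin eps e'). split. now apply Rmin_glb_lt.
      intros w Hw Hne. symmetry. apply Heq.
      * exact (Rlt_le_trans _ _ _ Hw (Rmin_l _ _)).
      * intros n En. apply (Hp n w).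
        split. apply Cmod_gt_0. now apply Cminus_eq_contra.
        exact (Rlt_le_trans _ _ _ Hw (Rmin_r _ _)).
        unfold pden. rewrite En, Cmult_0_l, cexp_0. ring.
    + apply (filterlim_filter_le_1 (G := within (fun w => w <> s) (locally s))
        (fun w => prefactor q z w * qtotal q z w)%C (filter_le_within _)).
      apply clim_mult. apply clim_prefactor. now apply qtotal_continuous.
  - intros Hns. apply Heq.
    + replace (s - s)%C with (RtoC 0) by ring. now rewrite Cmod_0.
    + intros [|n] En.
      * apply (f_equal Re) in En. rewrite Re_plus, !re_RtoC in En. simpl in En. lra.
      * apply (Hns n). rewrite RtoC_opp. apply Ceq_minus. rewrite <- En. ring.
Qed.
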